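(* Fix $z>0$ and $\gamma\in\mathbb R$, and let $n\to\infty$ through even positive integers, with $\kappa,u,r,p,q,C_{n,k},S_n,P_n,\mathcal Z_n,G_n,A,B,\mathcal I_{z,\gamma}$ as defined in the context. Then: (1) $\mathcal I_{z,\gamma}$ is entire and $G_n(\zeta)\to\mathcal I_{z,\gamma}(\zeta)$ locally uniformly for $\zeta\in\mathbb C$. (2) In particular, $S_n=\mathcal Z_n(1)$ satisfies $$S_n=C_{n,\kappa}\,n^{3/4}\,\mathcal I_{z,\gamma}(0)\,(1+o(1)),$$ and $$\frac{G_n(\zeta)}{G_n(0)}\longrightarrow\frac{\mathcal I_{z,\gamma}(\zeta)}{\mathcal I_{z,\gamma}(0)}$$ locally uniformly on $\mathbb C$. (3) The probability measures $$\nu_n:=\frac1{S_n}\sum_{\ell=-\kappa}^{\kappa}C_{n,\kappa+\ell}\,\delta_{\ell/n^{3/4}}$$ on $\mathbb R$ (where $\delta_x$ is the unit point mass at $x$) converge weakly to the probability measure $$d\nu_{z,\gamma}(x)=\frac1{\mathcal I_{z,\gamma}(0)}\exp\!\left(\gamma x^2-\frac{B(z)}{12}x^4\right)dx .$$ (4) If $U\subset\mathbb C$ is bounded and open and $\partial U$ contains no zero of $\mathcal I_{z,\gamma}$, then for all sufficiently large even $n$ the functions $\zeta\mapsto\mathcal Z_n(e^{\zeta/n^{3/4}})$ and $\zeta\mapsto\mathcal I_{z,\gamma}(\zeta)$ have the same number of zeros in $U$, counted with multiplicity. (5) In particular, if $s_0$ is a simple real zero of $s\mapsto\mathcal I_{z,\gamma}(is)$,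 then there are real numbers $s_n\to s_0$ such that $$P_n(e^{is_n/n^{3/4}})=P_n(e^{-is_n/n^{3/4}})=0$$ (for all sufficiently large even $n$).
   Context: For $0\le k\le n$ and $p\neq 0$, $p^j\ne q^j$ ($1\le j\le n$), the $(p,q)$-binomial coefficient is $$\binom{n}{k}_{p,q}:=\prod_{j=1}^{k}\frac{p^{\,n-k+j}-q^{\,n-k+j}}{p^j-q^j}.$$ For $z>0$ define $$A(z):=z\left(\coth\frac z4-1\right),\qquad B(z):=\frac{z^3\sinh(z/2)}{8\sinh^4(z/4)}>0.$$ For fixed $z>0$, $\gamma\in\mathbb R$ and an even positive integer $n$, put $$\kappa:=\frac n2,\quad u:=\frac{A(z)}2+\frac{\gamma}{\sqrt n},\quad r:=e^{-z/n},\quad p:=e^{-u/n},\quad q:=pr,$$ $$C_{n,k}:=\binom{n}{k}_{p,q},\quad S_n:=\sum_{k=0}^nC_{n,k},\quad P_n(w):=\sum_{k=0}^nC_{n,k}w^k,\quad \mathcal Z_n(w):=w^{-\kappa}P_n(w)\ (w\neq0),$$ $$G_n(\zeta):=\frac{\mathcal Z_n(e^{\zeta/n^{3/4}})}{C_{n,\kappa}\,n^{3/4}},\qquad \zeta\in\mathbb C,$$ $$\mathcal I_{z,\gamma}(\zeta):=\int_{-\infty}^{\infty}\exp\!\left(\zeta x+\gamma x^2-\frac{B(z)}{12}x^4\right)dx,\qquad\zeta\in\mathbb C.$$ *)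

(* Defs.v *)
From HB Require Import structures.
From mathcomp Require Import all_boot all_order all_algebra.
From mathcomp Require Import all_classical all_reals all_analysis.
From mathcomp Require Import measurable_realfun complex.

Set Implicit Arguments.
Unset Strict Implicit.
Unset Printing Implicit Defensive.

Import Order.TTheory GRing.Theory Num.Theory.
Import numFieldNormedType.Exports.

Local Open Scope classical_set_scope.
Local Open Scope ring_scope.
Local Open Scope complex_scope.

(* The complex plane over [R]; the regular-module tag [^o] is what carries the
   topology, uniformity and norm of the field [R[i]]. *)
Notation Cplx R := (R[i]^o).

Definition even_oo : set_system nat := within [set n | ~~ odd n] \oo.

Section ComplexAnalysis.
Context {R : realType}.
Implicit Types (f : Cplx R -> Cplx R) (U : set (Cplx R)).

Definition cexp (w : Cplx R) : Cplx R :=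
  (expR (complex.Re w))%:C * (cos (complex.Im w) +i* sin (complex.Im w)).

Definition Cintegral (f : R -> Cplx R) : Cplx R :=
  (\int[lebesgue_measure]_x complex.Re (f x))
  +i* (\int[lebesgue_measure]_x complex.Im (f x)).

Definition Cintegrable (f : R -> Cplx R) : Prop :=
  lebesgue_measure.-integrable setT (EFin \o (fun x => complex.Re (f x))) /\
  lebesgue_measure.-integrable setT (EFin \o (fun x => complex.Im (f x))).

Definition entire f : Prop := forall w : Cplx R, derivable f w 1.

Definition locally_uniform_cvg (f_ : nat -> Cplx R -> Cplx R)
    (F : set_system nat) f : Prop :=
  forall w : Cplx R, exists2 V : set (Cplx R), nbhs w V &
    {uniform V, f_ @ F --> f}.

Definition boundary U : set (Cplx R) := closure U `\` interior U.

(* [zero_order f w m]: near [w], [f v = (v - w)^m g v] with [g] holomorphic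
   and [g w != 0]; in particular [m = 0] means [f w != 0]. *)
Definition zero_order f (w : Cplx R) (m : nat) : Prop :=
  exists g : Cplx R -> Cplx R,
    [/\ \forall v \near w, derivable g v 1,
        g w != 0
      & \forall v \near w, f v = (v - w) ^+ m * g v].

(* [f] has finitely many zeros in [U], of total multiplicity [N]. *)
Definition zero_count f U (N : nat) : Prop :=
  exists (s : seq (Cplx R)) (m : Cplx R -> nat),
    [/\ uniq s,
        forall w, w \in s <-> U w /\ f w = 0,
        forall w, w \in s -> zero_order f w (m w)
      & N = (\sum_(w <- s) m w)%N].

End ComplexAnalysis.

Definition weak_cvg {R : realType}
    (mu_ : nat -> {measure set (measurableTypeR R) -> \bar R})
    (F : set_system nat)
    (mu : {measure set (measurableTypeR R) -> \bar R}) : Prop :=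
  forall f : R -> R, continuous f -> bounded_fun f ->
    (\int[mu_ n]_x f x) @[n --> F] --> \int[mu]_x f x.

(* Meaningful for [k <= n], [p != 0] and [p ^+ j != q ^+ j] ([1 <= j <= n]): the
   natural-number subtraction [n - k] truncates and [x / 0 = 0]. *)
Definition pq_binomial {F : fieldType} (p q : F) (n k : nat) : F :=
  \prod_(1 <= j < k.+1)
    ((p ^+ (n - k + j) - q ^+ (n - k + j)) / (p ^+ j - q ^+ j)).

Section Model.
Context {R : realType}.
Implicit Types (z g : R) (n k : nat).

Definition sinh (x : R) : R := (expR x - expR (- x)) / 2.
Definition cosh (x : R) : R := (expR x + expR (- x)) / 2.
Definition coth (x : R) : R := cosh x / sinh x.

Definition A_ z : R := z * (coth (z / 4) - 1).
Definition B_ z : R := z ^+ 3 * sinh (z / 2) / (8 * sinh (z / 4) ^+ 4).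

Definition kappa n : nat := n./2.
Definition u_ z g n : R := A_ z / 2 + g / Num.sqrt n%:R.
Definition r_ z n : R := expR (- z / n%:R).
Definition p_ z g n : R := expR (- u_ z g n / n%:R).
Definition q_ z g n : R := p_ z g n * r_ z n.

Definition n34 n : R := n%:R `^ (3 / 4).

Definition C_ z g n k : R := pq_binomial (p_ z g n) (q_ z g n) n k.
Definition S_ z g n : R := \sum_(0 <= k < n.+1) C_ z g n k.
Definition P_ z g n (w : Cplx R) : Cplx R :=
  \sum_(0 <= k < n.+1) (C_ z g n k)%:C * w ^+ k.
Definition Z_ z g n (w : Cplx R) : Cplx R := w ^- kappa n * P_ z g n w.
Definition G_ z g n (zeta : Cplx R) : Cplx R :=
  Z_ z g n (cexp (zeta / (n34 n)%:C)) / (C_ z g n (kappa n) * n34 n)%:C.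

Definition quartic z g (x : R) : R := g * x ^+ 2 - B_ z / 12 * x ^+ 4.

Definition I_integrand z g (zeta : Cplx R) (x : R) : Cplx R :=
  cexp (zeta * x%:C + (quartic z g x)%:C).
Definition I_ z g (zeta : Cplx R) : Cplx R :=
  Cintegral (I_integrand z g zeta).

Lemma C_ge0 z g n k : 0 <= C_ z g n k.
Proof.
apply: prodr_ge0 => j _; rewrite /q_.
set p := p_ _ _ _; set r := r_ _ _.
have p0 : 0 <= p by exact: expR_ge0.
have r0 : 0 <= r by exact: expR_ge0.
have E i : p ^+ i - (p * r) ^+ i = p ^+ i * (1 - r ^+ i).
  by rewrite exprMn mulrBr mulr1.
rewrite !E; have [r1|/ltW r1] := leP r 1.
  by apply: divr_ge0; apply: mulr_ge0; rewrite ?exprn_ge0// subr_ge0 exprn_ile1.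
by apply: mulr_le0; rewrite ?invr_le0; apply: mulr_ge0_le0;
  rewrite ?exprn_ge0// subr_le0 exprn_ege1.
Qed.

Lemma invS_ge0 z g n : 0 <= (S_ z g n)^-1.
Proof. by rewrite invr_ge0; apply: sumr_ge0 => k _; exact: C_ge0. Qed.

(* Indexed by [k = kappa n + l], with [l] from [- kappa n] to [kappa n]. *)
Definition nu_ z g n : {measure set (measurableTypeR R) -> \bar R} :=
  mscale (NngNum (invS_ge0 z g n))
    (msum (fun k => mscale (NngNum (C_ge0 z g n k))
             (dirac ((k%:R - (kappa n)%:R) / n34 n : measurableTypeR R)))
          n.+1).

Definition nu_density z g (x : R) : R :=
  (complex.Re (I_ z g 0))^-1 * expR (quartic z g x).

Definition nu_limit z g : set (measurableTypeR R) -> \bar R :=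
  fun V => (\int[lebesgue_measure]_(x in V) (nu_density z g x)%:E)%E.

Lemma nu_density_ge0 z g x : 0 <= nu_density z g x.
Proof.
apply: mulr_ge0; last exact: expR_ge0.
rewrite invr_ge0 /= /Rintegral fine_ge0//; apply: integral_ge0 => y _.
rewrite lee_fin /I_integrand /cexp /= !mul0r !addr0 oppr0 add0r.
by rewrite cos0 mulr1 addr0 expR_ge0.
Qed.

Lemma measurable_nu_density z g :
  measurable_fun setT (nu_density z g : measurableTypeR R -> R).
Proof.
apply: measurable_funM; first exact: measurable_cst.
apply: measurableT_comp => //; rewrite /quartic.
apply: measurable_funB; apply: measurable_funM => //; exact: measurable_funX.
Qed.

Let nu_limit0 z g : nu_limit z g set0 = 0%E.
Proof. exact: integral_set0. Qed.

Let nu_limit_ge0 z g V : (0 <= nu_limit z g V)%E.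
Proof. by apply: integral_ge0 => x _; rewrite lee_fin nu_density_ge0. Qed.

Let nu_limit_sigma_additive z g : semi_sigma_additive (nu_limit z g).
Proof.
apply: semi_sigma_additive_nng_induced.
  by apply/measurable_EFinP; exact: measurable_nu_density.
by move=> x; rewrite lee_fin nu_density_ge0.
Qed.

HB.instance Definition _ z g := isMeasure.Build _ _ _ (nu_limit z g)
  (nu_limit0 z g) (nu_limit_ge0 z g) (@nu_limit_sigma_additive z g).

End Model.

(* Main.v *)
From HB Require Import structures.
Require Import Defs.
From mathcomp Require Import all_boot all_order all_algebra.
From mathcomp Require Import all_classical all_reals all_analysis.
From mathcomp Require Import measurable_realfun complex.
From mathcomp Require Import ring lra zify.

(** The weights. Put [n = 2 m]. Divided by the central one, the coefficient at
distance [l] from the centre is a product of ratios of neighbours, and the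
logarithm of the [i]-th ratio is [u s + z s / 2 - ln (sinh (a + b) / sinh (a - b))]
with [s = (2 i + 1) / n], [b = (z / 4) s] and [a] close to [z / 4]. The last
logarithm is [2 coth a * b + cubic_coef a * b ^ 3 + O(b ^ 5)], and the first two
terms are a lower bound on the whole range [0 <= b < a] ([ln_sinh_quot_ge],
[ln_sinh_quot_le]). After summation over [i < l], with [x = l / n ^ (3/4)], the
linear terms would be of order [sqrt n * x ^ 2]; the choice of [u] cancels them up
to [g x ^ 2], and the cubic terms add up to [- B x ^ 4 / 12]. So the relative
coefficients converge to [expR (quartic x)] ([outer_ratio_cvg]), and since the lower
bound holds on the whole range they are dominated, for all [l] at once, by a fixed
function with a negative quartic exponent ([outer_ratio_dominated]).

The integrals. The relative coefficients at the sites [l / n ^ (3/4)] define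
Riemann sums. Dominated convergence for the corresponding step functions gives
their convergence to the integral against [expR (quartic x)], for every continuous
test function of at most exponential growth ([riemann_sum_dominated_cvg]). Bounded
continuous functions are among these, which is the weak convergence of the measures.

The transforms. [G_n] and [I] are the Laplace transforms [L (cexp (zeta x))] of
two positive functionals [L], the Riemann sum and the limit integral. Such a
transform is the power series with coefficients [L (x ^ k) / k!]
([pseval_moment]), and convergence of the functionals implies convergence of these
Taylor sequences in every weighted l1 norm ([coef_cvg_moment]). Locally uniform
convergence follows at once.

The zeros. Entire functions are represented by their Taylor sequences, so that
Hurwitz' theorem can be proved without contour integrals. An entire function that
is not identically zero has finitely many zeros in a disc, because each division
by [v - w] gains a factor in a weighted norm ([disc_factorization]). Each zero of
the limit attracts a zero of the approximations, because a nonzero value is not a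
local minimum of the modulus ([zero_persists]). Dividing both zeros out preserves
convergence, and induction matches all zeros ([hurwitz_factorization]).

The real zeros. The coefficients are symmetric about the centre, so [G_n] and [I]
are real on the imaginary axis. There a simple zero of [I] is a change of sign,
which the approximations inherit, and the intermediate value theorem applies
([real_zeros]). *)

Import Order.TTheory GRing.Theory Num.Theory.
Import numFieldNormedType.Exports.
Import Normc.

Set Implicit Arguments.
Unset Strict Implicit.
Unset Printing Implicit Defensive.

Local Open Scope classical_set_scope.
Local Open Scope ring_scope.
Local Open Scope complex_scope.

(** * The modulus of complex numbers *)

Section Modulus.
Context {R : realType}.
Implicit Types (x y v w : R[i]) (r M e : R).

Lemma normc_ge0 x : 0 <= normc x.
Proof. by case: x => a b /=; exact: sqrtr_ge0. Qed.

Lemma normcD x y : normc (x + y) <= normc x + normc y.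
Proof. exact: le_normcD. Qed.

Lemma normc_opp x : normc (- x) = normc x.
Proof. exact: normcN. Qed.

Lemma normcB x y : normc (x - y) <= normc x + normc y.
Proof. by rewrite -(normc_opp y); exact: normcD. Qed.

Lemma normc_distC x y : normc (x - y) = normc (y - x).
Proof. by rewrite -normc_opp opprB. Qed.

Lemma normc_distD y x w : normc (x - w) <= normc (x - y) + normc (y - w).
Proof. by apply: le_trans (normcD _ _); rewrite addrA subrK. Qed.

Lemma normcX x n : normc (x ^+ n) = normc x ^+ n.
Proof. by elim: n => [|n IH]; rewrite ?expr0 ?normc1// !exprS normcM IH. Qed.

Lemma normc_sum (I : Type) (s : seq I) (P : pred I) (F : I -> R[i]) :
  normc (\sum_(i <- s | P i) F i) <= \sum_(i <- s | P i) normc (F i).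
Proof.
elim/big_rec2: _ => [|i y x _ H]; first by rewrite normc0.
by apply: le_trans (normcD _ _) _; rewrite lerD2l.
Qed.

Lemma normc_real (a : R) : normc a%:C = `|a|.
Proof. by rewrite /= expr0n addr0 sqrtr_sqr. Qed.

Lemma normc_gt0 x : (0 < normc x) = (x != 0).
Proof.
rewrite lt_neqAle normc_ge0 andbT eq_sym; congr (~~ _).
by apply/eqP/eqP => [/eq0_normc//|->]; exact: normc0.
Qed.

Lemma normc_eq0 x : (normc x == 0) = (x == 0).
Proof. by apply: negb_inj; rewrite -normc_gt0 lt0r normc_ge0 andbT. Qed.

Lemma normc_Re x : `|complex.Re x| <= normc x.
Proof.
case: x => a b /=; rewrite -sqrtr_sqr; apply: ler_wsqrtr.
by rewrite lerDl sqr_ge0.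
Qed.

Lemma normc_Im x : `|complex.Im x| <= normc x.
Proof.
case: x => a b /=; rewrite -sqrtr_sqr; apply: ler_wsqrtr.
by rewrite lerDr sqr_ge0.
Qed.

Lemma normc_le_ReIm x : normc x <= `|complex.Re x| + `|complex.Im x|.
Proof.
rewrite [in leLHS](complexE x); apply: le_trans (normcD _ _) _.
rewrite normcM !normc_real /= expr0n add0r expr1n sqrtr1 mul1r.
by [].
Qed.

(** The norm of the complex plane takes its values in [R[i]]; here radii are real. *)
Lemma nbhs_normcP (w : Cplx R) (V : set (Cplx R)) :
  nbhs w V <-> exists2 e : R, 0 < e & forall v, normc (v - w) < e -> V v.
Proof.
split.
- move=> /nbhs_ballP[e /= e0 H]; have eR : e \is Num.real by exact: gtr0_real.
  exists (complex.Re e) => [|v Hv].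
    by move: e0; rewrite -(RRe_real eR) ltcR.
  apply: H; rewrite /ball /= -(RRe_real eR).
  by rewrite distrC -[`|_|]/((normc (v - w))%:C) ltcR.
- move=> [e e0 H]; apply/nbhs_ballP; exists e%:C; first by rewrite /= ltcR.
  move=> v; rewrite /ball /= distrC -[`|_|]/((normc (v - w))%:C) ltcR.
  exact: H.
Qed.

End Modulus.

Arguments normc : simpl never.

Lemma cvg_sub_limit {R : realType} {T : Type} {F : set_system T} {FF : Filter F}
  (f : T -> R) (l : R) : f x @[x --> F] --> l -> (f x - l) @[x --> F] --> (0 : R).
Proof. by rewrite -[X in _ -> _ --> X](subrr l) => h; apply: cvgB => //; exact: cvg_cst. Qed.

(** * Entire functions through their Taylor sequences *)

Definition partial_sum {R : realType} (a : nat -> R[i]) v N : R[i] :=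
  \sum_(k < N) a k * v ^+ k.

(** Real and imaginary parts are limits in [R], where Cauchy sequences are known to
converge; locking keeps unification from unfolding the limits. *)
HB.lock Definition pseval (R : realType) (a : nat -> R[i]) (v : R[i]) : R[i] :=
  (lim (complex.Re (partial_sum a v n) @[n --> \oo])) +i*
  (lim (complex.Im (partial_sum a v n) @[n --> \oo])).

Section PowerSeries.
Context {R : realType}.
Implicit Types (a b c : nat -> R[i]) (v w z : R[i]) (r M e : R).

(** Bounding all partial sums by [M] states both the convergence of the weighted
series and the inequality for its sum. *)
Definition l1_le a r M := forall N, \sum_(k < N) normc (a k) * r ^+ k <= M.

(** The Taylor sequences of entire functions. *)
Definition entire_coef a := forall r, 0 < r -> exists M, l1_le a r M.

Lemma l1_le_ge0 a r M : l1_le a r M -> 0 <= M.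
Proof. by move=> /(_ 0%N); rewrite big_ord0. Qed.

Lemma l1_le_weaken a r M M' : M <= M' -> l1_le a r M -> l1_le a r M'.
Proof. by move=> h H N; apply: le_trans (H N) h. Qed.

Lemma l1_le_radius a r r' M : 0 <= r' -> r' <= r -> l1_le a r M -> l1_le a r' M.
Proof.
move=> r0 rr H N; apply: le_trans (H N); apply: ler_sum => k _.
by apply: ler_wpM2l; rewrite ?normc_ge0// lerXn2r// nnegrE (le_trans r0).
Qed.

Lemma l1_le_term a r M k : 0 <= r -> l1_le a r M -> normc (a k) * r ^+ k <= M.
Proof.
move=> r0 /(_ k.+1); rewrite big_ord_recr /=; apply: le_trans.
by rewrite lerDr sumr_ge0// => i _; rewrite mulr_ge0 ?normc_ge0// exprn_ge0.
Qed.

Lemma l1_le_segment a r M N N' : 0 <= r -> (N <= N')%N -> l1_le a r M ->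
  \sum_(N <= k < N') normc (a k) * r ^+ k <= M.
Proof.
move=> r0 NN /(_ N'); rewrite -(big_mkord xpredT (fun k => normc (a k) * r ^+ k)).
rewrite (big_cat_nat (leq0n N) NN) /=; apply: le_trans.
by rewrite lerDr sumr_ge0// => i _; rewrite mulr_ge0 ?normc_ge0// exprn_ge0.
Qed.

(** The weight [r ^ k] absorbs [normc v ^ k] up to the factor [(normc v / r) ^ k],
which is largest at [k = N]. *)
Lemma partial_sum_tail a r M v N N' : 0 < r -> normc v <= r -> l1_le a r M ->
  (N <= N')%N ->
  normc (partial_sum a v N' - partial_sum a v N) <= M * (normc v / r) ^+ N.
Proof.
move=> r0 vr H NN; rewrite /partial_sum.
rewrite -(big_mkord xpredT (fun k => a k * v ^+ k)) (big_cat_nat (leq0n N) NN) /=.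
rewrite big_mkord addrAC subrr add0r.
apply: le_trans (normc_sum _ _ _) _.
have q0 : 0 <= normc v / r by rewrite divr_ge0 ?normc_ge0// ltW.
have q1 : normc v / r <= 1 by rewrite ler_pdivrMr// mul1r.
apply: (@le_trans _ _
  ((\sum_(N <= k < N') normc (a k) * r ^+ k) * (normc v / r) ^+ N)); last first.
  by apply: ler_wpM2r; [exact: exprn_ge0|apply: l1_le_segment (ltW r0) NN H].
rewrite mulr_suml [leLHS]big_seq [leRHS]big_seq; apply: ler_sum => k.
rewrite mem_index_iota => /andP[Nk _].
rewrite normcM normcX -[leRHS]mulrA; apply: ler_wpM2l; first exact: normc_ge0.
have -> : normc v ^+ k = r ^+ k * (normc v / r) ^+ k.
  by rewrite -exprMn mulrC divfK ?gt_eqF.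
apply: ler_wpM2l; first by rewrite exprn_ge0// ltW.
exact: ler_wiXn2l.
Qed.

Let cvg0_geometric (u : nat -> R) M q : 0 <= q < 1 ->
  (forall n, 0 <= u n <= M * q ^+ n) -> u n @[n --> \oo] --> 0.
Proof.
move=> /andP[q0 q1] H.
apply: (@squeeze_cvgr _ _ _ _ (fun=> 0) (fun n => M * q ^+ n)).
- exact: nearW.
- exact: cvg_cst.
- rewrite -[X in _ --> X](mulr0 M); apply: cvgMr; apply: cvg_expr.
  by rewrite ger0_norm.
Qed.

Let cvg_geometric (u : nat -> R) M q : 0 <= q < 1 ->
  (forall N N', (N <= N')%N -> `|u N' - u N| <= M * q ^+ N) ->
  cvgn u.
Proof.
move=> Hq H; apply/cauchy_cvgP/cauchy_exP => e /= e0.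
have M0 : 0 <= M.
  by have := H 0%N 0%N (leqnn _); rewrite expr0 mulr1; apply: le_trans.
have /cvgrPdist_lt/(_ _ e0) : M * q ^+ n @[n --> \oo] --> 0.
  by apply: (cvg0_geometric Hq (M := M)) => n; case/andP: Hq => q0 _;
    rewrite lexx mulr_ge0// exprn_ge0.
move=> [N _ HN]; exists (u N); exists N => // n /= Nn.
rewrite /ball /= distrC; apply: le_lt_trans (H _ _ Nn) _.
have := HN N (leqnn N); rewrite /= sub0r normrN; apply: le_lt_trans; exact: ler_norm.
Qed.

Lemma pseval_cvg_ReIm a v : entire_coef a ->
  complex.Re (partial_sum a v n) @[n --> \oo] --> complex.Re (pseval a v) /\
  complex.Im (partial_sum a v n) @[n --> \oo] --> complex.Im (pseval a v).
Proof.
move=> Ha; have r0 : 0 < 2 * normc v + 1.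
  by rewrite ltr_wpDl// mulr_ge0// normc_ge0.
have [M HM] := Ha _ r0.
have vr : normc v <= 2 * normc v + 1 by have := normc_ge0 v; lra.
have q : 0 <= normc v / (2 * normc v + 1) < 1.
  rewrite divr_ge0 ?normc_ge0 ?(ltW r0)//= ltr_pdivrMr// mul1r.
  by have := normc_ge0 v; lra.
rewrite pseval.unlock; split; apply: (cvg_geometric q) => N N' NN;
  (apply: le_trans (partial_sum_tail r0 vr HM NN)).
  by rewrite -raddfB; exact: normc_Re.
by rewrite -raddfB; exact: normc_Im.
Qed.

Lemma pseval_cvg a v : entire_coef a ->
  normc (partial_sum a v n - pseval a v) @[n --> \oo] --> 0.
Proof.
move=> /(pseval_cvg_ReIm v)[cR cI].
apply: (@squeeze_cvgr _ _ _ _ (fun=> 0) (fun n =>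
  `|complex.Re (partial_sum a v n) - complex.Re (pseval a v)| +
  `|complex.Im (partial_sum a v n) - complex.Im (pseval a v)|)).
- apply: nearW => n; rewrite normc_ge0/=; apply: le_trans (normc_le_ReIm _) _.
  by rewrite !raddfB.
- exact: cvg_cst.
- have := cvgD (cvg_norm (cvg_sub_limit cR)) (cvg_norm (cvg_sub_limit cI)).
  by rewrite normr0 addr0; exact.
Qed.

Lemma pseval_tail a v r M N : entire_coef a -> l1_le a r M -> 0 < r -> normc v <= r ->
  normc (pseval a v - partial_sum a v N) <= M * (normc v / r) ^+ N.
Proof.
move=> Ha HM r0 vr.
have h := pseval_cvg v Ha.
apply/ler_addgt0Pr => e e0; move/cvgrPdist_lt/(_ _ e0): h => [N1 _ HN1].
have := HN1 (maxn N N1) (leq_maxr _ _); rewrite /= sub0r normrN ger0_norm ?normc_ge0// => h.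
apply: le_trans (normc_distD (partial_sum a v (maxn N N1)) _ _) _.
rewrite addrC lerD//; first exact: partial_sum_tail (leq_maxl _ _).
by rewrite normc_distC ltW.
Qed.

Lemma pseval_bound a v r M : entire_coef a -> l1_le a r M -> 0 < r -> normc v <= r ->
  normc (pseval a v) <= M.
Proof.
move=> Ha HM r0 vr; have := pseval_tail 0 Ha HM r0 vr.
by rewrite expr0 mulr1 /partial_sum big_ord0 subr0.
Qed.

Lemma pseval_unique a v l : entire_coef a ->
  normc (partial_sum a v n - l) @[n --> \oo] --> 0 ->
  pseval a v = l.
Proof.
move=> Ha H; apply/eqP; rewrite -subr_eq0 -normc_eq0.
apply/eqP/le_anti; rewrite normc_ge0 andbT.
have h1 : normc (partial_sum a v n - pseval a v) + normc (partial_sum a v n - l)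
    @[n --> \oo] --> (0 + 0 : R) by apply: cvgD => //; exact: pseval_cvg.
rewrite -[leRHS]addr0; apply: (ler_cvg_to (cvg_cst (normc (pseval a v - l))) h1).
apply: nearW => n; rewrite (normc_distC _ (pseval a v)); exact: normc_distD.
Qed.

(** Terms that are bounded at the radius [2 * r] decay like [2 ^- k] at [r]. *)
Lemma entire_coef_geometric a :
  (forall r, 0 < r -> exists M, forall k, normc (a k) * r ^+ k <= M) ->
  entire_coef a.
Proof.
move=> H r r0; have [M HM] := H _ (mulr_gt0 (ltr0n R 2) r0).
have M0 : 0 <= M by apply: le_trans (HM 0%N); rewrite expr0 mulr1 normc_ge0.
exists (2 * M) => N.
apply: (@le_trans _ _ (\sum_(k < N) M * 2^-1 ^+ k)).
  apply: ler_sum => k _; rewrite exprVn ler_pdivlMr ?exprn_gt0//.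
  by rewrite -mulrA -exprMn [r * 2]mulrC.
rewrite -mulr_sumr mulrC ler_wpM2r//.
have -> : \sum_(k < N) 2^-1 ^+ k = 2 - 2 * 2^-1 ^+ N :> R.
  elim: N => [|N IH]; first by rewrite big_ord0 expr0; lra.
  by rewrite big_ord_recr /= IH exprS; field.
by rewrite lerBlDr lerDl mulr_ge0// exprn_ge0.
Qed.

Lemma entire_coefD a b : entire_coef a -> entire_coef b -> entire_coef (fun k => a k + b k).
Proof.
move=> Ha Hb r r0; have [M HM] := Ha _ r0; have [M' HM'] := Hb _ r0.
exists (M + M') => N; apply: le_trans (lerD (HM N) (HM' N)).
rewrite -big_split /=; apply: ler_sum => k _; rewrite -mulrDl.
by apply: ler_wpM2r; [rewrite exprn_ge0// ltW|exact: normcD].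
Qed.

Lemma l1_leZ (x : R[i]) a r M : l1_le a r M -> l1_le (fun k => x * a k) r (normc x * M).
Proof.
move=> H N; apply: le_trans (ler_wpM2l (normc_ge0 x) (H N)).
by rewrite mulr_sumr; apply: ler_sum => k _; rewrite normcM mulrA.
Qed.

Lemma l1_leD a b r M M' : 0 <= r -> l1_le a r M -> l1_le b r M' ->
  l1_le (fun k => a k + b k) r (M + M').
Proof.
move=> r0 HM HM' N; apply: le_trans (lerD (HM N) (HM' N)).
rewrite -big_split /=; apply: ler_sum => k _; rewrite -mulrDl.
by apply: ler_wpM2r; [rewrite exprn_ge0|exact: normcD].
Qed.

Lemma entire_coefZ (x : R[i]) a : entire_coef a -> entire_coef (fun k => x * a k).
Proof. by move=> Ha r /Ha[M HM]; exists (normc x * M); exact: l1_leZ. Qed.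

Lemma entire_coefB a b : entire_coef a -> entire_coef b -> entire_coef (fun k => a k - b k).
Proof.
move=> Ha Hb; have := entire_coefD Ha (entire_coefZ (-1) Hb); congr entire_coef.
by apply/funext => k; rewrite mulN1r.
Qed.

Lemma psevalD a b v : entire_coef a -> entire_coef b ->
  pseval (fun k => a k + b k) v = pseval a v + pseval b v.
Proof.
move=> Ha Hb; apply: pseval_unique; first exact: entire_coefD.
have h : normc (partial_sum a v n - pseval a v) + normc (partial_sum b v n - pseval b v)
    @[n --> \oo] --> (0 + 0 : R) by apply: cvgD; exact: pseval_cvg.
rewrite addr0 in h; apply: (squeeze_cvgr _ (cvg_cst 0) h).
apply: nearW => n; rewrite normc_ge0/=; apply: le_trans (normcD _ _).
suff -> : partial_sum (fun k => a k + b k) v n = partial_sum a v n + partial_sum b v n.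
  by rewrite opprD addrACA.
by rewrite -big_split /=; apply: eq_bigr => k _; rewrite mulrDl.
Qed.

Lemma psevalZ (x : R[i]) a v : entire_coef a ->
  pseval (fun k => x * a k) v = x * pseval a v.
Proof.
move=> Ha; apply: pseval_unique; first exact: entire_coefZ.
have h : normc x * normc (partial_sum a v n - pseval a v) @[n --> \oo] --> (normc x * 0 : R).
  by apply: cvgMr; exact: pseval_cvg.
rewrite mulr0 in h; apply: cvg_trans h; apply: near_eq_cvg; apply: nearW => n.
rewrite -normcM mulrBr; congr (normc (_ - _)).
by rewrite /partial_sum mulr_sumr; apply: eq_bigr => k _; rewrite mulrA.
Qed.

Lemma psevalB a b v : entire_coef a -> entire_coef b ->
  pseval (fun k => a k - b k) v = pseval a v - pseval b v.
Proof.
move=> Ha Hb; have := psevalD v Ha (entire_coefZ (-1) Hb); rewrite psevalZ// mulN1r => <-.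
by congr pseval; apply/funext => k; rewrite mulN1r.
Qed.

(** The Taylor sequence of [(v - z) * f v]. *)
Definition mul_lin z c k : R[i] := (if k is k'.+1 then c k' else 0) - z * c k.

Definition coef_shift a m k : R[i] := a (k + m)%N.

(** The Taylor sequence of [(f v - f z) / (v - z)]: expanding each
[(v ^ j - z ^ j) / (v - z)] and collecting [v ^ k] leaves
[\sum_i a (k + 1 + i) * z ^ i]. *)
Definition div_lin a z k : R[i] := pseval (coef_shift a k.+1) z.

Lemma l1_le_shift a r M m : 0 < r -> l1_le a r M -> l1_le (coef_shift a m) r (M / r ^+ m).
Proof.
move=> r0 H N; rewrite ler_pdivlMr ?exprn_gt0// mulr_suml.
apply: le_trans (l1_le_segment (ltW r0) (leq_addl N m) H).
rewrite -[X in \sum_(X <= _ < _) _]add0n big_addn addnK big_mkord; apply: ler_sum => k _.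
by rewrite /coef_shift -mulrA exprD.
Qed.

Lemma entire_coef_shift a m : entire_coef a -> entire_coef (coef_shift a m).
Proof. by move=> H r r0; have [M /(l1_le_shift m r0)] := H r r0; exists (M / r ^+ m). Qed.

Lemma partial_sumS a v N : partial_sum a v N.+1 = partial_sum a v N + a N * v ^+ N.
Proof. by rewrite /partial_sum big_ord_recr. Qed.

(** The product telescopes up to one boundary term. *)
Lemma partial_sum_mul_lin z c v N :
  partial_sum (mul_lin z c) v N.+1 = (v - z) * partial_sum c v N.+1 - c N * v ^+ N.+1.
Proof.
elim: N => [|N IH].
  by rewrite /partial_sum !big_ord_recr !big_ord0 /= /mul_lin /= !expr0 expr1; ring.
by rewrite partial_sumS IH [partial_sum c v N.+2]partial_sumS /mul_lin !exprS; ring.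
Qed.

Lemma entire_coef_mul_lin z c : entire_coef c -> entire_coef (mul_lin z c).
Proof.
move=> Hc; have h : entire_coef (fun k => if k is k'.+1 then c k' else 0).
  apply: entire_coef_geometric => r r0; have [M HM] := Hc r r0; exists (M * r) => -[|k].
    by rewrite normc0 mul0r mulr_ge0 ?(l1_le_ge0 HM)// ltW.
  by rewrite exprSr mulrA ler_wpM2r ?(ltW r0)// l1_le_term// ltW.
exact: entire_coefB h (entire_coefZ z Hc).
Qed.

Let term_cvg0 c v : entire_coef c -> normc (c n * v ^+ n.+1) @[n --> \oo] --> (0:R).
Proof.
move=> Hc; have r0 : 0 < 2 * normc v + 1.
  by rewrite ltr_wpDl// mulr_ge0// normc_ge0.
have [M HM] := Hc _ r0.
apply: (@cvg0_geometric _ (M * normc v) (normc v / (2 * normc v + 1))).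
  rewrite divr_ge0 ?normc_ge0 ?(ltW r0)//= ltr_pdivrMr// mul1r.
  by have := normc_ge0 v; lra.
move=> n; rewrite normc_ge0/= normcM normcX exprSr.
set s := 2 * normc v + 1 in r0 HM *.
have -> : normc v ^+ n = s ^+ n * (normc v / s) ^+ n.
  by rewrite -exprMn mulrC divfK ?gt_eqF.
rewrite (_ : _ * _ = normc (c n) * s ^+ n * ((normc v / s) ^+ n * normc v)); last by ring.
rewrite -[leRHS]mulrA [normc v * (_ ^+ _) in leRHS]mulrC.
apply: ler_wpM2r; last exact: l1_le_term (ltW r0) HM.
by rewrite mulr_ge0 ?exprn_ge0 ?divr_ge0 ?normc_ge0// ltW.
Qed.

Lemma pseval_mul_lin z c v : entire_coef c -> pseval (mul_lin z c) v = (v - z) * pseval c v.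
Proof.
move=> Hc; apply: pseval_unique; first exact: entire_coef_mul_lin.
rewrite -cvg_shiftS /=.
have h1 : normc (partial_sum c v n.+1 - pseval c v) @[n --> \oo] --> (0:R).
  by rewrite (cvg_shiftS (fun n => normc (partial_sum c v n - pseval c v))); exact: pseval_cvg.
have h : normc (v - z) * normc (partial_sum c v n.+1 - pseval c v) + normc (c n * v ^+ n.+1)
    @[n --> \oo] --> (normc (v - z) * 0 + 0 : R).
  by apply: cvgD; [exact: cvgMr|exact: term_cvg0].
rewrite mulr0 addr0 in h; apply: (squeeze_cvgr _ (cvg_cst 0) h).
apply: nearW => n; rewrite normc_ge0/= partial_sum_mul_lin -normcM.
by apply: le_trans (normcB _ _); rewrite mulrBr addrAC.
Qed.

Lemma pseval_const (x : R[i]) v :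
  entire_coef (fun k => if k is 0%N then x else 0) /\
  pseval (fun k => if k is 0%N then x else 0) v = x.
Proof.
have H : entire_coef (fun k => if k is 0%N then x else 0).
  apply: entire_coef_geometric => r r0; exists (normc x) => -[|i].
    by rewrite expr0 mulr1.
  by rewrite normc0 mul0r normc_ge0.
split => //; apply: pseval_unique => //; apply: cvg_near_cst; exists 1%N => // n /= n0.
rewrite /partial_sum; case: n n0 => // n _; rewrite big_ord_recl expr0 mulr1.
by rewrite big1 ?addr0 ?subrr ?normc0// => i _; rewrite mul0r.
Qed.

(** Horner's recursion for the tail of the series. *)
Lemma pseval_shift a z k : entire_coef a ->
  pseval (coef_shift a k) z = a k + z * pseval (coef_shift a k.+1) z.
Proof.
move=> Ha.
have := pseval_mul_lin 0 z (entire_coef_shift k.+1 Ha); rewrite subr0 => <-.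
have [h1 {1}<-] := pseval_const (a k) z.
rewrite -psevalD//; last exact/entire_coef_mul_lin/entire_coef_shift.
congr pseval; apply/funext => -[|i]; rewrite /coef_shift /mul_lin /=.
  by rewrite mul0r subr0 addr0.
by rewrite mul0r subr0 add0r addSnnS.
Qed.

Lemma entire_coef_div_lin a z : entire_coef a -> entire_coef (div_lin a z).
Proof.
move=> Ha; apply: entire_coef_geometric => r r0.
have s0 : 0 < r + normc z by rewrite ltr_wpDr// normc_ge0.
have [M HM] := Ha _ s0; exists (M / (r + normc z)) => k.
have zs : normc z <= r + normc z by rewrite lerDr ltW.
have := pseval_bound (entire_coef_shift k.+1 Ha) (l1_le_shift k.+1 s0 HM) s0 zs.
rewrite -/(div_lin a z k) => h.
apply: (@le_trans _ _ (normc (div_lin a z k) * (r + normc z) ^+ k)).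
  apply: ler_wpM2l; first exact: normc_ge0.
  by apply: lerXn2r; rewrite ?nnegrE ?(ltW r0) ?(ltW s0)// lerDl normc_ge0.
by rewrite -ler_pdivlMr ?exprn_gt0// -mulrA -invfM -exprS.
Qed.

(** The product is [f v - f z], which differs from [f] in its constant coefficient. *)
Lemma mul_div_lin a z k : entire_coef a ->
  mul_lin z (div_lin a z) k = if k is 0%N then a 0%N - pseval a z else a k.
Proof.
move=> Ha; rewrite /mul_lin /div_lin; case: k => [|k].
  have := pseval_shift z 0 Ha; rewrite (_ : coef_shift a 0 = a); last first.
    by apply/funext => i; rewrite /coef_shift addn0.
  by move=> ->; rewrite sub0r opprD addNKr.
by rewrite (pseval_shift _ k.+1)// addrK.
Qed.

Lemma mul_div_lin_root a z : entire_coef a -> pseval a z = 0 -> mul_lin z (div_lin a z) = a.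
Proof.
move=> Ha a0; apply/funext => k; rewrite mul_div_lin// a0 subr0.
by case: k.
Qed.

Lemma pseval_div_lin a z v : entire_coef a ->
  (v - z) * pseval (div_lin a z) v = pseval a v - pseval a z.
Proof.
move=> Ha; have [h1 h2] := pseval_const (pseval a z) v.
rewrite -[in RHS]h2 -psevalB// -pseval_mul_lin; last exact: entire_coef_div_lin.
by congr pseval; apply/funext => -[|k]; rewrite mul_div_lin// subr0.
Qed.

(** Division by [v - z] gains the factor [r - normc z] in the weighted norm:
[c k] enters the coefficient [k + 1] of the product with weight [r], and the
coefficient [k] with weight [normc z] only. This bounds the number of zeros in a
disc, and it makes dividing out a zero a continuous operation. *)
Lemma l1_le_div_lin z c r M : entire_coef c -> normc z < r -> l1_le (mul_lin z c) r M ->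
  l1_le c r (M / (r - normc z)).
Proof.
move=> Hc zr HM N; have r0 : 0 < r := le_lt_trans (normc_ge0 z) zr.
have d0 : 0 < r - normc z by rewrite subr_gt0.
rewrite ler_pdivlMr//.
pose T n := \sum_(k < n) normc (c k) * r ^+ k.
(* The truncated inequality has a boundary term, which tends to [0]. *)
have Tle n : T n * (r - normc z) <= M + normc (c n) * r ^+ n * normc z.
  have h : r * T n <= \sum_(k < n) normc (mul_lin z c k.+1) * r ^+ k.+1 + normc z * \sum_(k < n) normc (c k.+1) * r ^+ k.+1.
    rewrite !mulr_sumr -big_split /=; apply: ler_sum => k _.
    rewrite mulrCA -exprS [normc z * _]mulrA -mulrDl.
    apply: ler_wpM2r; first by rewrite exprn_ge0// ltW.
    by rewrite -normcM; apply: le_trans (normcD _ _); rewrite /mul_lin subrK.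
  have h2 : \sum_(k < n) normc (c k.+1) * r ^+ k.+1 <= T n + normc (c n) * r ^+ n.
    have -> : T n + normc (c n) * r ^+ n = T n.+1 by rewrite /T big_ord_recr.
    by rewrite /T big_ord_recl lerDr mulr_ge0 ?normc_ge0// exprn_ge0// ltW.
  have h3 : \sum_(k < n) normc (mul_lin z c k.+1) * r ^+ k.+1 <= M.
    by apply: le_trans (HM n.+1); rewrite big_ord_recl lerDr mulr_ge0 ?normc_ge0// exprn_ge0// ltW.
  have := ler_wpM2l (normc_ge0 z) h2; rewrite mulrBr; lra.
have : normc (c n * (r%:C) ^+ n.+1) @[n --> \oo] --> (0:R) by exact: term_cvg0.
move=> h; apply/ler_addgt0Pr => e e0.
have e1 : 0 < e * (r / (normc z + 1)).
  by rewrite mulr_gt0// divr_gt0// ltr_wpDl// normc_ge0.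
move/cvgrPdist_lt/(_ _ e1) : h => [n0 _ /(_ (maxn N n0))/= /(_ (leq_maxr _ _))].
set n := maxn N n0; rewrite sub0r normrN ger0_norm ?normc_ge0// normcM normcX.
rewrite normc_real gtr0_norm// exprSr => h.
apply: (@le_trans _ _ (T n * (r - normc z))).
  apply: ler_wpM2r; first exact: ltW.
  rewrite /T -!(big_mkord xpredT (fun k => normc (c k) * r ^+ k)).
  rewrite (big_cat_nat (leq0n N) (leq_maxl N n0)) /= lerDl sumr_ge0// => i _.
  by rewrite mulr_ge0 ?normc_ge0// exprn_ge0// ltW.
apply: le_trans (Tle n) _; rewrite lerD2l.
have {}h : normc (c n) * r ^+ n * (normc z + 1) < e.
  have zp : 0 < normc z + 1 by rewrite ltr_wpDl// normc_ge0.
  rewrite -ltr_pdivlMr// -(ltr_pM2r r0) -mulrA.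
  by apply: lt_le_trans h _; rewrite mulrA mulrAC.
apply: le_trans (ltW h); rewrite mulrDr mulr1 lerDl.
by rewrite mulr_ge0 ?normc_ge0// exprn_ge0// ltW.
Qed.

(** The divided difference at [v] is bounded on discs, so the function is Lipschitz
near [v]. *)
Lemma pseval_continuous {T : Type} {F : set_system T} {FF : Filter F} a v (v_ : T -> R[i]) :
  entire_coef a -> normc (v_ n - v) @[n --> F] --> (0 : R) ->
  normc (pseval a (v_ n) - pseval a v) @[n --> F] --> (0 : R).
Proof.
move=> Ha H; have r0 : 0 < normc v + 1 by rewrite ltr_wpDl// normc_ge0.
have Hd := entire_coef_div_lin v Ha; have [M HM] := Hd _ r0.
have h : normc (v_ n - v) * M @[n --> F] --> (0 * M : R).
  by apply: cvgMl.
rewrite mul0r in h; apply: (squeeze_cvgr _ (cvg_cst 0) h).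
move/cvgrPdist_lt/(_ _ ltr01) : H; apply: filterS => n.
rewrite sub0r normrN ger0_norm ?normc_ge0// => hn; rewrite andTb.
rewrite -pseval_div_lin// normcM; apply: ler_wpM2l; first exact: normc_ge0.
apply: (pseval_bound Hd HM r0); rewrite -[v_ n](subrK v).
by apply: le_trans (normcD _ _) _; rewrite addrC lerD2l ltW.
Qed.

End PowerSeries.

(** * Dividing out the zeros in a disc *)

Section Factorization.
Context {R : realType}.
Implicit Types (a b c : nat -> R[i]) (v w z : R[i]) (ws : seq R[i]) (r M e : R).

Lemma entire_coef_mul_lins b ws : entire_coef b -> entire_coef (foldr mul_lin b ws).
Proof. by move=> Hb; elim: ws => //= w ws; exact: entire_coef_mul_lin. Qed.

Lemma pseval_mul_lins b ws v : entire_coef b ->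
  pseval (foldr mul_lin b ws) v = (\prod_(w <- ws) (v - w)) * pseval b v.
Proof.
move=> Hb; elim: ws => [|w ws IH] /=; first by rewrite big_nil mul1r.
by rewrite pseval_mul_lin ?big_cons -?mulrA ?IH//; exact: entire_coef_mul_lins.
Qed.

Lemma l1_le_div_lins b ws r rho M : entire_coef b -> rho < r ->
  {in ws, forall w, normc w <= rho} ->
  l1_le (foldr mul_lin b ws) r M -> l1_le b r (M / (r - rho) ^+ size ws).
Proof.
move=> Hb rr; elim: ws M => [|w ws IH] M /= Hw H; first by rewrite expr0 divr1.
have d0 : 0 < r - rho by rewrite subr_gt0.
have wr : normc w <= rho by apply: Hw; rewrite mem_head.
have M0 := l1_le_ge0 H.
have h1 : l1_le (foldr mul_lin b ws) r (M / (r - rho)).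
  apply: l1_le_weaken (l1_le_div_lin (entire_coef_mul_lins _ Hb) (le_lt_trans wr rr) H).
  apply: ler_wpM2l => //; rewrite lef_pV2 ?posrE//; lra.
have := IH _ _ h1; rewrite exprS invfM mulrA; apply => x xs.
by apply: Hw; rewrite inE xs orbT.
Qed.

Lemma prod_normc_le ws v rho : {in ws, forall w, normc w <= rho} ->
  normc (\prod_(w <- ws) (v - w)) <= (normc v + rho) ^+ size ws.
Proof.
elim: ws => [|w ws IH] /= H; first by rewrite big_nil normc1 expr0.
rewrite big_cons normcM exprS; apply: ler_pM; rewrite ?normc_ge0//.
  by apply: le_trans (normcB _ _) _; rewrite lerD2l H// mem_head.
by apply: IH => x xs; apply: H; rewrite inE xs orbT.
Qed.

(** Zeros in the disc are divided out one at a time. This must stop: after [k]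
divisions the quotient is at most [M / (r - rho) ^ k] on the disc of radius [r],
while the product of the [k] linear factors at [v0] is at most
[(normc v0 + rho) ^ k], and for large [r] the nonzero value at [v0] would be at
most [M / 2 ^ k]. *)
Lemma disc_factorization a v0 rho : entire_coef a -> pseval a v0 != 0 -> 0 <= rho ->
  exists ws b, [/\ entire_coef b, a = foldr mul_lin b ws,
    {in ws, forall w, normc w <= rho} &
    forall v, normc v <= rho -> pseval b v != 0].
Proof.
move=> Ha f0 outer_ratio0; apply: contrapT => nofact.
have step k : exists ws b, [/\ entire_coef b, a = foldr mul_lin b ws,
    {in ws, forall w, normc w <= rho} & size ws = k].
  elim: k => [|k [ws [b [Hb aE Hw sk]]]]; first by exists [::], a; split.
  have [v vr bv] : exists2 v, normc v <= rho & pseval b v = 0.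
    apply: contrapT => H; apply: nofact; exists ws, b; split => // v vr.
    by apply/eqP => bv; apply: H; exists v.
  exists (rcons ws v), (div_lin b v); split; last by rewrite size_rcons sk.
  - exact: entire_coef_div_lin.
  - by rewrite -cats1 foldr_cat /= mul_div_lin_root.
  - by move=> w; rewrite mem_rcons inE => /orP[/eqP->|/Hw].
(* Chosen so that [normc v0 + rho <= (r - rho) / 2]. *)
pose r := 3 * rho + 2 * normc v0 + 1.
have v00 := normc_ge0 v0; have r0 : 0 < r by rewrite /r; lra.
have rr : rho < r by rewrite /r; lra.
have [M HM] := Ha _ r0.
have [k Hk] : exists k, M * 2^-1 ^+ k < normc (pseval a v0).
  have h : M * 2^-1 ^+ n @[n --> \oo] --> (M * 0 : R).
    by apply: cvgMr; apply: cvg_expr; rewrite ger0_norm ?invr_ge0//; lra.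
  rewrite mulr0 in h.
  have /(cvgr_lt _ h)[k _ /(_ k (leqnn k))/= Hk] : 0 < normc (pseval a v0) by rewrite normc_gt0.
  by exists k.
have [ws [b [Hb aE Hw sk]]] := step k.
suff : normc (pseval a v0) <= M * 2^-1 ^+ k by rewrite leNgt Hk.
rewrite aE pseval_mul_lins// normcM -sk.
have Hbn : l1_le b r (M / (r - rho) ^+ size ws) by apply: l1_le_div_lins Hw _ => //; rewrite -aE.
have vr : normc v0 <= r by rewrite /r; lra.
apply: le_trans (ler_pM (normc_ge0 _) (normc_ge0 _) (prod_normc_le v0 Hw) (pseval_bound Hb Hbn r0 vr)) _.
rewrite mulrCA -exprVn -exprMn ler_wpM2l ?(l1_le_ge0 HM)//.
apply: lerXn2r; rewrite ?nnegrE ?invr_ge0//; last rewrite ler_pdivrMr /r; try lra.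
by rewrite mulr_ge0 ?invr_ge0; rewrite /r; lra.
Qed.

Lemma prod_split_root ws v v0 :
  \prod_(w <- ws) (v - w) =
  (v - v0) ^+ count_mem v0 ws * \prod_(w <- [seq w <- ws | w != v0]) (v - w).
Proof.
elim: ws => [|w ws IH] /=; first by rewrite !big_nil expr0 mul1r.
rewrite big_cons IH; have [->|wv] /= := eqVneq w v0; first by rewrite exprS mulrA.
by rewrite big_cons add0n mulrCA.
Qed.

Lemma prod_roots_neq0 ws v : v \notin ws -> \prod_(w <- ws) (v - w) != 0.
Proof.
elim: ws => [|w ws IH]; first by rewrite big_nil oner_neq0.
by rewrite inE negb_or big_cons mulf_eq0 negb_or subr_eq0 => /andP[-> /IH].
Qed.

Lemma mul_lins_split_root b ws v v0 : entire_coef b ->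
  pseval (foldr mul_lin b ws) v = (v - v0) ^+ count_mem v0 ws *
    pseval (foldr mul_lin b [seq w <- ws | w != v0]) v.
Proof. by move=> Hb; rewrite !pseval_mul_lins// (prod_split_root _ _ v0) mulrA. Qed.

(** Argand's argument: [f v = f v0 + (v - v0) ^ k * h v] with [k > 0] and
[h v0 != 0], so a small step [t] from [v0] in the direction [xi], where
[xi ^ k = - f v0 / h v0], multiplies [f] by nearly [1 - t ^ k]. *)
Lemma no_local_min_modulus c v0 v1 e : entire_coef c -> pseval c v0 != 0 ->
  pseval c v1 != pseval c v0 -> 0 < e ->
  exists2 v, normc (v - v0) < e & normc (pseval c v) < normc (pseval c v0).
Proof.
move=> Hc f0 f1 e0.
have [Hk _] := pseval_const (pseval c v0) v1.
have [a Ha Ea] : exists2 a, entire_coef a & forall v, pseval a v = pseval c v - pseval c v0.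
  eexists; first exact: (entire_coefB Hc Hk).
  by move=> v; rewrite (psevalB v Hc Hk); have [_ ->] := pseval_const (pseval c v0) v.
have av1 : pseval a v1 != 0 by rewrite Ea subr_eq0.
have [ws [b [Hb aE Hw bn]]] := disc_factorization Ha av1 (normc_ge0 v0).
pose ws' := [seq w <- ws | w != v0].
pose h := pseval (foldr mul_lin b ws').
have hE v : pseval c v = pseval c v0 + (v - v0) ^+ count_mem v0 ws * h v.
  by rewrite -mul_lins_split_root// -aE Ea addrC subrK.
have h0 : h v0 != 0.
  rewrite /h pseval_mul_lins// mulf_neq0 ?bn//; apply: prod_roots_neq0.
  by rewrite mem_filter eqxx.
set k := count_mem v0 ws in hE.
have k0 : (0 < k)%N.
  rewrite lt0n; apply/eqP => k0; have := hE v0; rewrite k0 expr0 mul1r.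
  by move/esym/eqP; rewrite addrC -subr_eq0 addrK (negbTE h0).
pose xi := k.-root%C (- pseval c v0 / h v0).
have xiE : xi ^+ k = - pseval c v0 / h v0 by rewrite rootCK.
pose v_ (n : nat) := v0 + (n.+1%:R^-1 : R)%:C * xi.
have tcvg : normc (v_ n - v0) @[n --> \oo] --> (0 : R).
  have hh : n.+1%:R^-1 * normc xi @[n --> \oo] --> (0 * normc xi : R).
    by apply: cvgMl; exact: cvg_harmonic.
  rewrite mul0r in hh; apply: cvg_trans hh; apply: near_eq_cvg; apply: nearW => n.
  by rewrite /v_ addrAC subrr add0r normcM normc_real ger0_norm.
have hcvg : normc (h (v_ n) - h v0) @[n --> \oo] --> (0 : R).
  exact: (pseval_continuous (entire_coef_mul_lins ws' Hb) tcvg).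
have hn0 : 0 < normc (h v0) by rewrite normc_gt0.
have fn0 : 0 < normc (pseval c v0) by rewrite normc_gt0.
near \oo => n; exists (v_ n); first by near: n; exact: cvgr_lt tcvg _ e0.
have dn : normc (h (v_ n) - h v0) < normc (h v0) by near: n; exact: cvgr_lt hcvg _ hn0.
pose t : R := n.+1%:R^-1.
have t0 : 0 < t by rewrite invr_gt0.
have t1 : t <= 1 by rewrite invf_le1// ler1n.
have tk0 : 0 < t ^+ k by rewrite exprn_gt0.
have tk1 : t ^+ k <= 1 by rewrite exprn_ile1// ltW.
have -> : pseval c (v_ n) = pseval c v0 * ((1 - t ^+ k)%:C - (t ^+ k)%:C * ((h (v_ n) - h v0) / h v0)).
  have vE : v_ n - v0 = t%:C * xi by rewrite /v_ addrAC subrr add0r.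
  rewrite hE vE exprMn xiE -rmorphXn rmorphB rmorph1 /=.
  by move: (t ^+ k)%:C (h (v_ n)) => T H; field.
rewrite normcM -[ltRHS]mulr1 ltr_pM2l//; apply: le_lt_trans (normcB _ _) _.
rewrite normcM !normc_real !ger0_norm ?subr_ge0 ?(ltW tk0)//.
rewrite -ltrBrDl opprB addrCA subrr addr0 normcM normcV.
by rewrite -[ltRHS]mulr1 ltr_pM2l// ltr_pdivrMr// mul1r.
Unshelve. all: by end_near. Qed.

End Factorization.

(** * Zeros of a limit of entire functions *)

Section Hurwitz.
Context {R : realType}.
Implicit Types (a b c : nat -> R[i]) (v w z : R[i]) (ws : seq R[i]) (r M e : R).

(** Compactness in the coordinates [R * R]. The disc and the circle are the cases
[r1 = 0] and [r1 = r2]. *)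
Lemma annulus_min c w r1 r2 : entire_coef c -> 0 <= r1 <= r2 ->
  exists2 v0, r1 <= normc (v0 - w) <= r2 &
    forall v, r1 <= normc (v - w) <= r2 -> normc (pseval c v0) <= normc (pseval c v).
Proof.
move=> Hc /andP[r10 r12].
pose P (p : R * R) : R[i] := p.1 +i* p.2.
have Pc (p0 : R * R) : normc (P p - P p0) @[p --> p0] --> (0 : R).
  have h : `|p.1 - p0.1| + `|p.2 - p0.2| @[p --> p0] --> (`|p0.1 - p0.1| + `|p0.2 - p0.2| : R).
    apply: cvgD; apply: cvg_norm; apply: cvgB; try exact: cvg_cst.
      exact: cvg_fst.
    exact: cvg_snd.
  rewrite !subrr normr0 addr0 in h; apply: (squeeze_cvgr _ (cvg_cst 0) h).
  by apply: nearW => p; rewrite normc_ge0 /=; exact: normc_le_ReIm.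
have lip (f : R * R -> R[i]) l (p0 : R * R) : normc (f p - l) @[p --> p0] --> (0 : R) ->
    normc (f p) @[p --> p0] --> (normc l : R).
  move=> h; apply/cvgrPdist_lt => e e0; move/cvgrPdist_lt/(_ _ e0): h.
  apply: filterS => p; rewrite sub0r normrN ger0_norm ?normc_ge0//.
  apply: le_lt_trans; rewrite distrC ler_norml; apply/andP; split.
    rewrite lerNl opprB lerBlDr normc_distC.
    by have := normcD (l - f p) (f p); rewrite subrK.
  by rewrite lerBlDr; have := normcD (f p - l) l; rewrite subrK.
pose A : set (R * R) := [set p | r1 <= normc (P p - w) <= r2].
have Acl : closed A.
  have -> : A = (fun p => normc (P p - w)) @^-1` `[r1, r2].
    by apply/seteqP; split => p; rewrite /A /= in_itv /=.
  apply: closed_comp; last exact: interval_closed.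
  move=> p _; apply: (lip (fun p => P p - w)).
  by under eq_fun do rewrite opprB addrA subrK; exact: Pc.
pose K := normc w + r2.
have Acp : compact A.
  apply: (@subclosed_compact _ _ (`[- K, K] `*` `[- K, K])) => //.
    by apply: compact_setX; exact: segment_compact.
  move=> p /andP[_ pr]; have pK : normc (P p) <= K.
    by rewrite -[P p](subrK w); apply: le_trans (normcD _ _) _; rewrite addrC lerD2l.
  split; rewrite /= in_itv /= -ler_norml; apply: le_trans pK.
    exact: (normc_Re (P p)).
  exact: (normc_Im (P p)).
have A0 : A !=set0.
  exists (complex.Re w + r2, complex.Im w); rewrite /A /=.
  have -> : P (complex.Re w + r2, complex.Im w) - w = r2%:C.
    by rewrite {3}[w](complexE w); case: w {K Acl A Acp} => x y; rewrite /P /=; simpc;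
      congr (_ +i* _); ring.
  by rewrite normc_real ger0_norm ?r12 ?lexx//; exact: le_trans r12.
have [p0 p0A Hp0] := @compact_EVT_min _ R (fun p => normc (pseval c (P p))) A A0 Acp
  (continuous_subspaceT (fun p0 => lip (fun p => pseval c (P p)) _ p0 (pseval_continuous Hc (Pc p0)))).
exists (P p0); first by rewrite inE in p0A.
move=> v vA; have -> : v = P (complex.Re v, complex.Im v) by case: v vA.
by apply: Hp0; rewrite inE /A; case: v vA.
Qed.

(** At the index [n], choose a point that meets the best threshold [1 / (k + 1)]
attainable with [k <= n]; this one choice serves all thresholds. *)
Lemma near_choice (S : Type) (s0 : S) (F : set_system nat) (FF : Filter F)
    (FN : forall N, \forall n \near F, (N <= n)%N)
    (Q : nat -> S -> Prop) (d : S -> R) : (forall s, 0 <= d s) ->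
  (forall e, 0 < e -> \forall n \near F, exists2 s, Q n s & d s < e) ->
  exists2 s_ : nat -> S, d (s_ n) @[n --> F] --> (0 : R) &
    \forall n \near F, Q n (s_ n).
Proof.
move=> d0 H.
have step n m : exists s, forall k, (k <= m)%N ->
    (exists2 s', Q n s' & d s' < k.+1%:R^-1) -> Q n s /\ d s < k.+1%:R^-1.
  elim: m => [|m [s Hs]].
    have [[s Qs ds]|no] := pselect (exists2 s', Q n s' & d s' < 1%:R^-1).
      by exists s => -[|].
    by exists s0 => -[|].
  have [[s' Qs ds]|no] := pselect (exists2 s', Q n s' & d s' < m.+2%:R^-1).
    exists s' => k km _; split => //; apply: lt_le_trans ds _.
    by rewrite lef_pV2 ?posrE// ler_nat.
  by exists s => k; rewrite leq_eqVlt => /orP[/eqP->//|]; rewrite ltnS; exact: Hs.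
have [s_ Hs] := choice (fun n => step n n).
have near1 k : \forall n \near F, Q n (s_ n) /\ d (s_ n) < k.+1%:R^-1.
  have k0 : 0 < k.+1%:R^-1 :> R by rewrite invr_gt0.
  near=> n; apply: (Hs n k); first by near: n; exact: FN.
  by near: n; exact: H.
exists s_; last by have := near1 0%N; apply: filterS => n [].
apply/cvgrPdist_lt => e e0.
have /(cvgr_lt _ (cvg_harmonic))[k _ /(_ k (leqnn k))/= Hk] := e0.
have := near1 k; apply: filterS => n [_ h].
by rewrite sub0r normrN ger0_norm//; exact: lt_trans Hk.
Unshelve. all: by end_near. Qed.

(** On Taylor sequences, this is locally uniform convergence of entire functions. *)
Definition coef_cvg (a_ : nat -> nat -> R[i]) (F : set_system nat) a :=
  forall r e, 0 < r -> 0 < e ->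
    \forall n \near F, l1_le (fun k => a_ n k - a k) r e.

Lemma coef_cvg_uniform (a_ : nat -> nat -> R[i]) F (FF : Filter F) a r e :
  (forall n, entire_coef (a_ n)) -> entire_coef a -> coef_cvg a_ F a -> 0 < r -> 0 < e ->
  \forall n \near F, forall v, normc v <= r -> normc (pseval (a_ n) v - pseval a v) <= e.
Proof.
move=> Hn Ha H r0 e0; have := H r e r0 e0; apply: filterS => n h v vr.
by rewrite -psevalB//; apply: pseval_bound h r0 vr; exact: entire_coefB.
Qed.

Lemma avoid_radii (s : seq R) e : 0 < e ->
  exists2 rho, 0 < rho < e & rho \notin s.
Proof.
move=> e0; suff [rho /andP[r0 re] H] : exists2 rho, 0 < rho < e &
    {in s, forall x, 0 < x -> rho < x}.
  exists rho; first by rewrite r0.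
  by apply/negP => /H/(_ r0); rewrite ltxx.
elim: s => [|x s [rho /andP[r0 re] H]].
  by exists (e / 2) => //; rewrite divr_gt0//= ltr_pdivrMr//; lra.
have [x0|x0] := ltP 0 x; last first.
  exists rho; first by rewrite r0.
  move=> y; rewrite inE => /orP[/eqP->|/H//]; lra.
have m0 : 0 < Num.min rho x by rewrite lt_min r0.
have [mr mx] : Num.min rho x <= rho /\ Num.min rho x <= x.
  by rewrite !ge_min !lexx orbT.
exists (Num.min rho x / 2); first lra.
move=> y; rewrite inE => /orP[/eqP->|/H h] y0; first lra.
have := h y0; lra.
Qed.

(** On a small circle around [w] the modulus of the limit is at least some
[3 * de > 0]. Eventually the modulus of the approximation is then at least [2 * de]
on the circle and at most [de] at the centre, so its minimum over the disc is
attained inside, and by [no_local_min_modulus] this minimum is a zero. *)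
Lemma zero_persists (a_ : nat -> nat -> R[i]) F (FF : Filter F) a w v0 e :
  (forall n, entire_coef (a_ n)) -> entire_coef a -> coef_cvg a_ F a -> pseval a w = 0 ->
  pseval a v0 != 0 -> 0 < e ->
  \forall n \near F, exists2 v, pseval (a_ n) v = 0 & normc (v - w) < e.
Proof.
move=> Hn Ha Hcvg aw av0 e0.
have we0 : 0 <= normc w + e by rewrite addr_ge0 ?normc_ge0// ltW.
have [ws [b [Hb aE Hw bn]]] := disc_factorization Ha av0 we0.
have [rho /andP[outer_ratio0 rhoe] Hrho] := avoid_radii [seq normc (x - w) | x <- ws] e0.
have rle : normc w + rho <= normc w + e by rewrite lerD2l ltW.
have vdisc v : normc (v - w) <= rho -> normc v <= normc w + rho.
  by move=> h; rewrite -[v](subrK w); apply: le_trans (normcD _ _) _; rewrite addrC lerD2l.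
have circ v : normc (v - w) = rho -> pseval a v != 0.
  move=> h; rewrite aE pseval_mul_lins// mulf_neq0 ?bn//; last first.
    by apply: le_trans rle; apply: vdisc; rewrite h.
  apply: prod_roots_neq0; apply/negP => vws; move/negP: Hrho; apply.
  by apply/mapP; exists v.
have [vm /le_anti vmr Hvm] : exists2 v, rho <= normc (v - w) <= rho &
    forall v', rho <= normc (v' - w) <= rho -> normc (pseval a v) <= normc (pseval a v').
  by apply: annulus_min => //; rewrite ltW/=.
pose de := normc (pseval a vm) / 3.
have dm0 : 0 < normc (pseval a vm) by rewrite normc_gt0 circ.
have de0 : 0 < de by rewrite divr_gt0.
have r0 : 0 < normc w + rho by rewrite ltr_wpDl// normc_ge0.
have := coef_cvg_uniform FF Hn Ha Hcvg r0 de0; apply: filterS => n Hun.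
have [u /andP[_ ur] Hu] : exists2 v, 0 <= normc (v - w) <= rho &
    forall v', 0 <= normc (v' - w) <= rho -> normc (pseval (a_ n) v) <= normc (pseval (a_ n) v').
  by apply: annulus_min => //; rewrite lexx ltW.
have uw : normc (pseval (a_ n) u) <= de.
  have := Hu w; rewrite subrr normc0 lexx (ltW outer_ratio0) => /(_ isT) h.
  apply: le_trans h _; have := Hun w; rewrite aw subr0; apply.
  by rewrite lerDl ltW.
have big v : normc (v - w) = rho -> 2 * de <= normc (pseval (a_ n) v).
  move=> h; have h1 : normc (pseval a vm) <= normc (pseval a v) by apply: Hvm; rewrite h lexx.
  have h2 : normc (pseval (a_ n) v - pseval a v) <= de by apply: Hun; apply: vdisc; rewrite h.
  have := normcB (pseval (a_ n) v) (pseval (a_ n) v - pseval a v).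
  by rewrite opprB addrCA subrr addr0; rewrite /de in uw h2 *; lra.
have ult : normc (u - w) < rho.
  rewrite lt_neqAle ur andbT; apply/eqP => h; have := big _ h; lra.
exists u; last exact: lt_trans rhoe.
apply/eqP; apply: contraT => u0.
have pr : normc (w + rho%:C - w) = rho by rewrite addrAC subrr add0r normc_real gtr0_norm.
have nc : pseval (a_ n) (w + rho%:C) != pseval (a_ n) u.
  by apply/eqP => h; have := big _ pr; rewrite h; lra.
have d0 : 0 < rho - normc (u - w) by rewrite subr_gt0.
have [u' u'1 u'2] := no_local_min_modulus (Hn n) u0 nc d0.
have : normc (pseval (a_ n) u) <= normc (pseval (a_ n) u').
  apply: Hu; rewrite normc_ge0/=; apply: le_trans (normc_distD u _ _) _.
  by rewrite -lerBrDr ltW.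
by rewrite leNgt u'2.
Qed.

(** Induction on the zeros of the limit. A zero [z_ n] of the approximation tends to
[w]; once it is divided out the quotients still converge, because the bound of
[l1_le_div_lin] is uniform for [z_ n] near [w]. *)
Lemma hurwitz_factorization ws b (a_ : nat -> nat -> R[i]) F (FF : Filter F)
    (FN : forall N, \forall n \near F, (N <= n)%N) v0 :
  entire_coef b -> (forall n, entire_coef (a_ n)) -> coef_cvg a_ F (foldr mul_lin b ws) ->
  pseval (foldr mul_lin b ws) v0 != 0 ->
  exists (zs_ : nat -> seq R[i]) (b_ : nat -> nat -> R[i]),
    [/\ forall n, entire_coef (b_ n), coef_cvg b_ F b,
        \forall n \near F, a_ n = foldr mul_lin (b_ n) (zs_ n)
      & forall e, 0 < e -> \forall n \near F,
          all2 (fun z w => normc (z - w) < e) (zs_ n) ws].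
Proof.
move=> Hb; elim: ws a_ => [|w ws IH] a_ Hn Hcvg f0 /=.
  by exists (fun=> [::]), a_; split => // [|e _]; exact: nearW.
set a := foldr mul_lin b ws in Hcvg f0 IH.
have Ha : entire_coef a by exact: entire_coef_mul_lins.
have Hwa := entire_coef_mul_lin w Ha.
rewrite /= -/a in Hcvg f0.
have aw : pseval (mul_lin w a) w = 0 by rewrite pseval_mul_lin// subrr mul0r.
have Hz e : 0 < e ->
    \forall n \near F, exists2 v, pseval (a_ n) v = 0 & normc (v - w) < e.
  by move=> e0; exact: zero_persists Hcvg aw f0 e0.
have [z_ zcvg znear] := near_choice w FF FN (fun s => normc_ge0 (s - w)) Hz.
have [|||zs [b_ [Hb_ Hbc Hfac Hzs]]] := IH (fun n => div_lin (a_ n) (z_ n)).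
- by move=> n; exact: entire_coef_div_lin.
- move=> r e r0 e0.
  pose r' := r + normc w + 2.
  have w0 := normc_ge0 w.
  have r'0 : 0 < r' by rewrite /r'; lra.
  have [M HM] := Ha _ r'0; have M0 := l1_le_ge0 HM.
  have e2 : 0 < e / 2 by lra.
  have e3 : 0 < e / 2 / (M + 1) by rewrite divr_gt0//; lra.
  near=> n.
  have an0 : pseval (a_ n) (z_ n) = 0 by near: n.
  have zw1 : normc (z_ n - w) < 1 by near: n; exact: cvgr_lt zcvg _ ltr01.
  have zwe : normc (z_ n - w) < e / 2 / (M + 1) by near: n; exact: cvgr_lt zcvg _ e3.
  have h1 : l1_le (fun k => a_ n k - mul_lin w a k) r' (e / 2) by near: n; exact: Hcvg.
  have zn : normc (z_ n) < normc w + 1.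
    by rewrite -[z_ n](subrK w); apply: le_lt_trans (normcD _ _) _; rewrite addrC ltrD2l.
  have zr' : normc (z_ n) < r' by rewrite /r'; lra.
  have Hd : entire_coef (fun k => div_lin (a_ n) (z_ n) k - a k) by apply: entire_coefB => //; exact: entire_coef_div_lin.
  have h2 : l1_le (mul_lin (z_ n) (fun k => div_lin (a_ n) (z_ n) k - a k)) r' e.
    have -> : mul_lin (z_ n) (fun k => div_lin (a_ n) (z_ n) k - a k) =
        (fun k => (a_ n k - mul_lin w a k) + (z_ n - w) * a k).
      apply/funext => k; have <- := congr1 (@^~ k) (mul_div_lin_root (Hn n) an0).
      by rewrite /mul_lin /=; case: k => [|k]; ring.
    apply: l1_le_weaken (l1_leD (ltW r'0) h1 (l1_leZ _ HM)).
    suff : normc (z_ n - w) * M <= e / 2 by lra.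
    apply: (@le_trans _ _ (e / 2 / (M + 1) * M)); first by rewrite ler_wpM2r// ltW.
    by rewrite -mulrA ler_piMr ?(ltW e2)// mulrC ler_pdivrMr ?mul1r; lra.
  apply: (@l1_le_radius _ _ r'); rewrite ?(ltW r0)//; first by rewrite /r'; lra.
  apply: l1_le_weaken (l1_le_div_lin Hd zr' h2).
  by rewrite ler_piMr ?(ltW e0)// invf_le1 /r'; lra.
- move: f0; rewrite pseval_mul_lin// mulf_eq0 negb_or => /andP[_ h]; exact: h.
exists (fun n => z_ n :: zs n), b_; split => // [|e e0].
  near=> n => /=; have <- : div_lin (a_ n) (z_ n) = foldr mul_lin (b_ n) (zs n) by near: n.
  by rewrite mul_div_lin_root//; near: n.
near=> n => /=; apply/andP; split; first by near: n; exact: cvgr_lt zcvg _ e0.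
by near: n; exact: Hzs.
Unshelve. all: by end_near. Qed.

End Hurwitz.

(** * Counting zeros in a bounded open set *)

Section ZeroCount.
Context {R : realType}.
Implicit Types (a b c : nat -> R[i]) (v w z : R[i]) (ws : seq R[i]) (r M e : R).

Lemma cvg_normc {T : Type} {F : set_system T} {FF : Filter F}
    (f : T -> Cplx R) (l : Cplx R) :
  normc (f x - l) @[x --> F] --> (0 : R) -> f x @[x --> F] --> l.
Proof.
move=> h V /nbhs_normcP[e e0 HV]; have := cvgr_lt _ h _ e0.
move=> h2. by apply: (@filterS T F FF _ _ _ (h2 FF)) => x hx; exact: HV.
Qed.

(** The divided difference extends continuously to [w], where its value is the
derivative. *)
Lemma derivable_pseval a (w : Cplx R) : entire_coef a ->
  derivable (pseval a : Cplx R -> Cplx R) w 1.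
Proof.
move=> Ha; apply/cvg_ex; exists (pseval (div_lin a w) w : Cplx R); apply: cvg_normc.
have hw : normc (h + w - w) @[h --> (0 : Cplx R)^'] --> (0 : R).
  apply/cvgrPdist_lt => e e0; apply/nbhs_normcP; exists e => // h.
  by rewrite subr0 => he _; rewrite addrK sub0r normrN ger0_norm ?normc_ge0.
have h1 : normc (pseval (div_lin a w) (h + w) - pseval (div_lin a w) w)
    @[h --> (0 : Cplx R)^'] --> (0 : R).
  exact: pseval_continuous (entire_coef_div_lin w Ha) hw.
apply/cvgrPdist_lt => e e0; move/cvgrPdist_lt/(_ _ e0): h1.
move=> /nbhs_normcP[d d0 Hd]; apply/nbhs_normcP; exists d => // h hd h0.
have := Hd h hd h0; rewrite -[h *: 1]/(h * 1) mulr1 /= -(pseval_div_lin w (h + w) Ha) addrK.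
by rewrite -[_ *: _]/(h^-1 * _) mulKf.
Qed.

Lemma count_sum_mult (ws : seq R[i]) (P : pred R[i]) :
  count P ws = (\sum_(w <- undup [seq w <- ws | P w]) count_mem w ws)%N.
Proof.
rewrite -size_filter -(sum1_size [seq w <- ws | P w]) -big_undup_iterop_count /=.
rewrite [LHS]big_seq [RHS]big_seq; apply: eq_bigr => w.
rewrite mem_undup mem_filter => /andP[Pw _].
have -> : count_mem w [seq w <- ws | P w] = count_mem w ws.
  rewrite count_filter; apply: eq_count => x /=.
  by case: eqVneq => //= ->.
by rewrite Monoid.iteropE iter_addn_0 mul1n.
Qed.

Lemma zero_count_prod (f : Cplx R -> Cplx R) (U : set (Cplx R)) ws b :
  entire_coef b -> (forall v, U v -> pseval b v != 0) ->
  (forall v, f v = \prod_(w <- ws) (v - w) * pseval b v) ->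
  zero_count f U (count (fun w => `[< U w >]) ws).
Proof.
move=> Hb bU fE.
exists (undup [seq w <- ws | `[< U w >]]), (fun w => count_mem w ws).
split; [exact: undup_uniq| | |exact: count_sum_mult].
- move=> w; rewrite mem_undup mem_filter; split.
    move=> /andP[/asboolP Uw wws]; split => //.
    rewrite fE; apply/eqP; rewrite mulf_eq0; apply/orP; left.
    by apply: contraT => /negP; case; rewrite (big_rem w)//= subrr mul0r.
  move=> [Uw /eqP]; rewrite fE mulf_eq0 (negbTE (bU _ Uw)) orbF => h.
  rewrite asboolT//=; apply: contraT => /prod_roots_neq0; by rewrite (eqP h) eqxx.
- move=> w; rewrite mem_undup mem_filter => /andP[/asboolP Uw wws].
  pose ws' := [seq x <- ws | x != w].
  exists (pseval (foldr mul_lin b ws')); split.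
  + by apply/nbhs_normcP; exists 1 => // v _; apply: derivable_pseval; exact: entire_coef_mul_lins.
  + rewrite pseval_mul_lins// mulf_neq0 ?bU//; apply: prod_roots_neq0.
    by rewrite mem_filter eqxx.
  + by apply/nbhs_normcP; exists 1 => // v _;
    rewrite fE -pseval_mul_lins// (mul_lins_split_root _ _ w).
Qed.

(** A point off the boundary is interior to [U] or to its complement, and finitely
many radii have a positive minimum. *)
Lemma boundary_dist (U : set (Cplx R)) ws : open U ->
  (forall w, w \in ws -> ~ boundary U w) ->
  exists2 e : R, 0 < e & forall w z, w \in ws -> normc (z - w) < e ->
    (U z <-> U w).
Proof.
move=> Uo; elim: ws => [|w ws IH] H; first by exists 1.
have [|e e0 He] := IH; first by move=> x xs; apply: H; rewrite inE xs orbT.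
have [d d0 Hd] : exists2 d : R, 0 < d & forall z, normc (z - w) < d -> (U z <-> U w).
  have [Uw|nUw] := pselect (U w).
    have /nbhs_normcP[d d0 Hd] : nbhs (w : Cplx R) U by exact: open_nbhs_nbhs.
    by exists d => // z /Hd.
  have nc : ~ closure U w.
    move=> cw; apply: (H w (mem_head _ _)); split => //.
    by move=> /interior_subset.
  have /nbhs_normcP[d d0 Hd] : nbhs (w : Cplx R) (~` U).
    apply: contrapT => h; apply: nc => B Bw; apply: contrapT => hB; apply: h.
    apply: filterS Bw => x Bx Ux; apply: hB; by exists x.
  by exists d => // z /Hd.
exists (Num.min d e); first by rewrite lt_min d0.
move=> x z; rewrite inE lt_min => /orP[/eqP->|xs] /andP[h1 h2]; first exact: Hd.
exact: He.
Qed.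

(** In a disc containing [U], split off the zeros [ws] of the limit. The zeros of the
approximation matched with [ws] end up on the same side of the boundary of [U], and
its remaining factor is uniformly close to one that is bounded away from zero on
the disc. *)
Lemma hurwitz_zero_count (a_ : nat -> nat -> R[i]) a F (FF : Filter F)
    (FN : forall N, \forall n \near F, (N <= n)%N) v0
    (U : set (Cplx R)) (f_ : nat -> Cplx R -> Cplx R) :
  (forall n, entire_coef (a_ n)) -> entire_coef a -> coef_cvg a_ F a -> pseval a v0 != 0 ->
  bounded_set U -> open U -> (forall w, boundary U w -> pseval a w != 0) ->
  (\forall n \near F, exists2 K, K != 0 & forall v, f_ n v = K * pseval (a_ n) v) ->
  \forall n \near F, exists N, zero_count (f_ n) U N /\ zero_count (pseval a) U N.
Proof.
move=> Hn Ha Hcvg av0 [M [Mreal HM]] Uo Hbd Hf.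
pose rho := Num.max 0 (complex.Re M + 1) + 1.
have outer_ratio0 : 0 <= rho by rewrite /rho addr_ge0// le_max lexx.
have Urho v : U v -> normc v <= rho.
  move=> Uv; have MM : M < M + 1 by rewrite ltrDl.
  have := HM _ MM v Uv; rewrite /= -[`|v|]/((normc v)%:C) -(RRe_real Mreal) -(rmorph1 (real_complex R)) -rmorphD /=.
  by rewrite lecR => h; apply: le_trans h _; rewrite /rho ler_wpDr// le_max lexx orbT.
have [ws [b [Hb aE Hw bn]]] := disc_factorization Ha av0 outer_ratio0.
rewrite aE in Hcvg av0 Hbd.
have [zs [b_ [Hb_ Hbc Hfac Hzs]]] := hurwitz_factorization FF FN Hb Hn Hcvg av0.
have [vm /andP[_ vmr] Hvm] : exists2 v, 0 <= normc (v - 0) <= rho &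
    forall v', 0 <= normc (v' - 0) <= rho -> normc (pseval b v) <= normc (pseval b v').
  by apply: annulus_min => //; rewrite lexx.
have d0 : 0 < normc (pseval b vm) / 2 by rewrite divr_gt0// normc_gt0 bn// -[vm]subr0.
have r1 : 0 < rho + 1 by rewrite ltr_wpDl.
have [e e0 He] : exists2 e : R, 0 < e & forall w z, w \in ws -> normc (z - w) < e -> (U z <-> U w).
  apply: boundary_dist => // w wws /Hbd; rewrite pseval_mul_lins// (big_rem w)//= subrr.
  by rewrite !mul0r eqxx.
have Hunif := coef_cvg_uniform FF Hb_ Hb Hbc r1 d0.
near=> n.
exists (count (fun w => `[< U w >]) ws).
have [K K0 fK] : exists2 K, K != 0 & forall v, f_ n v = K * pseval (a_ n) v by near: n.
have anE : a_ n = foldr mul_lin (b_ n) (zs n) by near: n.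
have hz : all2 (fun z w => normc (z - w) < e) (zs n) ws by near: n; exact: Hzs.
have hu : forall v, normc v <= rho + 1 ->
  normc (pseval (b_ n) v - pseval b v) <= normc (pseval b vm) / 2 by near: n.
split; last first.
  apply: (zero_count_prod Hb) => [v Uv|v]; first by apply: bn; exact: Urho.
  by rewrite aE pseval_mul_lins.
have -> : count (fun w => `[< U w >]) ws = count (fun w => `[< U w >]) (zs n).
  elim: (ws) (zs n) hz He => [|w ws1 IH] [|z zs1] //= /andP[h1 h2] He'.
  congr addn; last by apply: IH => // w' z' h; apply: He'; rewrite inE h orbT.
  congr nat_of_bool; apply: asbool_equiv_eq; apply: iff_sym.
  by apply: He' h1; rewrite mem_head.
apply: (zero_count_prod (entire_coefZ K (Hb_ n))) => [v Uv|v]; last first.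
  by rewrite fK anE pseval_mul_lins// (psevalZ K v (Hb_ n)) mulrCA.
rewrite (psevalZ K v (Hb_ n)) mulf_neq0//; apply/eqP => bv0.
have vr := Urho v Uv.
have := hu v; rewrite bv0 sub0r normc_opp => /(_ (ler_wpDr ler01 vr)) h.
have := Hvm v; rewrite subr0 normc_ge0 vr => /(_ isT); lra.
Unshelve. all: by end_near. Qed.

Lemma locally_uniform_discs (f_ : nat -> Cplx R -> Cplx R) (f : Cplx R -> Cplx R) F
  (FF : Filter F) :
  (forall r e, 0 < r -> 0 < e ->
    \forall n \near F, forall v, normc v <= r -> normc (f_ n v - f v) <= e) ->
  locally_uniform_cvg f_ F f.
Proof.
move=> H w; exists [set v | normc v <= normc w + 1].
  apply/nbhs_normcP; exists 1 => // v h /=; rewrite -[v](subrK w).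
  by apply: le_trans (normcD _ _) _; rewrite addrC lerD2l ltW.
have r0 : 0 < normc w + 1 by rewrite ltr_wpDl// normc_ge0.
move=> P /uniform_nbhs [E [entE EP]].
move: entE; rewrite -entourage_ballE => -[e /= e0 HE].
have eR : e \is Num.real by exact: gtr0_real.
have e2 : 0 < complex.Re e / 2.
  by rewrite divr_gt0//; move: e0; rewrite -(RRe_real eR) ltcR.
have := H _ _ r0 e2; apply: filterS => n Hn /=; apply: EP => v /= vr.
apply: HE; rewrite /ball /= -(RRe_real eR) distrC -[`|_|]/((normc _)%:C) ltcR.
apply: le_lt_trans (Hn v vr) _; lra.
Qed.

End ZeroCount.

(** * Logarithm of a quotient of hyperbolic sines *)

Section Hyperbolic.
Context {R : realType}.
Implicit Types (x a b : R).

Lemma is_derive_sinh x : is_derive x 1 (@sinh R) (cosh x).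
Proof.
rewrite /sinh /cosh; apply: is_derive_eq.
by rewrite /GRing.scale /=; field.
Qed.

Lemma is_derive_cosh x : is_derive x 1 (@cosh R) (sinh x).
Proof.
rewrite /sinh /cosh; apply: is_derive_eq.
by rewrite /GRing.scale /=; field.
Qed.

Lemma sinh0 : sinh 0 = 0 :> R.
Proof. by rewrite /sinh oppr0 subrr mul0r. Qed.

Lemma cosh_sqr x : cosh x ^+ 2 = 1 + sinh x ^+ 2.
Proof.
have h : expR x * expR (- x) = 1 by rewrite expRN divff ?gt_eqF ?expR_gt0.
rewrite /cosh /sinh; move: h; set X := expR x; set Y := expR (- x) => h.
have -> : ((X + Y) / 2) ^+ 2 = ((X - Y) / 2) ^+ 2 + X * Y by field.
by rewrite h addrC.
Qed.

Lemma sinhD a b : sinh (a + b) = sinh a * cosh b + cosh a * sinh b.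
Proof. by rewrite /sinh /cosh opprD !expRD; field. Qed.

Lemma coshD a b : cosh (a + b) = cosh a * cosh b + sinh a * sinh b.
Proof. by rewrite /sinh /cosh opprD !expRD; field. Qed.

Lemma sinhN a : sinh (- a) = - sinh a.
Proof. by rewrite /sinh opprK; field. Qed.

Lemma coshN a : cosh (- a) = cosh a.
Proof. by rewrite /cosh opprK addrC. Qed.

Lemma cosh_gt0 x : 0 < cosh x.
Proof. by rewrite /cosh divr_gt0// addr_gt0// expR_gt0. Qed.

Lemma sinh_gt0 x : 0 < x -> 0 < sinh x.
Proof. by move=> x0; rewrite /sinh divr_gt0// subr_gt0 ltr_expR; lra. Qed.

Lemma sinh_ge0 x : 0 <= x -> 0 <= sinh x.
Proof. by rewrite le_eqVlt => /orP[/eqP<-|/sinh_gt0/ltW//]; rewrite sinh0. Qed.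

Lemma ler_sinh a b : a <= b -> sinh a <= sinh b.
Proof.
move=> ab; have h1 : expR a <= expR b by rewrite ler_expR.
have h2 : expR (- b) <= expR (- a) by rewrite ler_expR; lra.
by rewrite /sinh; lra.
Qed.

Lemma ltr_sinh a b : a < b -> sinh a < sinh b.
Proof.
move=> ab; have h1 : expR a < expR b by rewrite ltr_expR.
have h2 : expR (- b) < expR (- a) by rewrite ltr_expR; lra.
by rewrite /sinh; lra.
Qed.

(** Bounds between functions and Taylor polynomials are obtained by integrating from
[0] in this form. *)
Lemma derive_ge0_le (f df : R -> R) t :
  (forall x, 0 <= x <= t -> is_derive x 1 f (df x)) ->
  (forall x, 0 <= x <= t -> 0 <= df x) -> 0 <= t -> f 0 <= f t.
Proof.
move=> fd f0 t0.
have [||c ct h] := @MVT_segment R f df 0 t t0.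
- by move=> x /andP[x0 xt]; apply: fd; move: x0 xt; rewrite !bnd_simp; lra.
- apply: derivable_within_continuous => x xt.
  by have [] : is_derive x 1 f (df x) by apply: fd; move: xt; rewrite in_itv.
- rewrite -subr_ge0 h mulr_ge0 ?subr_ge0//; apply: f0; move: ct; by rewrite in_itv.
Qed.

Lemma sinh_ge x : 0 <= x -> x <= sinh x.
Proof.
move=> x0; rewrite -subr_ge0.
have -> : 0 = sinh 0 - 0 :> R by rewrite sinh0 subr0.
apply: (@derive_ge0_le (fun x => sinh x - x) (fun x => cosh x - 1)) => // y /andP[y0 yx].
  by have := is_derive_sinh y => h; apply: is_derive_eq.
have := cosh_sqr y; have := cosh_gt0 y; have := sinh_ge0 y0; nra.
Qed.

Lemma cosh_le2 x : 0 <= x <= 1 / 2 -> cosh x <= 2.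
Proof.
move=> /andP[x0 x1]; rewrite /cosh.
have h1 : expR (- x) <= 1 by rewrite expR_le1; lra.
have h2 : 1 / 2 <= expR (- x) by have := expR_ge1Dx (- x); lra.
have h3 : expR x <= 2.
  rewrite -[x]opprK expRN -[leRHS]invrK lef_pV2 ?posrE ?expR_gt0 ?invr_gt0//; lra.
lra.
Qed.

Lemma sinh_le2x x : 0 <= x <= 1 / 2 -> sinh x <= 2 * x.
Proof.
move=> /andP[x0 x1]; rewrite -subr_ge0.
have -> : 0 = 2 * 0 - sinh 0 :> R by rewrite sinh0; lra.
apply: (@derive_ge0_le (fun x => 2 * x - sinh x) (fun x => 2 - cosh x)) => // y /andP[y0 yx].
  have h := is_derive_sinh y; apply: is_derive_eq; rewrite /GRing.scale /=; ring.
by rewrite subr_ge0 cosh_le2//; lra.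
Qed.

Lemma sinh_le_cubic x : 0 <= x <= 1 / 2 -> sinh x <= x + x ^+ 3.
Proof.
move=> /andP[x0 x1]; rewrite -subr_ge0.
have -> : 0 = 0 + 0 ^+ 3 - sinh 0 :> R by rewrite sinh0 expr0n /=; lra.
apply: (@derive_ge0_le (fun x => x + x ^+ 3 - sinh x) (fun x => 1 + 3 * x ^+ 2 - cosh x)) => // y /andP[y0 yx].
  have h := is_derive_sinh y; apply: is_derive_eq; rewrite /GRing.scale /=; ring.
have h1 : sinh y <= 2 * y by apply: sinh_le2x; lra.
have h2 := sinh_ge0 y0; have h3 := cosh_sqr y; have h4 := cosh_gt0 y.
have y2 : 0 <= y ^+ 2 by exact: sqr_ge0.
have h5 : sinh y ^+ 2 <= 4 * y ^+ 2.
  have -> : 4 * y ^+ 2 = (2 * y) ^+ 2 by ring.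
  by apply: lerXn2r; rewrite ?nnegrE//; lra.
have : cosh y <= 1 + 2 * y ^+ 2.
  rewrite -(@ler_pXn2r _ 2)// ?nnegrE; [|exact: ltW|lra].
  by rewrite h3; have := sqr_ge0 (y ^+ 2); lra.
lra.
Qed.

(** Equal to [2 * artanh (coth a * tanh b)], an odd function of [b]. *)
Definition ln_sinh_quot a b := ln (sinh (a + b)) - ln (sinh (a - b)).

(** [sinh (a + b) * sinh (a - b) = sinh a ^ 2 - sinh b ^ 2], so the derivative is the
sum of a geometric series in [(sinh b / sinh a) ^ 2]. *)
Lemma is_derive_ln_sinh_quot a b : 0 <= b < a ->
  is_derive b 1 (ln_sinh_quot a) (2 * coth a / (1 - (sinh b / sinh a) ^+ 2)).
Proof.
move=> /andP[b0 ba]; have p1 : 0 < sinh (a + b) by apply: sinh_gt0; lra.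
have p2 : 0 < sinh (a - b) by apply: sinh_gt0; lra.
have sa : 0 < sinh a by apply: sinh_gt0; lra.
have d1 : is_derive b 1 (fun b => sinh (a + b)) (cosh (a + b) * 1).
  apply: (@is_derive1_comp _ (@sinh R) (fun b => a + b)); first exact: is_derive_sinh.
  by apply: is_derive_eq; rewrite /GRing.scale /=; ring.
have d2 : is_derive b 1 (fun b => sinh (a - b)) (cosh (a - b) * -1).
  apply: (@is_derive1_comp _ (@sinh R) (fun b => a - b)); first exact: is_derive_sinh.
  by apply: is_derive_eq; rewrite /GRing.scale /=; ring.
have d3 := @is_derive1_comp _ (@ln R) (fun b => sinh (a + b)) b _ _ (is_derive1_ln p1) d1.
have d4 := @is_derive1_comp _ (@ln R) (fun b => sinh (a - b)) b _ _ (is_derive1_ln p2) d2.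
have d5 := is_deriveB d3 d4; apply: (is_derive_eq d5).
have e1 : sinh (a + b) * sinh (a - b) = sinh a ^+ 2 - sinh b ^+ 2.
  rewrite !sinhD sinhN coshN.
  have -> : (sinh a * cosh b + cosh a * sinh b) * (sinh a * cosh b + cosh a * - sinh b) =
    sinh a ^+ 2 * cosh b ^+ 2 - cosh a ^+ 2 * sinh b ^+ 2 by ring.
  by rewrite !cosh_sqr; ring.
have n1 : sinh a ^+ 2 - sinh b ^+ 2 != 0 by rewrite -e1 mulf_neq0// gt_eqF.
have -> : (sinh (a + b))^-1 * (cosh (a + b) * 1) - (sinh (a - b))^-1 * (cosh (a - b) * -1)
  = (cosh (a + b) * sinh (a - b) + cosh (a - b) * sinh (a + b)) / (sinh (a + b) * sinh (a - b)).
  by field; rewrite !gt_eqF.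
have -> : cosh (a + b) * sinh (a - b) + cosh (a - b) * sinh (a + b) = 2 * sinh a * cosh a.
  rewrite !sinhD !coshD sinhN coshN.
  have -> : (cosh a * cosh b + sinh a * sinh b) * (sinh a * cosh b + cosh a * - sinh b) +
     (cosh a * cosh b + sinh a * - sinh b) * (sinh a * cosh b + cosh a * sinh b) =
    2 * sinh a * cosh a * (cosh b ^+ 2 - sinh b ^+ 2) by ring.
  by rewrite cosh_sqr; ring.
by rewrite e1 /coth; field; rewrite n1 gt_eqF.
Qed.

Lemma ln_sinh_quot0 a : ln_sinh_quot a 0 = 0.
Proof. by rewrite /ln_sinh_quot addr0 subr0 subrr. Qed.

(** The coefficient of [b ^ 3] in the expansion of [ln_sinh_quot a] at [0]. *)
Definition cubic_coef a : R := 2 / 3 * coth a / sinh a ^+ 2.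

Lemma coth_gt0 a : 0 < a -> 0 < coth a.
Proof. by move=> a0; rewrite /coth divr_gt0 ?cosh_gt0 ?sinh_gt0. Qed.

(** The derivative is at least the first two terms of its geometric series, and
[sinh b >= b]. The bound reaches up to [b = a], which later gives a domination of
all coefficients at once. *)
Lemma ln_sinh_quot_ge a b : 0 <= b < a ->
  2 * coth a * b + cubic_coef a * b ^+ 3 <= ln_sinh_quot a b.
Proof.
move=> /andP[b0 ba]; have a0 : 0 < a by lra.
rewrite -subr_ge0.
have -> : 0 = ln_sinh_quot a 0 - (2 * coth a * 0 + cubic_coef a * 0 ^+ 3) by rewrite ln_sinh_quot0 expr0n /=; lra.
apply: (@derive_ge0_le (fun b => ln_sinh_quot a b - (2 * coth a * b + cubic_coef a * b ^+ 3))
 (fun b => 2 * coth a / (1 - (sinh b / sinh a) ^+ 2) -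
   (2 * coth a + 3 * cubic_coef a * b ^+ 2))) => // y /andP[y0 yb].
  have h : is_derive y 1 (ln_sinh_quot a) (2 * coth a / (1 - (sinh y / sinh a) ^+ 2)).
    by apply: is_derive_ln_sinh_quot; lra.
  by apply: is_derive_eq; rewrite /GRing.scale /=; ring.
have sa := sinh_gt0 a0; have c0 := coth_gt0 a0.
have sy : y <= sinh y by exact: sinh_ge.
have sya : sinh y < sinh a by apply: ltr_sinh; lra.
have s0 := sinh_ge0 y0.
have t1 : 0 <= (sinh y / sinh a) ^+ 2 < 1.
  rewrite sqr_ge0/= expr_lt1//; last exact: divr_ge0 s0 (ltW sa).
  by rewrite ltr_pdivrMr// mul1r.
have t2 : (y / sinh a) ^+ 2 <= (sinh y / sinh a) ^+ 2.
  apply: lerXn2r; rewrite ?nnegrE.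
  - exact: divr_ge0 y0 (ltW sa).
  - exact: divr_ge0 s0 (ltW sa).
  - by rewrite ler_pM2r ?invr_gt0.
rewrite subr_ge0; have -> : 2 * coth a + 3 * cubic_coef a * y ^+ 2 = 2 * coth a * (1 + (y / sinh a) ^+ 2).
  by rewrite /cubic_coef; field; rewrite gt_eqF.
have cc : 0 < 2 * coth a by lra.
rewrite (ler_pM2l cc); move: t1 t2.
move: ((sinh y / sinh a) ^+ 2) ((y / sinh a) ^+ 2) => t t' /andP[t1 t1'] tt.
rewrite -[leRHS]mul1r ler_pdivlMr; last lra.
nra.
Qed.

(** For small [b] the geometric series in [t] is at most [1 + t + 2 * t ^ 2], and
[sinh b ^ 2 <= b ^ 2 + 3 * b ^ 4]. The constants are uniform in [a >= a0], because
[a] will move with [n]. *)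
Lemma ln_sinh_quot_le a0 : 0 < a0 -> exists b0 K : R, [/\ 0 < b0, b0 < a0, 0 <= K &
  forall a b, a0 <= a -> 0 <= b <= b0 ->
    ln_sinh_quot a b <= 2 * coth a * b + cubic_coef a * b ^+ 3 + K * b ^+ 5].
Proof.
move=> a00; have s0 := sinh_gt0 a00; have c0 := coth_gt0 a00.
set s := sinh a0 in s0 *.
pose b0 := Num.min (1 / 2) (Num.min (a0 / 2) (s / 2)).
(* [3 / s ^ 2] comes from the quartic term in the bound of [sinh b ^ 2], [8 / s ^ 4]
   from [2 * t ^ 2] with [sinh b ^ 2 <= 2 * b ^ 2], and [1 / 5] from integration. *)
pose K := 2 * coth a0 * (3 / s ^+ 2 + 8 / s ^+ 4) / 5.
have b00 : 0 < b0 by rewrite !lt_min; apply/and3P; split; lra.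
have [b1 b2 b3] : [/\ b0 <= 1 / 2, b0 <= a0 / 2 & b0 <= s / 2].
  by rewrite /b0 !ge_min !lexx !orbT.
have K0 : 0 <= K.
  have h2 : 0 < 3 / s ^+ 2 by rewrite divr_gt0// exprn_gt0.
  have h4 : 0 < 8 / s ^+ 4 by rewrite divr_gt0// exprn_gt0.
  rewrite /K divr_ge0//; apply: mulr_ge0; lra.
have KE : 5 * K = 2 * coth a0 * (3 * (s ^+ 2)^-1 + 8 * (s ^+ 2)^-1 ^+ 2).
  by rewrite /K; field; rewrite gt_eqF.
clearbody K b0; exists b0, K; split => //; first lra.
move=> a b aa /andP[bge ble]; have a_gt0 : 0 < a by lra.
have sa : s <= sinh a by exact: ler_sinh.
have sa0 : 0 < sinh a by lra.
have ca := coth_gt0 a_gt0.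
have cle : coth a <= coth a0.
  rewrite /coth ler_pdivrMr// mulrAC ler_pdivlMr//.
  have : 0 <= sinh (a - a0) by apply: sinh_ge0; lra.
  rewrite sinhD sinhN coshN; lra.
rewrite -subr_ge0.
have -> : 0 = 2 * coth a * 0 + cubic_coef a * 0 ^+ 3 + K * 0 ^+ 5 - ln_sinh_quot a 0.
  by rewrite ln_sinh_quot0 !expr0n /=; lra.
apply: (@derive_ge0_le (fun b => 2 * coth a * b + cubic_coef a * b ^+ 3 + K * b ^+ 5 - ln_sinh_quot a b)
 (fun b => 2 * coth a + 3 * cubic_coef a * b ^+ 2 + 5 * K * b ^+ 4 -
    2 * coth a / (1 - (sinh b / sinh a) ^+ 2))); last exact: bge.
  move=> y /andP[y0 yb].
  have h : is_derive y 1 (ln_sinh_quot a) (2 * coth a / (1 - (sinh y / sinh a) ^+ 2)).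
    by apply: is_derive_ln_sinh_quot; lra.
  by apply: is_derive_eq; rewrite /GRing.scale /=; ring.
move=> y /andP[y0 yb].
have y12 : 0 <= y <= 1 / 2 by lra.
have sy0 := sinh_ge0 y0; have sy := sinh_le_cubic y12.
have y2 : 0 <= y ^+ 2 <= 1 / 4 by rewrite sqr_ge0/=; nra.
have sy2 : sinh y ^+ 2 <= y ^+ 2 * (1 + y ^+ 2) ^+ 2.
  have -> : y ^+ 2 * (1 + y ^+ 2) ^+ 2 = (y + y ^+ 3) ^+ 2 by ring.
  by apply: lerXn2r; rewrite ?nnegrE//; apply: le_trans sy.
have sy4 : sinh y ^+ 2 <= y ^+ 2 + 3 * y ^+ 4.
  apply: le_trans sy2 _; rewrite (_ : y ^+ 4 = y ^+ 2 * y ^+ 2); last by ring.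
  move: (y ^+ 2) y2 => t /andP[t0 t1]; nra.
have sy3 : sinh y ^+ 2 <= 2 * y ^+ 2.
  apply: le_trans sy2 _; move: (y ^+ 2) y2 => t /andP[t0 t1]; nra.
have v0 : 0 < (sinh a ^+ 2)^-1 by rewrite invr_gt0 exprn_gt0.
set V := (sinh a ^+ 2)^-1 in v0.
have vle : V <= (s ^+ 2)^-1.
  by rewrite lef_pV2 ?posrE ?exprn_gt0//; apply: lerXn2r; rewrite ?nnegrE ?(ltW s0) ?(ltW sa0).
set V0 := (s ^+ 2)^-1 in vle.
have yV : y ^+ 2 * V0 <= 1 / 4.
  have : (y / s) ^+ 2 <= (1 / 2) ^+ 2.
    apply: lerXn2r; rewrite ?nnegrE; [exact: divr_ge0 y0 (ltW s0)|lra|].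
    by rewrite ler_pdivrMr//; lra.
  by rewrite expr_div_n -/V0; lra.
have -> : (sinh y / sinh a) ^+ 2 = sinh y ^+ 2 * V by rewrite expr_div_n.
have -> : 3 * cubic_coef a = 2 * coth a * V by rewrite /cubic_coef -/V; field.
have hK : 2 * coth a * (3 * V + 8 * V ^+ 2) <= 5 * K.
  rewrite KE -/V0.
  apply: ler_pM; [lra| |lra|].
    by have := sqr_ge0 V; lra.
  have : V ^+ 2 <= V0 ^+ 2 by apply: lerXn2r; rewrite ?nnegrE; lra.
  lra.
rewrite subr_ge0.
apply: (@le_trans _ _ (2 * coth a * (1 + V * y ^+ 2 + (3 * V + 8 * V ^+ 2) * y ^+ 4))); last first.
  have : 0 <= y ^+ 4 by rewrite exprn_ge0.
  move: hK; move: (5 * K) (y ^+ 4) => k t; nra.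
have cc : 0 < 2 * coth a by lra.
rewrite (ler_pM2l cc).
have x0 : 0 <= sinh y ^+ 2 * V by rewrite mulr_ge0 ?sqr_ge0 ?ltW.
have x1 : sinh y ^+ 2 * V <= 1 / 2.
  have : sinh y ^+ 2 * V <= 2 * y ^+ 2 * V0 by apply: ler_pM => //; [exact: sqr_ge0|exact: ltW].
  lra.
have x2 : sinh y ^+ 2 * V <= V * y ^+ 2 + 3 * V * y ^+ 4 by nra.
have x3 : (sinh y ^+ 2 * V) ^+ 2 <= 4 * V ^+ 2 * y ^+ 4.
  have -> : 4 * V ^+ 2 * y ^+ 4 = (2 * y ^+ 2 * V) ^+ 2 by ring.
  apply: lerXn2r; rewrite ?nnegrE//; last by rewrite ler_pM2r.
  by rewrite mulr_ge0 ?(ltW v0)// mulr_ge0// sqr_ge0.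
apply: (@le_trans _ _ (1 + sinh y ^+ 2 * V + 2 * (sinh y ^+ 2 * V) ^+ 2)); last lra.
move: (sinh y ^+ 2 * V) x0 x1 => t t0 t1.
by rewrite -[leLHS]mul1r ler_pdivrMr; nra.
Qed.

End Hyperbolic.

(** * Ratios of the binomial coefficients *)

Section Coefficients.
Context {R : realType}.
Variables (z g : R).
Hypothesis z0 : 0 < z.
Implicit Types (n m k l : nat).

(** The Pochhammer symbol [(r; r)_j]. *)
Definition qfac (r : R) j : R := \prod_(1 <= i < j.+1) (1 - r ^+ i).

Lemma qfacS r j : qfac r j.+1 = qfac r j * (1 - r ^+ j.+1).
Proof. by rewrite /qfac big_nat_recr. Qed.

Lemma r_itv n : (0 < n)%N -> 0 < r_ z n < 1.
Proof.
by move=> n0; rewrite /r_ expR_gt0 expR_lt1 mulNr oppr_lt0 divr_gt0// ltr0n.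
Qed.

Lemma qfac_gt0 n j : (0 < n)%N -> 0 < qfac (r_ z n) j.
Proof.
move=> n0; have /andP[r0 r1] := r_itv n0; rewrite /qfac big_seq.
apply: prodr_gt0 => i; rewrite mem_index_iota => /andP[i0 _].
by rewrite subr_gt0 exprn_ilt1// ?ltW// -lt0n.
Qed.

(** [p ^ i - q ^ i = p ^ i * (1 - r ^ i)] separates the powers of [p], whose exponents
add up to [k * (n - k)], from a Gaussian binomial coefficient in [r]. *)
Lemma C_qfac n k : (0 < n)%N -> (k <= n)%N ->
  C_ z g n k = p_ z g n ^+ (k * (n - k)) * qfac (r_ z n) n /
    (qfac (r_ z n) k * qfac (r_ z n) (n - k)).
Proof.
move=> n0 kn; rewrite /C_ /pq_binomial /q_.
set p := p_ z g n; set r := r_ z n.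
have p0 : p != 0 by rewrite gt_eqF// expR_gt0.
have F0 j : qfac r j != 0 by rewrite gt_eqF// qfac_gt0.
have -> : qfac r n = qfac r (n - k + k) by rewrite subnK.
move: (n - k)%N => j; elim: k {kn} => [|k IH].
  rewrite big_geq// addn0 mul0n expr0 mul1r.
  by rewrite [qfac r 0]big_geq// mul1r divff ?F0.
rewrite big_nat_recr//= IH addnS !qfacS.
have h i : p ^+ i - (p * r) ^+ i = p ^+ i * (1 - r ^+ i) by rewrite exprMn mulrBr mulr1.
have r1 i : 1 - r ^+ i.+1 != 0.
  have /andP[rr0 rr1] := r_itv n0.
  by rewrite gt_eqF// subr_gt0 exprn_ilt1// ltW.
rewrite !h mulSn -addnS addnC !exprD.
by field; rewrite ?F0 ?r1 ?expf_neq0.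
Qed.

Lemma C_gt0 n k : (0 < n)%N -> (k <= n)%N -> 0 < C_ z g n k.
Proof.
move=> n0 kn; rewrite C_qfac// divr_gt0// mulr_gt0 ?qfac_gt0//.
by rewrite exprn_gt0// expR_gt0.
Qed.

Lemma C_sym n k : (0 < n)%N -> (k <= n)%N -> C_ z g n (n - k) = C_ z g n k.
Proof.
move=> n0 kn; rewrite !C_qfac ?leq_subr// subKn// mulnC.
by congr (_ / _); rewrite mulrC.
Qed.

(** Throughout, [n = m.*2], and [l] is the distance from the centre. *)
Definition outer_ratio m l : R := C_ z g m.*2 (m + l) / C_ z g m.*2 m.

Lemma outer_ratio0 m : (0 < m)%N -> outer_ratio m 0 = 1.
Proof.
move=> m0; rewrite /outer_ratio addn0 divff// gt_eqF// C_gt0 ?double_gt0//.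
by rewrite -addnn leq_addr.
Qed.

Lemma outer_ratio_gt0 m l : (0 < m)%N -> (l <= m)%N -> 0 < outer_ratio m l.
Proof.
by move=> m0 lm; apply: divr_gt0; apply: C_gt0;
  rewrite ?double_gt0// -addnn ?leq_add2l// leq_addr.
Qed.

Definition odd_frac m l : R := (2 * l + 1)%:R / m.*2%:R.

Lemma outer_ratioS m l : (l < m)%N ->
  outer_ratio m l.+1 = outer_ratio m l * (expR (u_ z g m.*2 * odd_frac m l) *
    ((1 - r_ z m.*2 ^+ (m - l)) / (1 - r_ z m.*2 ^+ (m + l).+1))).
Proof.
move=> lm; have m0 : (0 < m)%N by case: m lm.
have n0 : (0 < m.*2)%N by rewrite double_gt0.
have le1 : (m + l.+1 <= m.*2)%N by rewrite -addnn leq_add2l.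
have le2 : (m + l <= m.*2)%N by rewrite (leq_trans _ le1)// leq_add2l.
have C0 : C_ z g m.*2 m != 0 by rewrite gt_eqF// C_gt0// -addnn leq_addr.
rewrite /outer_ratio (C_qfac n0 le1) (C_qfac n0 le2).
set p := p_ z g m.*2; set r := r_ z m.*2; set C0' := C_ z g m.*2 m.
have p0 : p != 0 by rewrite gt_eqF// expR_gt0.
have F0 j : qfac r j != 0 by rewrite gt_eqF// qfac_gt0.
have -> : expR (u_ z g m.*2 * odd_frac m l) = (p ^+ (2 * l + 1))^-1.
  rewrite /p /p_ -expRM_natr -expRN /odd_frac; congr expR.
  by rewrite !mulNr opprK mulrA mulrAC.
have e1 : (m.*2 - (m + l) = (m - l.+1).+1)%N by rewrite -addnn; lia.
have e2 : (m.*2 - (m + l.+1) = m - l.+1)%N by rewrite -addnn; lia.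
rewrite e1 e2 addnS !qfacS.
have -> : (m - l = (m - l.+1).+1)%N by lia.
have -> : ((m + l) * (m - l.+1).+1 = (m + l).+1 * (m - l.+1) + (2 * l + 1))%N.
  set d := (m - l.+1)%N; have -> : m = (d + l.+1)%N by rewrite /d subnK.
  by ring.
rewrite exprD.
have r1 i : 1 - r ^+ i.+1 != 0.
  have /andP[rr0 rr1] := r_itv n0.
  by rewrite gt_eqF// subr_gt0 exprn_ilt1// ltW.
by field; rewrite ?F0 ?r1 ?expf_neq0 ?F0 ?C0.
Qed.

(** Half the sum of [(m + l + 1) * z / (2 * n)] and [(m - l) * z / (2 * n)], the
arguments of the two hyperbolic sines below; half their difference is
[z / 4 * odd_frac m l]. *)
Definition midpoint m : R := z / 4 * (1 + m.*2%:R^-1).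

(** [1 - r ^ j = 2 * expR (- x) * sinh x] with [x = j * z / (2 * n)]. The
exponentials contribute [z / 2 * odd_frac m l]. *)
Lemma outer_ratioS_expR m l : (l < m)%N ->
  outer_ratio m l.+1 = outer_ratio m l * expR (u_ z g m.*2 * odd_frac m l + z / 2 * odd_frac m l -
    ln_sinh_quot (midpoint m) (z / 4 * odd_frac m l)).
Proof.
move=> lm; rewrite outer_ratioS//; congr (_ * _).
rewrite -addrA expRD; congr (_ * _).
have N0 : 0 < m.*2%:R :> R by rewrite ltr0n double_gt0; case: m lm.
set a := midpoint m; set b := z / 4 * odd_frac m l.
have ab1 : r_ z m.*2 ^+ (m + l).+1 = expR (- (2 * (a + b))).
  rewrite /r_ -expRM_natr; congr expR; rewrite /a /b /midpoint /odd_frac.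
  have -> : (m + l).+1%:R = (m.*2%:R + (2 * l + 1)%:R + 1) / 2 :> R.
    by rewrite -muln2 -[(m + l).+1]addn1 !natrD !natrM; field.
  by field; rewrite gt_eqF.
have ab2 : r_ z m.*2 ^+ (m - l) = expR (- (2 * (a - b))).
  rewrite /r_ -expRM_natr; congr expR; rewrite /a /b /midpoint /odd_frac.
  have -> : (m - l)%:R = (m.*2%:R - (2 * l + 1)%:R + 1) / 2 :> R.
    by rewrite natrB ?(ltnW lm)// -muln2 natrD !natrM; field.
  by field; rewrite gt_eqF.
have ba : 0 < a - b.
  rewrite /a /b /midpoint /odd_frac -mulrBr mulr_gt0 ?divr_gt0//.
  have : (2 * l + 1)%:R / m.*2%:R < 1 :> R.
    by rewrite ltr_pdivrMr// mul1r ltr_nat -muln2; lia.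
  by have : 0 < m.*2%:R^-1 :> R; [rewrite invr_gt0|lra].
have bge : 0 <= b by rewrite /b mulr_ge0 ?divr_ge0 ?(ltW z0)// ltW.
have aux x : 1 - expR (- (2 * x)) = 2 * expR (- x) * sinh x.
  rewrite /sinh; have -> : - (2 * x) = - x + - x by ring.
  rewrite expRD; have h : expR x * expR (- x) = 1 by rewrite expRN divff ?gt_eqF ?expR_gt0.
  by move: h; set X := expR x; set Y := expR (- x) => h; rewrite -[V in V - _]h; field.
have s1 : 0 < sinh (a + b) by apply: sinh_gt0; lra.
have s2 : 0 < sinh (a - b) by exact: sinh_gt0.
rewrite ab1 ab2 !aux.
have -> : z / 2 * odd_frac m l = - (a - b) - - (a + b) by rewrite /b; field.
rewrite expRB /ln_sinh_quot expRB !lnK ?posrE// expRD opprK.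
have n1 : expR (a + b) != 0 by rewrite gt_eqF ?expR_gt0.
by rewrite (expRN (a + b)); field; rewrite n1 (gt_eqF s1) (gt_eqF s2).
Qed.

Lemma outer_ratio_expR m l : (l <= m)%N -> (0 < m)%N ->
  outer_ratio m l = expR (\sum_(i < l) (u_ z g m.*2 * odd_frac m i + z / 2 * odd_frac m i -
    ln_sinh_quot (midpoint m) (z / 4 * odd_frac m i))).
Proof.
move=> lm m0; elim: l lm => [|l IH] lm; first by rewrite big_ord0 expR0 outer_ratio0.
by rewrite outer_ratioS_expR// IH ?(ltnW lm)// big_ord_recr /= [RHS]expRD.
Qed.

Lemma sum_odd_frac m l : \sum_(i < l) odd_frac m i = l%:R ^+ 2 / m.*2%:R.
Proof.
rewrite /odd_frac -mulr_suml; congr (_ / _).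
elim: l => [|l IH]; first by rewrite big_ord0 expr0n.
by rewrite big_ord_recr /= IH -natr1 [(2 * l + 1)%:R]natrD natrM; ring.
Qed.

Lemma sum_odd_frac3 m l : \sum_(i < l) odd_frac m i ^+ 3 =
  (2 * l%:R ^+ 4 - l%:R ^+ 2) / m.*2%:R ^+ 3.
Proof.
under eq_bigr do rewrite /odd_frac expr_div_n.
rewrite -mulr_suml; congr (_ / _).
elim: l => [|l IH]; first by rewrite big_ord0 !expr0n mulr0 subrr.
by rewrite big_ord_recr /= IH -natr1 [(2 * l + 1)%:R]natrD natrM; ring.
Qed.

Lemma sum_odd_frac5 m l : \sum_(i < l) odd_frac m i ^+ 5 <=
  32 * l%:R ^+ 6 / m.*2%:R ^+ 5.
Proof.
under eq_bigr do rewrite /odd_frac expr_div_n.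
rewrite -mulr_suml ler_wpM2r ?invr_ge0 ?exprn_ge0//.
apply: (@le_trans _ _ (\sum_(i < l) (2 * l%:R) ^+ 5)).
  apply: ler_sum => i _; apply: lerXn2r; rewrite ?nnegrE ?mulr_ge0//.
  by rewrite -natrM ler_nat; have := ltn_ord i; lia.
rewrite sumr_const card_ord -[X in X <= _]mulr_natr.
by have -> : (2 * l%:R) ^+ 5 * l%:R = 32 * l%:R ^+ 6 :> R by ring.
Qed.

Lemma n34_gt0 n : (0 < n)%N -> 0 < n34 (R := R) n.
Proof. by move=> n0; rewrite /n34 powR_gt0// ltr0n. Qed.

Lemma n34_sq n : n34 (R := R) n ^+ 2 = n%:R * Num.sqrt n%:R.
Proof.
have [->|n0] := posnP n.
  by rewrite mul0r /n34 powR0 ?expr0n//; apply/eqP; lra.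
rewrite /n34 -powR_mulrn ?powR_ge0// -powRrM.
rewrite -powR12_sqrt ?ler0n// -{2}[n%:R]powRr1 ?ler0n// -powRD.
  by congr powR; lra.
by apply/implyP => _; rewrite pnatr_eq0 -lt0n.
Qed.

End Coefficients.

(** * Quartic asymptotics of the coefficients *)

Lemma cvg_exprn {R : realType} {T : Type} {F : set_system T} {FF : Filter F}
  (u : T -> R) (l : R) k : u x @[x --> F] --> l -> u x ^+ k @[x --> F] --> l ^+ k.
Proof.
move=> h; elim: k => [|k IH]; first by under eq_fun do rewrite expr0; exact: cvg_cst.
by rewrite exprS; under eq_fun do rewrite exprS; exact: cvgM.
Qed.

Section RatioAsymptotics.
Context {R : realType}.
Variables (z g : R).
Hypothesis z0 : 0 < z.
Implicit Types (n m k l : nat).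

Definition scaled_dist m l : R := l%:R / n34 m.*2.

(** [quartic_coef] and [quadratic_coef] are versions of [B_ z] and [g] at finite [n].
They absorb the lower order terms, which makes [sum_main_terms] an identity. *)
Definition quartic_coef m : R := 24 * cubic_coef (midpoint z m) * (z / 4) ^+ 3.

Definition quadratic_coef m : R :=
  g + z / 2 * (coth (z / 4) - coth (midpoint z m)) * Num.sqrt m.*2%:R +
  quartic_coef m / 24 / (m.*2%:R * Num.sqrt m.*2%:R).

Lemma sqrt_double_gt0 m : (0 < m)%N -> 0 < Num.sqrt m.*2%:R :> R.
Proof. by move=> m0; rewrite sqrtr_gt0 ltr0n double_gt0. Qed.

Lemma scaled_dist_sq m l : (0 < m)%N ->
  scaled_dist m l ^+ 2 = l%:R ^+ 2 / (m.*2%:R * Num.sqrt m.*2%:R).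
Proof. by move=> m0; rewrite /scaled_dist expr_div_n n34_sq. Qed.

(** The choice of [u_ z g n] cancels the quadratic term of order [sqrt n], up to the
difference between [coth (z / 4)] and [coth (midpoint z m)]. *)
Lemma sum_main_terms m l : (0 < m)%N ->
  \sum_(i < l) (u_ z g m.*2 * odd_frac m i + z / 2 * odd_frac m i -
    (2 * coth (midpoint z m) * (z / 4 * odd_frac m i) +
      cubic_coef (midpoint z m) * (z / 4 * odd_frac m i) ^+ 3)) =
  quadratic_coef m * scaled_dist m l ^+ 2 - quartic_coef m / 12 * scaled_dist m l ^+ 4.
Proof.
move=> m0; set c := coth (midpoint z m); set K := cubic_coef (midpoint z m).
have -> : \sum_(i < l) (u_ z g m.*2 * odd_frac m i + z / 2 * odd_frac m i -
    (2 * c * (z / 4 * odd_frac m i) + K * (z / 4 * odd_frac m i) ^+ 3)) =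
  (u_ z g m.*2 + z / 2 - c * (z / 2)) * \sum_(i < l) odd_frac m i -
  K * (z / 4) ^+ 3 * \sum_(i < l) odd_frac m i ^+ 3.
  rewrite !mulr_sumr -sumrB; apply: eq_bigr => i _.
  by rewrite exprMn; field.
rewrite sum_odd_frac sum_odd_frac3.
have -> : scaled_dist m l ^+ 4 = (scaled_dist m l ^+ 2) ^+ 2 by rewrite -exprM.
rewrite scaled_dist_sq// /quadratic_coef /quartic_coef -/c -/K /u_ /A_.
have s0 := sqrt_double_gt0 m0; set s := Num.sqrt m.*2%:R in s0 *.
have -> : m.*2%:R = s ^+ 2 by rewrite sqr_sqrtr.
by field; rewrite gt_eqF.
Qed.

Lemma odd_frac_lt1 m i : (0 < m)%N -> (i < m)%N -> 0 <= (odd_frac m i : R) < 1.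
Proof.
move=> m0 im; rewrite divr_ge0//= ltr_pdivrMr ?ltr0n ?double_gt0//.
by rewrite mul1r ltr_nat -muln2; lia.
Qed.

Lemma midpoint_ge m : z / 4 <= midpoint z m.
Proof. by rewrite /midpoint ler_peMr ?divr_ge0 ?(ltW z0)// lerDl invr_ge0. Qed.

Lemma outer_ratio_le m l : (0 < m)%N -> (l <= m)%N ->
  outer_ratio z g m l <= expR (quadratic_coef m * scaled_dist m l ^+ 2 - quartic_coef m / 12 * scaled_dist m l ^+ 4).
Proof.
move=> m0 lm; rewrite outer_ratio_expR// ler_expR -sum_main_terms//; apply: ler_sum => i _.
rewrite lerD2l lerN2; apply: ln_sinh_quot_ge.
have /andP[s0 s1] := odd_frac_lt1 m0 (leq_trans (ltn_ord i) lm).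
have := midpoint_ge m; have q0 : 0 < z / 4 by rewrite divr_gt0.
by rewrite mulr_ge0 ?(ltW q0)//= => h; apply: lt_le_trans h; rewrite -[ltRHS]mulr1 ltr_pM2l.
Qed.

(** The quintic remainders add up to [O(l ^ 6 / n ^ 5)], which is
[O(x ^ 6 / sqrt n)] at [x = l / n ^ (3/4)]. *)
Lemma outer_ratio_ge : exists d K : R, [/\ 0 < d, 0 <= K &
  forall m l, (0 < m)%N -> (l <= m)%N -> l%:R / m.*2%:R <= d ->
  expR (quadratic_coef m * scaled_dist m l ^+ 2 - quartic_coef m / 12 * scaled_dist m l ^+ 4 -
    K * scaled_dist m l ^+ 6 / Num.sqrt m.*2%:R) <= outer_ratio z g m l].
Proof.
have q0 : 0 < z / 4 by rewrite divr_gt0.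
have [b0 [K [b00 b0q K0 HK]]] := ln_sinh_quot_le q0.
exists (b0 / (2 * (z / 4))), (K * (z / 4) ^+ 5 * 32); split.
- by rewrite divr_gt0// mulr_gt0.
- by apply: mulr_ge0 => //; apply: mulr_ge0 => //; rewrite exprn_ge0// ltW.
move=> m l m0 lm ld; rewrite outer_ratio_expR// ler_expR.
have N0 : 0 < m.*2%:R :> R by rewrite ltr0n double_gt0.
apply: (@le_trans _ _ (\sum_(i < l) (u_ z g m.*2 * odd_frac m i + z / 2 * odd_frac m i -
    (2 * coth (midpoint z m) * (z / 4 * odd_frac m i) +
      cubic_coef (midpoint z m) * (z / 4 * odd_frac m i) ^+ 3)) -
   K * (z / 4) ^+ 5 * \sum_(i < l) odd_frac m i ^+ 5)).
  rewrite sum_main_terms// lerD2l lerN2.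
  have -> : K * (z / 4) ^+ 5 * 32 * scaled_dist m l ^+ 6 / Num.sqrt m.*2%:R =
     K * (z / 4) ^+ 5 * (32 * l%:R ^+ 6 / m.*2%:R ^+ 5).
    have -> : scaled_dist m l ^+ 6 = (scaled_dist m l ^+ 2) ^+ 3 by rewrite -exprM.
    rewrite scaled_dist_sq//.
    have s0 := sqrt_double_gt0 m0; set s := Num.sqrt m.*2%:R in s0 *.
    have -> : m.*2%:R = s ^+ 2 by rewrite sqr_sqrtr.
    by field; rewrite gt_eqF.
  apply: ler_wpM2l; last exact: sum_odd_frac5.
  by rewrite mulr_ge0// exprn_ge0// ltW.
rewrite mulr_sumr -sumrB; apply: ler_sum => i _.
have -> : K * (z / 4) ^+ 5 * odd_frac m i ^+ 5 = K * (z / 4 * odd_frac m i) ^+ 5.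
  by field.
rewrite -addrA lerD2l -opprD lerN2; apply: HK; first exact: midpoint_ge.
have /andP[s0 s1] := odd_frac_lt1 m0 (leq_trans (ltn_ord i) lm).
rewrite mulr_ge0 ?(ltW q0)//= mulrC -ler_pdivlMr//.
apply: (@le_trans _ _ (2 * (l%:R / m.*2%:R))).
  rewrite /odd_frac mulrA ler_pM2r ?invr_gt0// -natrM ler_nat.
  by have := ltn_ord i; lia.
have -> : b0 / (z / 4) = 2 * (b0 / (2 * (z / 4))) by field; rewrite gt_eqF.
by rewrite ler_pM2l.
Qed.

Lemma cvg_doubleV : (m.*2%:R : R)^-1 @[m --> \oo] --> (0 : R).
Proof.
apply: (@squeeze_cvgr _ _ _ _ (fun=> 0) (fun m => (m.+1%:R : R)^-1)); last 2 first.
- exact: cvg_cst.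
- exact: cvg_harmonic.
near=> m; rewrite invr_ge0 ler0n/= lef_pV2 ?posrE ?ltr0n ?double_gt0//.
  by rewrite ler_nat -addnn -addn1 leq_add2l; near: m; exists 1%N.
by near: m; exists 1%N.
Unshelve. all: by end_near. Qed.

Lemma cvg_sqrt_doubleV : (Num.sqrt (m.*2%:R : R))^-1 @[m --> \oo] --> (0 : R).
Proof.
have h : Num.sqrt ((m.*2%:R : R)^-1) @[m --> \oo] --> (Num.sqrt 0 : R).
  by apply: continuous_cvg; [exact: sqrt_continuous|exact: cvg_doubleV].
rewrite sqrtr0 in h; apply: cvg_trans h; apply: near_eq_cvg; apply: nearW => m.
by rewrite sqrtrV.
Qed.

Lemma cvg_midpoint : midpoint z m @[m --> \oo] --> (z / 4 : R).
Proof.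
have h : z / 4 * (1 + (m.*2%:R : R)^-1) @[m --> \oo] --> (z / 4 * (1 + 0) : R).
  by apply: cvgMr; apply: cvgD; [exact: cvg_cst|exact: cvg_doubleV].
by rewrite addr0 mulr1 in h.
Qed.

Lemma cvg_sinh_midpoint : sinh (midpoint z m) @[m --> \oo] --> (sinh (z / 4) : R).
Proof.
apply: continuous_cvg; last exact: cvg_midpoint.
apply: differentiable_continuous; apply/derivable1_diffP.
by have [] := is_derive_sinh (z / 4).
Qed.

Lemma cvg_coth_midpoint : coth (midpoint z m) @[m --> \oo] --> (coth (z / 4) : R).
Proof.
apply: cvgM; last first.
  by apply: cvgV; [rewrite gt_eqF// sinh_gt0// divr_gt0|exact: cvg_sinh_midpoint].
apply: continuous_cvg; last exact: cvg_midpoint.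
apply: differentiable_continuous; apply/derivable1_diffP.
by have [] := is_derive_cosh (z / 4).
Qed.

(** The duplication formula for [sinh (z / 2)] identifies [B_ z] with
[24 * cubic_coef (z / 4) * (z / 4) ^ 3]. *)
Lemma cvg_quartic_coef : quartic_coef m @[m --> \oo] --> (B_ z : R).
Proof.
have s0 : 0 < sinh (z / 4) by rewrite sinh_gt0// divr_gt0.
have -> : B_ z = 24 * (2 / 3 * coth (z / 4) * (sinh (z / 4) ^+ 2)^-1) * (z / 4) ^+ 3.
  rewrite /B_; have -> : z / 2 = z / 4 + z / 4 by field.
  by rewrite sinhD /coth; field; rewrite gt_eqF.
apply: cvgM; last exact: cvg_cst.
apply: cvgM; first exact: cvg_cst.
apply: cvgM; first by apply: cvgM; [exact: cvg_cst|exact: cvg_coth_midpoint].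
apply: cvgV; first by rewrite gt_eqF// exprn_gt0.
exact: cvg_exprn cvg_sinh_midpoint.
Qed.

(** The difference of the two values of [coth] is [O(1 / n)], which beats [sqrt n]. *)
Lemma cvg_quadratic_coef : quadratic_coef m @[m --> \oo] --> (g : R).
Proof.
have q0 : 0 < z / 4 by rewrite divr_gt0.
have s0 : 0 < sinh (z / 4) by exact: sinh_gt0.
have h1 : z / 2 * (coth (z / 4) - coth (midpoint z m)) * Num.sqrt m.*2%:R
    @[m --> \oo] --> (0 : R).
  pose K := z / 2 * (z / 2) / sinh (z / 4) ^+ 2.
  have hK : K * (Num.sqrt m.*2%:R)^-1 @[m --> \oo] --> (K * 0 : R).
    by apply: cvgMr; exact: cvg_sqrt_doubleV.
  rewrite mulr0 in hK; apply: (squeeze_cvgr _ (cvg_cst 0) hK).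
  have e1 : 0 < (1 / 2) / (z / 4) by rewrite divr_gt0.
  near=> m.
  have m0 : (0 < m)%N by near: m; exists 1%N.
  have t1 : m.*2%:R^-1 < (1 / 2) / (z / 4) by near: m; exact: cvgr_lt cvg_doubleV _ e1.
  have N0 : 0 < m.*2%:R :> R by rewrite ltr0n double_gt0.
  set a := midpoint z m; pose t := z / 4 * m.*2%:R^-1.
  have aE : a = z / 4 + t by rewrite /a /midpoint mulrDr mulr1.
  have t0 : 0 < t by rewrite mulr_gt0 ?invr_gt0.
  have t2 : t <= 1 / 2 by rewrite /t mulrC -ler_pdivlMr// ltW.
  have sa : sinh (z / 4) <= sinh a by apply: ler_sinh; exact: midpoint_ge.
  have sa0 : 0 < sinh a by lra.
  have -> : coth (z / 4) - coth a = sinh t / (sinh a * sinh (z / 4)).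
    have -> : t = a + - (z / 4) by rewrite aE; ring.
    by rewrite sinhD sinhN coshN /coth; field; rewrite !gt_eqF.
  have sqrt0 := sqrt_double_gt0 m0.
  apply/andP; split.
    apply: mulr_ge0; last exact: ltW.
    apply: mulr_ge0; first by rewrite divr_ge0// ltW.
    apply: divr_ge0; first exact: sinh_ge0 (ltW t0).
    by apply: mulr_ge0; exact: ltW.
  have st : sinh t <= 2 * t by apply: sinh_le2x; rewrite t2 ltW.
  have st0 : 0 <= sinh t by apply: sinh_ge0; exact: ltW.
  apply: (@le_trans _ _ (z / 2 * (2 * t / (sinh (z / 4) ^+ 2)) * Num.sqrt m.*2%:R)).
    rewrite ler_wpM2r ?(ltW sqrt0)// ler_wpM2l ?divr_ge0 ?(ltW z0)//.
    apply: ler_pM => //; first by rewrite invr_ge0 mulr_ge0// ltW.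
    rewrite lef_pV2 ?posrE; first by rewrite expr2 ler_pM2r.
      exact: mulr_gt0.
    exact: exprn_gt0.
  rewrite le_eqVlt; apply/orP; left; apply/eqP; rewrite /K /t.
  set s := Num.sqrt m.*2%:R in sqrt0 *.
  have -> : m.*2%:R = s ^+ 2 by rewrite sqr_sqrtr.
  by field; rewrite !gt_eqF.
have h2 : quartic_coef m / 24 / (m.*2%:R * Num.sqrt m.*2%:R) @[m --> \oo] --> (B_ z / 24 * (0 * 0) : R).
  under eq_fun do rewrite invfM.
  apply: cvgM; first by apply: cvgM; [exact: cvg_quartic_coef|exact: cvg_cst].
  by apply: cvgM; [exact: cvg_doubleV|exact: cvg_sqrt_doubleV].
have h := cvgD (cvgD (cvg_cst g) h1) h2.
rewrite !mulr0 !addr0 in h; apply: cvg_trans (h _ _ _).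
by apply: near_eq_cvg; apply: nearW => m.
Unshelve. all: by end_near. Qed.

Lemma B_gt0 : 0 < B_ z.
Proof.
have [h2 h4] : 0 < z / 2 /\ 0 < z / 4 by split; rewrite divr_gt0.
apply: divr_gt0; apply: mulr_gt0 => //; first exact: exprn_gt0.
  exact: sinh_gt0.
by apply: exprn_gt0; exact: sinh_gt0.
Qed.

(** [outer_ratio_le] holds for every [l]; half of the quartic coefficient is given up
to replace the moving coefficients by fixed ones. *)
Lemma outer_ratio_dominated : \forall m \near \oo, forall l, (l <= m)%N ->
  outer_ratio z g m l <= expR ((`|g| + 1) * scaled_dist m l ^+ 2 - B_ z / 24 * scaled_dist m l ^+ 4).
Proof.
have B0 := B_gt0.
near=> m => l lm.
have m0 : (0 < m)%N by near: m; exists 1%N.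
apply: le_trans (outer_ratio_le m0 lm) _; rewrite ler_expR.
have h1 : quadratic_coef m < `|g| + 1.
  near: m; apply: (cvgr_lt _ cvg_quadratic_coef).
  by rewrite ltr_pwDr// ler_norm.
have h2 : B_ z / 2 < quartic_coef m.
  by near: m; apply: (cvgr_gt _ cvg_quartic_coef); lra.
have y2 := sqr_ge0 (scaled_dist m l); have y4 : 0 <= scaled_dist m l ^+ 4 by rewrite exprn_even_ge0.
apply: lerB; first by rewrite ler_wpM2r// ltW.
by rewrite ler_wpM2r//; lra.
Unshelve. all: by end_near. Qed.

(** Squeezed between [outer_ratio_ge] and [outer_ratio_le]. The former applies
eventually, because [l / n] is about [x / n ^ (1/4)]. *)
Lemma outer_ratio_cvg (l_ : nat -> nat) (x : R) : (\forall m \near \oo, (l_ m <= m)%N) ->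
  scaled_dist m (l_ m) @[m --> \oo] --> x ->
  outer_ratio z g m (l_ m) @[m --> \oo] --> expR (quartic z g x).
Proof.
move=> lm yx.
have ex (u : nat -> R) (L : R) : u m @[m --> \oo] --> L ->
    expR (u m) @[m --> \oo] --> expR L.
  by move=> h; apply: continuous_cvg => //; exact: continuous_expR.
have pw k : scaled_dist m (l_ m) ^+ k @[m --> \oo] --> x ^+ k.
  exact: cvg_exprn yx.
have h1 : quadratic_coef m * scaled_dist m (l_ m) ^+ 2 - quartic_coef m / 12 * scaled_dist m (l_ m) ^+ 4 @[m --> \oo] --> quartic z g x.
  apply: cvgB; first by apply: cvgM; [exact: cvg_quadratic_coef|exact: pw].
  apply: cvgM; last exact: pw.
  by apply: cvgM; [exact: cvg_quartic_coef|exact: cvg_cst].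
have [d [K [d0 K0 Hd]]] := outer_ratio_ge.
have h2 : quadratic_coef m * scaled_dist m (l_ m) ^+ 2 - quartic_coef m / 12 * scaled_dist m (l_ m) ^+ 4 -
    K * scaled_dist m (l_ m) ^+ 6 / Num.sqrt m.*2%:R @[m --> \oo] --> quartic z g x - K * x ^+ 6 * 0.
  apply: cvgB => //; apply: cvgM; last exact: cvg_sqrt_doubleV.
  by apply: cvgM; [exact: cvg_cst|exact: pw].
rewrite mulr0 subr0 in h2.
apply: (squeeze_cvgr _ (ex _ _ h2) (ex _ _ h1)).
have h3 : scaled_dist m (l_ m) ^+ 2 * (Num.sqrt m.*2%:R)^-1 @[m --> \oo] --> x ^+ 2 * 0.
  by apply: cvgM; [exact: pw|exact: cvg_sqrt_doubleV].
rewrite mulr0 in h3.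
have d2 : 0 < d ^+ 2 by rewrite exprn_gt0.
near=> m.
have m0 : (0 < m)%N by near: m; exists 1%N.
have lmm : (l_ m <= m)%N by near: m.
rewrite outer_ratio_le// andbT; apply: Hd => //.
have : scaled_dist m (l_ m) ^+ 2 * (Num.sqrt m.*2%:R)^-1 < d ^+ 2 by near: m;
  exact: cvgr_lt h3 _ d2.
rewrite scaled_dist_sq//.
have s0 := sqrt_double_gt0 m0; set s := Num.sqrt m.*2%:R in s0 *.
have -> : m.*2%:R = s ^+ 2 by rewrite sqr_sqrtr.
have -> : (l_ m)%:R ^+ 2 / (s ^+ 2 * s) / s = ((l_ m)%:R / s ^+ 2) ^+ 2.
  by field; rewrite gt_eqF.
move=> h; rewrite -(@ler_pXn2r _ 2)// ?nnegrE ?(ltW d0) ?(ltW h)//.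
by rewrite divr_ge0// sqr_ge0.
Unshelve. all: by end_near. Qed.

End RatioAsymptotics.

(** * Step functions carrying the coefficients *)

Section RiemannSums.
Context {R : realType}.
Variables (z g : R).
Hypothesis z0 : 0 < z.
Implicit Types (n m k l : nat) (x y : R) (f : R -> R).

Local Notation mu := (@lebesgue_measure R).

Definition site m k : R := (k%:R - m%:R) / n34 m.*2.

Definition central_ratio m k : R := C_ z g m.*2 k / C_ z g m.*2 m.

Definition cell m k : set R := `[site m k, site m k.+1[%classic.

(** The integrand behind the Riemann sum: its integral is the sum, and dominated
convergence applies to it. *)
Definition step_fun f m x : R :=
  \sum_(k < m.*2.+1) central_ratio m k * f (site m k) * \1_(cell m k) x.

(** The coefficients are symmetric about the centre. *)
Lemma central_ratio_outer m k : (0 < m)%N -> (k <= m.*2)%N ->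
  exists l, [/\ (l <= m)%N, central_ratio m k = outer_ratio z g m l & `|site m k| = scaled_dist m l].
Proof.
move=> m0 km; have n0 : (0 < m.*2)%N by rewrite double_gt0.
have n34p := n34_gt0 (R := R) n0.
have [mk|/ltnW mk] := leqP m k.
  exists (k - m)%N; split; first by rewrite leq_subLR addnn.
    by rewrite /outer_ratio subnKC.
  rewrite /site normrM [`|_^-1|]gtr0_norm ?invr_gt0// /scaled_dist natrB//.
  by rewrite ger0_norm// subr_ge0 ler_nat.
exists (m - k)%N; split; first exact: leq_subr.
  rewrite /outer_ratio (_ : m + (m - k) = m.*2 - k)%N; last by rewrite -addnn addnBA.
  by rewrite C_sym.
rewrite /site normrM [`|_^-1|]gtr0_norm ?invr_gt0// /scaled_dist natrB//.
by rewrite ler0_norm ?opprB// subr_le0 ler_nat.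
Qed.

Lemma cell_width m k : site m k.+1 - site m k = (n34 m.*2)^-1.
Proof. by rewrite /site -natr1; ring. Qed.

Lemma ler_site m k k' : (0 < m)%N -> (k <= k')%N -> site m k <= site m k'.
Proof.
move=> m0 kk; have n34p := n34_gt0 (R := R) (_ : 0 < m.*2)%N.
by rewrite ler_pM2r ?invr_gt0 ?n34p ?double_gt0// lerD2r ler_nat.
Qed.

Lemma step_fun_cell f m k x : (0 < m)%N -> (k <= m.*2)%N -> cell m k x ->
  step_fun f m x = central_ratio m k * f (site m k).
Proof.
move=> m0 km xc; rewrite /step_fun.
have km' : (k < m.*2.+1)%N by [].
rewrite (bigD1 (Ordinal km'))//= big1 => [|i ik].
  by rewrite addr0 indicE mem_set// mulr1.
rewrite indicE memNset ?mulr0// => xi.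
move: xc xi; rewrite /cell /= !in_itv /= => /andP[h1 h2] /andP[h3 h4].
have : nat_of_ord i != k by apply: contra ik => /eqP ik; apply/eqP/val_inj.
rewrite neq_ltn => /orP[ik'|ki'].
  by have := ler_site m0 ik'; rewrite leNgt (le_lt_trans h1 h4).
by have := ler_site m0 ki'; rewrite leNgt (le_lt_trans h3 h2).
Qed.

Lemma step_fun_out f m x : (forall k, (k <= m.*2)%N -> ~ cell m k x) -> step_fun f m x = 0.
Proof.
move=> H; rewrite /step_fun big1// => i _; rewrite indicE memNset ?mulr0//.
by apply: H; have := ltn_ord i.
Qed.

Lemma cvg_n34V : (n34 (R := R) m.*2)^-1 @[m --> \oo] --> (0 : R).
Proof.
have h : Num.sqrt ((m.*2%:R : R)^-1 * (Num.sqrt m.*2%:R)^-1) @[m --> \oo] --> (Num.sqrt (0 * 0) : R).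
  apply: continuous_cvg; first exact: sqrt_continuous.
  by apply: cvgM; [exact: cvg_doubleV|exact: cvg_sqrt_doubleV].
rewrite mulr0 sqrtr0 in h; apply: cvg_trans h; apply: near_eq_cvg; apply: nearW => m.
rewrite -invfM -n34_sq sqrtrV ?sqr_ge0// sqrtr_sqr ger0_norm//.
by rewrite /n34 powR_ge0.
Qed.

Lemma cvg_n34_N : n34 (R := R) m.*2 / m.*2%:R @[m --> \oo] --> (0 : R).
Proof.
have h : Num.sqrt ((Num.sqrt m.*2%:R)^-1) @[m --> \oo] --> (Num.sqrt 0 : R).
  by apply: continuous_cvg; [exact: sqrt_continuous|exact: cvg_sqrt_doubleV].
rewrite sqrtr0 in h; apply: cvg_trans h; apply: near_eq_cvg; near=> m.
have m0 : (0 < m)%N by near: m; exists 1%N.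
have s0 := sqrt_double_gt0 (R := R) m0.
rewrite -[RHS]ger0_norm ?divr_ge0 ?powR_ge0// -sqrtr_sqr; congr Num.sqrt.
rewrite expr_div_n n34_sq; set s := Num.sqrt m.*2%:R in s0 *.
have -> : m.*2%:R = s ^+ 2 by rewrite sqr_sqrtr.
by field; rewrite gt_eqF.
Unshelve. all: by end_near. Qed.

Definition site_below m x : nat := Num.trunc (x * n34 m.*2 + m%:R).

(** The sites reach out to [n ^ (1/4) / 2] on both sides. *)
Lemma near_site_below x : \forall m \near \oo,
  (site_below m x <= m.*2)%N /\ cell m (site_below m x) x.
Proof.
have e0 : 0 < (1 / 4) / (`|x| + 1) :> R by rewrite divr_gt0// ltr_wpDl.
near=> m.
have m0 : (0 < m)%N by near: m; exists 1%N.
have N0 : 0 < m.*2%:R :> R by rewrite ltr0n double_gt0.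
have n34p := n34_gt0 (R := R) (_ : 0 < m.*2)%N.
have {}n34p : 0 < n34 (R := R) m.*2 by apply: n34p; rewrite double_gt0.
have h : n34 (R := R) m.*2 / m.*2%:R < (1 / 4) / (`|x| + 1).
  by near: m; exact: cvgr_lt cvg_n34_N _ e0.
have hx : `|x| * n34 m.*2 <= m%:R.
  rewrite ltr_pdivrMr// mulrAC ltr_pdivlMr ?ltr_wpDl// in h.
  have E : m.*2%:R = 2 * m%:R :> R by rewrite -muln2 natrM mulrC.
  rewrite E mulrDr mulr1 in h; have m00 : 0 <= m%:R :> R by [].
  rewrite mulrC; move: (n34 m.*2 * `|x|) (n34 m.*2) (m%:R : R) h n34p m00.
  by move=> A B C h1 h2 h3; set D := B * _ in h1 *; lra.
have hx1 : - m%:R <= x * n34 m.*2 <= m%:R.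
  by rewrite -ler_norml normrM (gtr0_norm n34p).
have t0 : 0 <= x * n34 m.*2 + m%:R by lra.
have /andP[k1 k2] := truncn_itv t0; split.
  rewrite -(ler_nat R); apply: le_trans k1 _.
  have E2 : m.*2%:R = m%:R + m%:R :> R by rewrite -natrD addnn.
  by rewrite E2; lra.
rewrite /cell /= in_itv /= /site ler_pdivrMr// ltr_pdivlMr//.
by apply/andP; split; move: k1 k2; rewrite /site_below; lra.
Unshelve. all: by end_near. Qed.

Lemma cell_dist m k x : cell m k x -> `|x - site m k| <= (n34 m.*2)^-1.
Proof.
rewrite /cell /= in_itv /= => /andP[h1 h2]; rewrite -(cell_width m k).
by rewrite ger0_norm ?subr_ge0// lerD2r ltW.
Qed.

Lemma quartic_norm x : quartic z g `|x| = quartic z g x.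
Proof.
rewrite /quartic real_normK ?num_real//; congr (_ - _ * _).
by rewrite (_ : 4 = 2 * 2)%N// !exprM real_normK ?num_real.
Qed.

Lemma step_fun_cvg f x : continuous f ->
  step_fun f m x @[m --> \oo] --> expR (quartic z g x) * f x.
Proof.
move=> fc.
have hk := near_site_below x.
have xkx : site m (site_below m x) @[m --> \oo] --> x.
  apply/cvgrPdist_le => e e0.
  near=> m; have [km xc] : (site_below m x <= m.*2)%N /\ cell m (site_below m x) x by near: m.
  apply: le_trans (cell_dist xc) _; apply: ltW; near: m.
  exact: cvgr_lt cvg_n34V _ e0.
have [l_ Hl] : exists l_ : nat -> nat, forall m, (0 < m)%N -> (site_below m x <= m.*2)%N ->
    [/\ (l_ m <= m)%N, central_ratio m (site_below m x) = outer_ratio z g m (l_ m) & `|site m (site_below m x)| = scaled_dist m (l_ m)].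
  have H m : exists l, (0 < m)%N -> (site_below m x <= m.*2)%N ->
      [/\ (l <= m)%N, central_ratio m (site_below m x) = outer_ratio z g m l & `|site m (site_below m x)| = scaled_dist m l].
    have [km|km] := boolP ((0 < m)%N && (site_below m x <= m.*2)%N).
      by case/andP: km => m0 km; have [l Hl] := central_ratio_outer m0 km; exists l.
    by exists 0%N => m0 k0; rewrite m0 k0 in km.
  by have [l_ Hl] := choice H; exists l_.
have Hl' : \forall m \near \oo, [/\ (0 < m)%N, cell m (site_below m x) x, (site_below m x <= m.*2)%N &
    [/\ (l_ m <= m)%N, central_ratio m (site_below m x) = outer_ratio z g m (l_ m) & `|site m (site_below m x)| = scaled_dist m (l_ m)]].
  near=> m; have [km xc] : (site_below m x <= m.*2)%N /\ cell m (site_below m x) x by near: m.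
  have m0 : (0 < m)%N by near: m; exists 1%N.
  by split => //; apply: Hl.
have yx : scaled_dist m (l_ m) @[m --> \oo] --> `|x|.
  have h : `|site m (site_below m x)| @[m --> \oo] --> `|x| by exact: cvg_norm.
  apply: cvg_trans h; apply: near_eq_cvg.
  by apply: filterS Hl' => m [_ _ _ [_ _ ->]].
have lm : \forall m \near \oo, (l_ m <= m)%N.
  by apply: filterS Hl' => m [_ _ _ []].
have h1 := outer_ratio_cvg (g := g) z0 lm yx; rewrite quartic_norm in h1.
have h2 : f (site m (site_below m x)) @[m --> \oo] --> f x.
  by apply: (continuous_cvg _ (fc x)).
have h3 : outer_ratio z g m (l_ m) * f (site m (site_below m x)) @[m --> \oo] -->
    expR (quartic z g x) * f x by exact: cvgM.
apply: cvg_trans h3; apply: near_eq_cvg.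
by apply: filterS Hl' => m [m0 xc km [_ rE _]]; rewrite (step_fun_cell f m0 km xc) rE.
Unshelve. all: by end_near. Qed.

(** Completing the square in [y ^ 2]. The form of the right-hand side leaves a
Gaussian in [x] once [x ^ 2 <= 2 * y ^ 2 + 2]. *)
Lemma quartic_beats (C D be : R) : 0 < be -> exists K, forall y,
  C * `|y| + D * y ^+ 2 - be * y ^+ 4 <= K - 2 * y ^+ 2.
Proof.
move=> be0; pose E := `|C| + `|D| + 2; exists (`|C| + E ^+ 2 / (4 * be)) => y.
have C0 := normr_ge0 C; have D0 := normr_ge0 D.
have y20 : 0 <= y ^+ 2 by exact: sqr_ge0.
have h1 : C * `|y| <= `|C| * (1 + y ^+ 2).
  apply: (@le_trans _ _ (`|C| * `|y|)); first by rewrite ler_wpM2r// ler_norm.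
  apply: ler_wpM2l => //; rewrite -real_normK ?num_real//.
  by have := sqr_ge0 (`|y| - 1 / 2); move: (`|y|) => t; lra.
have h2 : D * y ^+ 2 <= `|D| * y ^+ 2 by rewrite ler_wpM2r// ler_norm.
have h3 : E * y ^+ 2 - be * y ^+ 4 <= E ^+ 2 / (4 * be).
  rewrite -subr_ge0 (_ : _ - _ = be * (y ^+ 2 - E / (2 * be)) ^+ 2).
    by rewrite mulr_ge0 ?sqr_ge0 ?ltW.
  by field; rewrite gt_eqF.
move: h3; rewrite /E; lra.
Qed.

(** A point [x] and the site [y] of its cell are at distance at most [1], so that
[x ^ 2 <= 2 * y ^ 2 + 2]. *)
Lemma step_fun_dominated f (C : R) : (forall x, `|f x| <= expR (C * (1 + `|x|))) ->
  exists K, 0 <= K /\ \forall m \near \oo, forall x,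
    `|step_fun f m x| <= K * gauss_fun x.
Proof.
move=> Hf; have B0 : 0 < B_ z / 24 by rewrite divr_gt0// B_gt0.
have [K HK] := quartic_beats C (`|g| + 1) B0.
exists (expR (C + K + 2)); split; first exact: expR_ge0.
near=> m => x.
have m0 : (0 < m)%N by near: m; exists 1%N.
have w1 : (n34 (R := R) m.*2)^-1 < 1 by near: m; exact: cvgr_lt cvg_n34V _ ltr01.
have dom : forall l, (l <= m)%N ->
  outer_ratio z g m l <= expR ((`|g| + 1) * scaled_dist m l ^+ 2 - B_ z / 24 * scaled_dist m l ^+ 4).
  by near: m; exact: outer_ratio_dominated.
have [[k [km xc]]|nox] := pselect (exists k, (k <= m.*2)%N /\ cell m k x); last first.
  rewrite step_fun_out ?normr0 ?mulr_ge0 ?expR_ge0// => k km xc; apply: nox.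
  by exists k.
rewrite (step_fun_cell f m0 km xc).
have [l [lm rE yE]] := central_ratio_outer m0 km.
rewrite normrM rE gtr0_norm ?outer_ratio_gt0//.
apply: le_trans (ler_pM _ _ (dom l lm) (Hf _)) _; rewrite ?normr_ge0//.
  by rewrite ltW// outer_ratio_gt0.
rewrite -yE !real_normK ?num_real// (_ : `|site m k| ^+ 4 = site m k ^+ 4); last first.
  by rewrite (_ : 4 = 2 * 2)%N// !exprM real_normK ?num_real.
rewrite /gauss_fun -!expRD ler_expR.
have := HK (site m k).
have hd : `|x - site m k| <= 1 by apply: le_trans (cell_dist xc) (ltW w1).
have hx2 : x ^+ 2 <= 2 * site m k ^+ 2 + 2.
  have hh : (x - site m k) ^+ 2 <= 1.
    by rewrite -real_normK ?num_real// expr_le1.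
  have := sqr_ge0 (x - site m k - site m k).
  move: (site m k) hh => y; lra.
move: hx2; set y2 := site m k ^+ 2; set y4 := site m k ^+ 4; set ay := `|site m k|.
rewrite mulrDr mulr1; lra.
Unshelve. all: by end_near. Qed.

End RiemannSums.

(** * Convergence of the Riemann sums *)

Section RiemannLimit.
Context {R : realType}.
Variables (z g : R).
Hypothesis z0 : 0 < z.
Implicit Types (n m k l : nat) (x y : R) (f : R -> R).

Local Notation mu := (@lebesgue_measure R).

Definition riemann_sum f m : R :=
  (n34 m.*2)^-1 * \sum_(k < m.*2.+1) central_ratio z g m k * f (site m k).

Lemma measurable_step_fun f m : measurable_fun [set: R] (step_fun z g f m).
Proof.
rewrite /step_fun; apply: measurable_sum => k; apply: measurable_funM => //.
by apply: measurable_indic; exact: measurable_itv.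
Qed.

Lemma integral_step_fun f m : (0 < m)%N ->
  (\int[mu]_x (step_fun z g f m x)%:E = (riemann_sum f m)%:E)%E.
Proof.
move=> m0; have n34p : 0 < (n34 m.*2)^-1 :> R by rewrite invr_gt0 n34_gt0// double_gt0.
have muc k : mu (cell m k) = ((n34 m.*2)^-1)%:E.
  rewrite /cell lebesgue_measure_itv /= lte_fin -subr_gt0 cell_width n34p.
  by rewrite -EFinB cell_width.
have mc k : measurable (cell m k : set R) by exact: measurable_itv.
have ind k : (\int[mu]_x (\1_(cell m k) x)%:E = ((n34 m.*2)^-1)%:E)%E.
  rewrite integral_indic; [rewrite setIT; exact: muc|by []|exact: mc].
have ic k : mu.-integrable setT (fun x => (\1_(cell m k) x)%:E).
  exact: integrable_indic_itv.
under eq_integral do rewrite /step_fun -sumEFin.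
rewrite integral_sum//=; last first.
  by move=> k; under eq_fun do rewrite EFinM; apply: integrableZl => //; exact: ic.
rewrite /riemann_sum mulr_sumr -sumEFin; apply: eq_bigr => k _.
under eq_integral do rewrite EFinM.
by rewrite (integralZl measurableT (ic k)) ind -EFinM mulrC.
Qed.

(** Dominated convergence for [step_fun], started at an index [M] from which the
domination holds. *)
Lemma riemann_sum_dominated_cvg f (C : R) : continuous f ->
  (forall x, `|f x| <= expR (C * (1 + `|x|))) ->
  mu.-integrable setT (EFin \o (fun x => expR (quartic z g x) * f x)) /\
  riemann_sum f m @[m --> \oo] --> \int[mu]_x (expR (quartic z g x) * f x).
Proof.
move=> fc Hf; have [K [K0 [M0 _ HM0]]] := step_fun_dominated g z0 Hf.
pose M := maxn 1 M0.
pose F m x := (step_fun z g f (m + M) x)%:E.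
pose G x := (expR (quartic z g x) * f x)%:E.
have mF m : measurable_fun [set: R] (F m).
  by apply/measurable_EFinP; exact: measurable_step_fun.
have mq : measurable_fun [set: R] (fun x => quartic z g x).
  by rewrite /quartic; apply: measurable_funB; apply: measurable_funM => //; exact: measurable_funX.
have mG : measurable_fun [set: R] G.
  apply/measurable_EFinP; apply: measurable_funM; first exact: measurableT_comp.
  exact: continuous_measurable_fun.
have FG : {ae mu, forall x, setT x -> F ^~ x @ \oo --> G x}.
  apply: aeW => x _; apply: cvg_EFin; first exact: nearW.
  rewrite (cvg_shiftn M (fun m => step_fun z g f m x)).
  exact: step_fun_cvg.
have iK : mu.-integrable setT (fun x => (K * gauss_fun x)%:E).
  under eq_fun do rewrite EFinM.
  by apply: integrableZl => //; exact: integrableT_gauss.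
have dF : {ae mu, forall x m, setT x -> (`|F m x| <= (K * gauss_fun x)%:E)%E}.
  apply: aeW => x m _; rewrite /F abse_EFin lee_fin; apply: HM0 => /=.
  by rewrite (leq_trans (leq_maxr 1 M0))// leq_addl.
have [iG _ cG] := @dominated_convergence _ (measurableTypeR R) R mu setT
  measurableT F G (fun x => (K * gauss_fun x)%:E) mF mG FG iK dF.
split; first exact: iG.
rewrite -(cvg_shiftn M).
have fin : (\int[mu]_x G x)%E \is a fin_num by exact: integrable_fin_num iG.
have cG' : (\int[mu]_x F m x)%E @[m --> \oo] --> (fine (\int[mu]_x G x)%E)%:E.
  by rewrite fineK.
have h : fine (\int[mu]_x F m x)%E @[m --> \oo] --> fine (\int[mu]_x G x)%E.
  exact: fine_cvg cG'.
apply: cvg_trans h; apply: near_eq_cvg; apply: nearW => m /=.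
by rewrite /F integral_step_fun// addn_gt0 /M leq_max orbT.
Qed.

End RiemannLimit.

(** * Taylor remainder of the complex exponential *)

Section ComplexExponential.
Context {R : realType}.
Implicit Types (c w : R[i]) (t : R).

(** The real part of [c * cexp (t * w)]. Letting [c] vary makes the family stable under
differentiation in [t]. *)
Definition Re_exp_line c w t : R :=
  expR (t * complex.Re w) * (complex.Re c * cos (t * complex.Im w) -
    complex.Im c * sin (t * complex.Im w)).

Definition Re_taylor_line c w N t : R :=
  \sum_(m < N) complex.Re (c * w ^+ m) * (t ^+ m / m`!%:R).

Lemma is_derive_Re_exp_line c w t :
  is_derive t 1 (Re_exp_line c w) (Re_exp_line (c * w) w t).
Proof.
case: w => a b; case: c => al be; rewrite /Re_exp_line /=.
have e1 : is_derive t 1 (fun t => t * a) a.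
  by apply: is_derive_eq; rewrite /GRing.scale /=; ring.
have e2 : is_derive t 1 (fun t => t * b) b.
  by apply: is_derive_eq; rewrite /GRing.scale /=; ring.
have d1 := @is_derive1_comp _ (@expR R) (fun t => t * a) t _ _ (is_derive_expR _) e1.
have d2 := @is_derive1_comp _ (@cos R) (fun t => t * b) t _ _ (is_derive_cos _) e2.
have d3 := @is_derive1_comp _ (@sin R) (fun t => t * b) t _ _ (is_derive_sin _) e2.
apply: is_derive_eq.
by rewrite /GRing.scale /=; ring.
Qed.

Lemma is_derive_expn n t :
  is_derive t 1 (fun s : R => s ^+ n.+1) (n.+1%:R * t ^+ n).
Proof.
elim: n => [|n IH].
  have e := is_derive_id t 1; rewrite expr0 mulr1.
  exact: e.
have e := is_deriveM (is_derive_id t 1) IH.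
rewrite (_ : (fun s : R => s ^+ n.+2) = id * (fun s : R => s ^+ n.+1)); last first.
  by apply/funext => s; rewrite exprS.
apply: (is_derive_eq e); rewrite /GRing.scale /= -natr1.
by rewrite exprS; ring.
Qed.

Lemma is_derive_Re_taylor_line c w N t :
  is_derive t 1 (Re_taylor_line c w N.+1) (Re_taylor_line (c * w) w N t).
Proof.
elim: N => [|N IH].
  rewrite /Re_taylor_line big_ord0.
  rewrite (_ : (fun t => _) = cst (complex.Re c)); first exact: is_derive_cst.
  by apply/funext => s; rewrite big_ord1 !expr0 fact0 divr1 !mulr1.
have -> : Re_taylor_line c w N.+2 = Re_taylor_line c w N.+1 \+
    (fun t => complex.Re (c * w ^+ N.+1) / (N.+1)`!%:R * t ^+ N.+1).
  by apply/funext => s; rewrite /Re_taylor_line big_ord_recr /=; congr (_ + _); ring.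
rewrite (_ : Re_taylor_line (c * w) w N.+1 t = Re_taylor_line (c * w) w N t +
   complex.Re (c * w * w ^+ N) * (t ^+ N / N`!%:R)); last by rewrite /Re_taylor_line big_ord_recr.
apply: is_deriveD; set a := complex.Re _ / _.
have e1 := is_derive_expn N t.
have e2 : is_derive t 1 (fun s : R => a * s ^+ N.+1) (a * (N.+1%:R * t ^+ N)).
  by apply: is_derive_eq; rewrite /GRing.scale /=; ring.
apply: (is_derive_eq e2); rewrite /a -(mulrA c w) -exprS /GRing.scale /= factS natrM.
by field; rewrite nat1r !pnatr_eq0 -lt0n fact_gt0.
Qed.

(** Differentiation in [t] lowers [N] and replaces [c] by [c * w], so the bound is
integrated by induction on [N]. *)
Lemma Re_exp_line_taylor c w N t : 0 <= t ->
  Re_exp_line c w t - Re_taylor_line c w N t <=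
  normc c * normc w ^+ N * (t ^+ N / N`!%:R) * expR (normc w * t).
Proof.
elim: N c t => [|N IH] c t t0.
  rewrite /Re_taylor_line big_ord0 subr0 expr0 fact0 divr1 !mulr1.
  have h1 : expR (t * complex.Re w) <= expR (normc w * t).
    by rewrite ler_expR mulrC ler_wpM2r//; apply: le_trans (ler_norm _) (normc_Re w).
  have h2 : complex.Re c * cos (t * complex.Im w) - complex.Im c * sin (t * complex.Im w) <= normc c.
    set th := t * complex.Im w.
    have := normc_Re (c * (cos th +i* sin th)).
    rewrite normcM (_ : normc (cos th +i* sin th) = 1); last first.
      by rewrite /normc cos2Dsin2 sqrtr1.
    rewrite mulr1; apply: le_trans; apply: le_trans (ler_norm _).
    by case: c.
  rewrite /Re_exp_line mulrC; apply: (@le_trans _ _ (normc c * expR (t * complex.Re w))).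
    by rewrite ler_wpM2r// expR_ge0.
  by rewrite ler_wpM2l// normc_ge0.
pose K := normc c * normc w ^+ N.+1.
have K0 : 0 <= K by rewrite mulr_ge0 ?normc_ge0// exprn_ge0// normc_ge0.
pose f s := K * (s ^+ N.+1 / (N.+1)`!%:R) * expR (normc w * s) - (Re_exp_line c w s - Re_taylor_line c w N.+1 s).
pose df s := K * (s ^+ N / N`!%:R) * expR (normc w * s) +
  K * (s ^+ N.+1 / (N.+1)`!%:R) * (normc w * expR (normc w * s)) -
  (Re_exp_line (c * w) w s - Re_taylor_line (c * w) w N s).
have fE : 0 <= f t.
  have <- : f 0 = 0.
    rewrite /f expr0n /= mul0r mulr0 mul0r sub0r /Re_exp_line /Re_taylor_line !mul0r expR0 cos0 sin0.
    rewrite mulr0 subr0 mulr1 mul1r big_ord_recl /= big1 => [|i _]; last first.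
      by rewrite expr0n /= mul0r mulr0.
    by rewrite !expr0 fact0 divr1 !mulr1 addr0 subrr oppr0.
  apply: (derive_ge0_le (df := df)) => //.
    move=> s _; rewrite /f /df.
    have d1 : is_derive s 1 (fun s => normc w * s) (normc w).
      by apply: is_derive_eq; rewrite /GRing.scale /=; ring.
    have d2 := @is_derive1_comp _ (@expR R) (fun s => normc w * s) s _ _ (is_derive_expR _) d1.
    have d3 := is_derive_Re_exp_line c w s.
    have d4 := is_derive_Re_taylor_line c w N s.
    have e1 := is_derive_expn N s.
    apply: is_derive_eq; rewrite /GRing.scale /= factS natrM.
    by field; rewrite nat1r !pnatr_eq0 -lt0n fact_gt0.
  move=> s /andP[s0 _]; rewrite /df.
  have := IH (c * w) s s0; rewrite normcM -[normc c * normc w * _]mulrA -exprS -/K.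
  suff : 0 <= K * (s ^+ N.+1 / (N.+1)`!%:R) * (normc w * expR (normc w * s)) by lra.
  apply: mulr_ge0; apply: mulr_ge0 => //; rewrite ?normc_ge0 ?expR_ge0//.
  by rewrite divr_ge0// exprn_ge0.
by move: fE; rewrite /f subr_ge0.
Qed.

Definition exp_taylor (w : R[i]) N : R[i] := \sum_(m < N) w ^+ m / (m`!%:R : R)%:C.

(** Taking for [c] the conjugate of the remainder [D] turns a bound on the real part of
[c * D] into one on the modulus of [D]. *)
Lemma cexp_taylor w N :
  normc (cexp w - exp_taylor w N) <= normc w ^+ N / N`!%:R * expR (normc w).
Proof.
set D := cexp w - exp_taylor w N.
have H c : complex.Re (c * D) <= normc c * (normc w ^+ N / N`!%:R * expR (normc w)).
  have := Re_exp_line_taylor c w N ler01; rewrite expr1n !mulr1 mul1r !mulrA.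
  apply: le_trans; rewrite le_eqVlt; apply/orP; left; apply/eqP.
  rewrite /D mulrBr raddfB /=; congr (_ - _).
    by rewrite /Re_exp_line /cexp !mul1r; case: (c) => al be /=; simpc; ring.
  rewrite /Re_taylor_line /exp_taylor mulr_sumr raddf_sum /=; apply: eq_bigr => m _.
  rewrite expr1n mul1r mulrA -fmorphV /=; case: (c * w ^+ m) => x y /=.
  by ring.
have [D0|D0] := eqVneq D 0.
  rewrite D0 normc0; apply: mulr_ge0; last exact: expR_ge0.
  by apply: divr_ge0 => //; exact/exprn_ge0/normc_ge0.
have := H (conjc D); have -> : complex.Re (conjc D * D) = normc D * normc D.
  rewrite -expr2; case: (D) => x y; rewrite /normc sqr_sqrtr ?addr_ge0 ?sqr_ge0//=.
  by ring.
have -> : normc (conjc D) = normc D by case: (D) => x y; rewrite /normc /= sqrrN.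
have D1 : 0 < normc D by rewrite normc_gt0.
by rewrite (ler_pM2l D1).
Qed.

Lemma expn_fact_le (x : R) N : 0 <= x -> x ^+ N / N`!%:R <= expR x.
Proof.
case: N => [|N] x0; first by rewrite expr0 fact0 divr1 -expR0 ler_expR.
by have := expR_ge1Dxn N x0; lra.
Qed.

(** [(2 * x) ^ N / N! <= expR (2 * x)]: in this form the remainder is geometric in [N]
and exponentially bounded in [w]. *)
Lemma cexp_taylor_geo w N :
  normc (cexp w - exp_taylor w N) <= 2^-1 ^+ N * expR (3 * normc w).
Proof.
apply: le_trans (cexp_taylor w N) _.
have w0 := normc_ge0 w.
have -> : 3 * normc w = 2 * normc w + normc w by ring.
rewrite expRD mulrA ler_wpM2r ?expR_ge0// exprVn -[leRHS]mulrC ler_pdivlMr ?exprn_gt0//.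
rewrite mulrAC -exprMn [normc w * 2]mulrC; apply: expn_fact_le.
by rewrite mulr_ge0.
Qed.

Lemma normc_cexp w : normc (cexp w) = expR (complex.Re w).
Proof.
rewrite /cexp normcM normc_real gtr0_norm ?expR_gt0//.
by rewrite /normc cos2Dsin2 sqrtr1 mulr1.
Qed.

Lemma cexpD v w : cexp (v + w) = cexp v * cexp w :> R[i].
Proof.
case: v => a b; case: w => c d; rewrite /cexp /= expRD cosD sinD.
by simpc; congr (_ +i* _); ring.
Qed.

Lemma cexp0 : cexp (0 : R[i]) = 1.
Proof. by rewrite /cexp /= expR0 cos0 sin0 mul1r. Qed.

Lemma cexp_real (x : R) : cexp x%:C = (expR x)%:C.
Proof. by rewrite /cexp /= cos0 sin0 mulr1. Qed.

Lemma cexpX w n : cexp w ^+ n = cexp (n%:R * w) :> R[i].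
Proof.
elim: n => [|n IH]; first by rewrite expr0 mul0r cexp0.
by rewrite exprS IH -natr1 mulrDl mul1r addrC cexpD mulrC.
Qed.

Lemma cexp_neq0 w : cexp w != 0 :> R[i].
Proof. by rewrite -normc_gt0 normc_cexp expR_gt0. Qed.

End ComplexExponential.

(** * Laplace transforms of positive functionals *)

Section PositiveFunctionals.
Context {R : realType}.
Implicit Types (f h : R -> R) (w zeta : R[i]) (C K r x : R).

(** A class of test functions that contains both the monomials and the exponentials of
Laplace transforms. *)
Definition exp_bounded f : Prop := continuous f /\
  exists K C, forall x, `|f x| <= K * expR (C * `|x|).

Lemma exp_bounded_cst K : exp_bounded (fun=> K).
Proof.
split; first by move=> x; exact: cvg_cst.
by exists `|K|, 0 => x; rewrite mul0r expR0 mulr1.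
Qed.

Lemma exp_boundedD f h : exp_bounded f -> exp_bounded h -> exp_bounded (fun x => f x + h x).
Proof.
move=> [fc [K [C Hf]]] [hc [K' [C' Hh]]]; split.
  by move=> x; apply: cvgD; [exact: fc|exact: hc].
exists (`|K| + `|K'|), (Num.max C C') => x.
have x0 := normr_ge0 x.
have aux k c : c <= Num.max C C' -> k * expR (c * `|x|) <= `|k| * expR (Num.max C C' * `|x|).
  move=> cm; apply: (@le_trans _ _ (`|k| * expR (c * `|x|))).
    by rewrite ler_wpM2r ?expR_ge0// ler_norm.
  by rewrite ler_wpM2l// ler_expR ler_wpM2r.
rewrite mulrDl; apply: le_trans (ler_normD _ _) _; apply: lerD.
  by apply: le_trans (Hf x) _; apply: aux; rewrite le_max lexx.
by apply: le_trans (Hh x) _; apply: aux; rewrite le_max lexx orbT.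
Qed.

Lemma exp_boundedZ K f : exp_bounded f -> exp_bounded (fun x => K * f x).
Proof.
move=> [fc [K' [C Hf]]]; split.
  by move=> x; apply: cvgM; [exact: cvg_cst|exact: fc].
by exists (`|K| * K'), C => x; rewrite normrM -mulrA ler_wpM2l.
Qed.

Lemma exp_bounded_sum (F : nat -> R -> R) N : (forall k, exp_bounded (F k)) ->
  exp_bounded (fun x => \sum_(k < N) F k x).
Proof.
move=> HF; elim: N => [|N IH].
  by under eq_fun do rewrite big_ord0; exact: exp_bounded_cst.
by under eq_fun do rewrite big_ord_recr /=; exact: exp_boundedD.
Qed.

Lemma exp_bounded_exprn k : exp_bounded (fun x => x ^+ k).
Proof.
split; first by move=> x; exact: exprn_continuous.
exists k`!%:R, 1 => x; rewrite normrX mul1r -ler_pdivrMl ?ltr0n ?fact_gt0//.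
by rewrite mulrC; exact: expn_fact_le.
Qed.

Lemma exp_bounded_expR_norm r : exp_bounded (fun x => expR (r * `|x|)).
Proof.
split; last by exists 1, r => x; rewrite mul1r gtr0_norm ?expR_gt0.
move=> x; apply: (@continuous_comp _ _ _ (fun x => r * `|x|) expR).
  by apply: cvgM; [exact: cvg_cst|exact: norm_continuous].
exact: continuous_expR.
Qed.

Lemma Re_cexpx zeta x : complex.Re (cexp (zeta * x%:C)) =
  expR (x * complex.Re zeta) * cos (x * complex.Im zeta).
Proof.
by case: zeta => a b; rewrite /cexp /=; simpc; rewrite /= ![x * _]mulrC.
Qed.

Lemma Im_cexpx zeta x : complex.Im (cexp (zeta * x%:C)) =
  expR (x * complex.Re zeta) * sin (x * complex.Im zeta).
Proof.
by case: zeta => a b; rewrite /cexp /=; simpc; rewrite /= ![x * _]mulrC.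
Qed.

Lemma normc_cexpx zeta x : normc (cexp (zeta * x%:C)) <= expR (normc zeta * `|x|).
Proof.
rewrite normc_cexp ler_expR; apply: le_trans (ler_norm _) _.
by apply: le_trans (normc_Re _) _; rewrite normcM normc_real.
Qed.

Let cont_scale (F : R -> R) (b : R) : continuous F -> continuous (fun x => F (x * b)).
Proof.
move=> Fc x; apply: (@continuous_comp _ _ _ (fun x => x * b) F).
  by apply: cvgM; [exact: cvg_id|exact: cvg_cst].
exact: Fc.
Qed.

Lemma exp_bounded_Re_cexp zeta : exp_bounded (fun x => complex.Re (cexp (zeta * x%:C))).
Proof.
split; last first.
  exists 1, (normc zeta) => x; rewrite mul1r.
  exact: le_trans (normc_Re _) (normc_cexpx _ _).
under eq_fun do rewrite Re_cexpx.
move=> x; apply: cvgM; first exact: (cont_scale (@continuous_expR R)).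
exact: (cont_scale (@continuous_cos R)).
Qed.

Lemma exp_bounded_Im_cexp zeta : exp_bounded (fun x => complex.Im (cexp (zeta * x%:C))).
Proof.
split; last first.
  exists 1, (normc zeta) => x; rewrite mul1r.
  exact: le_trans (normc_Im _) (normc_cexpx _ _).
under eq_fun do rewrite Im_cexpx.
move=> x; apply: cvgM; first exact: (cont_scale (@continuous_expR R)).
exact: (cont_scale (@continuous_sin R)).
Qed.

(** Riemann sums and the limit integral are both used through this interface alone. *)
Definition positive_functional (L : (R -> R) -> R) : Prop :=
  [/\ forall f h, exp_bounded f -> exp_bounded h -> L (fun x => f x + h x) = L f + L h,
      forall K f, exp_bounded f -> L (fun x => K * f x) = K * L f
    & forall f h, exp_bounded f -> exp_bounded h -> (forall x, `|f x| <= h x) -> `|L f| <= L h].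

Section Laplace.
Variable L : (R -> R) -> R.
Hypothesis HL : positive_functional L.

Definition laplace zeta : R[i] :=
  L (fun x => complex.Re (cexp (zeta * x%:C))) +i*
  L (fun x => complex.Im (cexp (zeta * x%:C))).

Definition moment_coef k : R[i] := (L (fun x => x ^+ k) / k`!%:R)%:C.

Lemma posfun0 : L (fun=> 0) = 0.
Proof.
have [_ LZ _] := HL; rewrite -[RHS](mul0r (L (fun=> 0))) -(LZ 0 _ (exp_bounded_cst 0)).
by congr L; apply/funext => x; rewrite mul0r.
Qed.

Lemma posfun_sum (F : nat -> R -> R) N : (forall k, exp_bounded (F k)) ->
  L (fun x => \sum_(k < N) F k x) = \sum_(k < N) L (F k).
Proof.
have [LD _ _] := HL => HF; elim: N => [|N IH].
  by rewrite big_ord0 -[RHS]posfun0; under eq_fun do rewrite big_ord0.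
under eq_fun do rewrite big_ord_recr /=.
by rewrite big_ord_recr /= -IH; apply: LD => //; exact: exp_bounded_sum.
Qed.

Lemma posfunB f h : exp_bounded f -> exp_bounded h -> L (fun x => f x - h x) = L f - L h.
Proof.
have [LD LZ _] := HL => mf mh; rewrite -mulN1r -LZ// -LD//; last exact: exp_boundedZ.
by congr L; apply/funext => x; rewrite mulN1r.
Qed.

Lemma posfun_expabs_ge0 r : 0 <= L (fun x => expR (r * `|x|)).
Proof.
have [_ _ Lle] := HL; apply: le_trans (normr_ge0 (L (fun=> 0))) _.
apply: Lle; [exact: exp_bounded_cst|exact: exp_bounded_expR_norm|].
by move=> x; rewrite normr0 expR_ge0.
Qed.

(** By positivity, from [(r * `|x|) ^ k / k! <= expR (r * `|x|)]. *)
Lemma moment_coef_le r k : 0 < r ->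
  normc (moment_coef k) * r ^+ k <= L (fun x => expR (r * `|x|)).
Proof.
move=> r0; have [_ LZ Lle] := HL; rewrite /moment_coef normc_real.
have k0 : 0 < k`!%:R :> R by rewrite ltr0n fact_gt0.
have rk0 : 0 < r ^+ k by rewrite exprn_gt0.
have -> : `|L (fun x => x ^+ k) / k`!%:R| * r ^+ k =
    `|L (fun x => r ^+ k / k`!%:R * x ^+ k)|.
  rewrite LZ; last exact: exp_bounded_exprn.
  rewrite !normrM (gtr0_norm rk0) [`|_^-1|]gtr0_norm ?invr_gt0//.
  by ring.
apply: Lle; [exact/exp_boundedZ/exp_bounded_exprn|exact: exp_bounded_expR_norm|move=> x].
rewrite !normrM (gtr0_norm rk0) [`|_^-1|]gtr0_norm ?invr_gt0// normrX.
rewrite mulrAC -exprMn; apply: expn_fact_le.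
by rewrite mulr_ge0// ltW.
Qed.

Lemma entire_coef_moment : entire_coef moment_coef.
Proof.
apply: entire_coef_geometric => r r0; exists (L (fun x => expR (r * `|x|))) => k.
exact: moment_coef_le.
Qed.

(** The functional commutes with the exponential series, since the Taylor remainder is
at most [2 ^- N] times a fixed test function. *)
Lemma pseval_moment zeta : pseval moment_coef zeta = laplace zeta.
Proof.
have [LD LZ Lle] := HL.
apply: pseval_unique; first exact: entire_coef_moment.
pose E := L (fun x => expR (3 * normc zeta * `|x|)).
have hE : 2 * E * 2^-1 ^+ n @[n --> \oo] --> (2 * E * 0 : R).
  by apply: cvgMr; apply: cvg_expr; rewrite ger0_norm ?invr_ge0//; lra.
rewrite mulr0 in hE; apply: (squeeze_cvgr _ (cvg_cst 0) hE).
apply: nearW => N; rewrite normc_ge0/=.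
(* [F] is the real or the imaginary part. *)
have mT (F : R[i] -> R) : {morph F : x y / x + y} -> (forall (k : R) y, F (k%:C * y) = k * F y) ->
    [/\ exp_bounded (fun x => F (exp_taylor (zeta * x%:C) N))
      & F (partial_sum moment_coef zeta N) = L (fun x => F (exp_taylor (zeta * x%:C) N))].
  move=> FD FZ; have F0 : F 0 = 0 by rewrite -(mulr0 0) -[0 * 0]/((0 : R)%:C * 0) FZ mul0r.
  have Fsum n (G : 'I_n -> R[i]) : F (\sum_(k < n) G k) = \sum_(k < n) F (G k).
    exact: (big_morph F FD F0).
  have -> : (fun x => F (exp_taylor (zeta * x%:C) N)) =
      (fun x => \sum_(k < N) F (zeta ^+ k) / k`!%:R * x ^+ k).
    apply/funext => x; rewrite /exp_taylor Fsum; apply: eq_bigr => k _.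
    have -> : (zeta * x%:C) ^+ k / (k`!%:R : R)%:C = (x ^+ k / k`!%:R)%:C * zeta ^+ k.
      by rewrite exprMn rmorphM fmorphV rmorphXn /=; ring.
    by rewrite FZ; ring.
  have mk k : exp_bounded (fun x => F (zeta ^+ k) / k`!%:R * x ^+ k) by exact/exp_boundedZ/exp_bounded_exprn.
  split; first exact: (exp_bounded_sum N mk).
  rewrite (posfun_sum N mk) /partial_sum Fsum; apply: eq_bigr => k _.
  by rewrite /moment_coef FZ LZ; [ring|exact: exp_bounded_exprn].
have bd x : normc (exp_taylor (zeta * x%:C) N - cexp (zeta * x%:C)) <=
    2^-1 ^+ N * expR (3 * normc zeta * `|x|).
  rewrite normc_distC; apply: le_trans (cexp_taylor_geo _ _) _.
  by rewrite normcM normc_real mulrA.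
have mb : exp_bounded (fun x => 2^-1 ^+ N * expR (3 * normc zeta * `|x|)) by exact/exp_boundedZ/exp_bounded_expR_norm.
have [||mR eR] := mT (@complex.Re R).
- by case=> a b [c d].
- by move=> k [c d] /=; rewrite mul0r subr0.
have [||mI eI] := mT (@complex.Im R).
- by case=> a b [c d].
- by move=> k [c d] /=; rewrite mul0r addr0.
apply: le_trans (normc_le_ReIm _) _; rewrite !raddfB /= eR eI.
rewrite -!posfunB//; try exact: exp_bounded_Re_cexp; try exact: exp_bounded_Im_cexp.
have -> : 2 * E * 2^-1 ^+ N = L (fun x => 2^-1 ^+ N * expR (3 * normc zeta * `|x|)) +
   L (fun x => 2^-1 ^+ N * expR (3 * normc zeta * `|x|)).
  by rewrite LZ; [rewrite -/E; ring|exact: exp_bounded_expR_norm].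
apply: lerD; apply: Lle => //.
- by have := exp_boundedD mR (exp_boundedZ (-1) (exp_bounded_Re_cexp zeta));
  under eq_fun do rewrite mulN1r.
- move=> x; have := le_trans (normc_Re _) (bd x).
  by rewrite raddfB.
- by have := exp_boundedD mI (exp_boundedZ (-1) (exp_bounded_Im_cexp zeta));
  under eq_fun do rewrite mulN1r.
- move=> x; have := le_trans (normc_Im _) (bd x).
  by rewrite raddfB.
Qed.

End Laplace.

(** Finitely many coefficients converge one by one. The tails are geometric, uniformly
in [n], because [L_ n] is eventually bounded on [expR (2 * r * `|x|)]. *)
Lemma coef_cvg_moment (L_ : nat -> (R -> R) -> R) (L : (R -> R) -> R) F (FF : Filter F) :
  (forall n, positive_functional (L_ n)) -> positive_functional L ->
  (forall f, exp_bounded f -> L_ n f @[n --> F] --> L f) ->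
  coef_cvg (fun n => moment_coef (L_ n)) F (moment_coef L).
Proof.
move=> Hn HL Hc r e r0 e0.
have r20 : 0 < 2 * r by rewrite mulr_gt0.
pose E := L (fun x => expR (2 * r * `|x|)).
have E0 : 0 <= E by exact: posfun_expabs_ge0.
pose K := 2 * E + 1; have K0 : 0 < K by rewrite /K; lra.
have [N0 HN0] : exists N0, 2 * K * 2^-1 ^+ N0 < e / 2.
  have h : 2 * K * 2^-1 ^+ n @[n --> \oo] --> (2 * K * 0 : R).
    by apply: cvgMr; apply: cvg_expr; rewrite ger0_norm ?invr_ge0//; lra.
  rewrite mulr0 in h; have e2 : 0 < e / 2 by rewrite divr_gt0.
  by have /(cvgr_lt _ h)[N _ /(_ N (leqnn N))/= HN] := e2; exists N.
have head : \sum_(k < N0) normc (moment_coef (L_ n) k - moment_coef L k) * r ^+ k @[n --> F] --> (0 : R).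
  elim: (N0) => [|N IH].
    by under eq_fun do rewrite big_ord0; exact: cvg_cst.
  under eq_fun do rewrite big_ord_recr /=.
  suff h : normc (moment_coef (L_ n) N - moment_coef L N) * r ^+ N @[n --> F] --> (0 : R).
    by have := cvgD IH h; rewrite addr0; exact.
  have h : `|L_ n (fun x => x ^+ N) - L (fun x => x ^+ N)| * (N`!%:R^-1 * r ^+ N) @[n --> F] -->
      (`|L (fun x => x ^+ N) - L (fun x => x ^+ N)| * (N`!%:R^-1 * r ^+ N)).
    apply: cvgM; last exact: cvg_cst.
    by apply: cvg_norm; apply: cvgB; [apply: Hc; exact: exp_bounded_exprn|exact: cvg_cst].
  rewrite subrr normr0 mul0r in h; apply: cvg_trans h; apply: near_eq_cvg; apply: nearW => n.
  have k0 : 0 < N`!%:R^-1 :> R by rewrite invr_gt0 ltr0n fact_gt0.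
  by rewrite /moment_coef -rmorphB normc_real -mulrBl normrM (gtr0_norm k0) mulrA.
have e2 : 0 < e / 2 by rewrite divr_gt0.
near=> n => N.
have hh : \sum_(k < N0) normc (moment_coef (L_ n) k - moment_coef L k) * r ^+ k < e / 2.
  by near: n; exact: cvgr_lt head _ e2.
have En : L_ n (fun x => expR (2 * r * `|x|)) < E + 1.
  near: n; apply: (cvgr_lt _ (Hc _ (exp_bounded_expR_norm _))); rewrite /E; lra.
have term k : normc (moment_coef (L_ n) k - moment_coef L k) * r ^+ k <= K * 2^-1 ^+ k.
  rewrite exprVn ler_pdivlMr ?exprn_gt0// -mulrA -exprMn [r * 2]mulrC.
  apply: (@le_trans _ _ ((normc (moment_coef (L_ n) k) + normc (moment_coef L k)) * (2 * r) ^+ k)).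
    by apply: ler_wpM2r; [rewrite exprn_ge0// ltW|exact: normcB].
  rewrite mulrDl; have := moment_coef_le (Hn n) k r20; have := moment_coef_le HL k r20.
  by rewrite -/E /K; lra.
have geo M : \sum_(N0 <= k < N0 + M) 2^-1 ^+ k <= 2 * 2^-1 ^+ N0 :> R.
  suff -> : \sum_(N0 <= k < N0 + M) 2^-1 ^+ k = 2 * 2^-1 ^+ N0 - 2 * 2^-1 ^+ (N0 + M) :> R.
    by rewrite lerBlDr lerDl mulr_ge0// exprn_ge0.
  elim: M => [|M IH]; first by rewrite addn0 big_geq// subrr.
  by rewrite addnS big_nat_recr ?leq_addr//= IH exprS; field.
apply: (@le_trans _ _ (\sum_(k < N0 + N) normc (moment_coef (L_ n) k - moment_coef L k) * r ^+ k)).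
  rewrite -!(big_mkord xpredT (fun k => normc (moment_coef (L_ n) k - moment_coef L k) * r ^+ k)).
  rewrite (big_cat_nat (leq0n N) (leq_addl N0 N)) /= lerDl sumr_ge0// => i _.
  by rewrite mulr_ge0 ?normc_ge0// exprn_ge0// ltW.
rewrite -(big_mkord xpredT (fun k => normc (moment_coef (L_ n) k - moment_coef L k) * r ^+ k)).
rewrite (big_cat_nat (leq0n N0) (leq_addr N N0)) /= big_mkord.
have : \sum_(N0 <= k < N0 + N) normc (moment_coef (L_ n) k - moment_coef L k) * r ^+ k <= e / 2.
  apply: (@le_trans _ _ (\sum_(N0 <= k < N0 + N) K * 2^-1 ^+ k)); first exact: ler_sum.
  rewrite -mulr_sumr; apply: le_trans (ltW HN0).
  by rewrite [2 * K]mulrC -mulrA ler_wpM2l ?(ltW K0).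
lra.
Unshelve. all: by end_near. Qed.

End PositiveFunctionals.

(** * Partition functions as Laplace transforms *)

Lemma Re_scale (R : realType) (k : R) (w : R[i]) : complex.Re (k%:C * w) = k * complex.Re w.
Proof. by case: w => a b /=; rewrite mul0r subr0. Qed.

Lemma Im_scale (R : realType) (k : R) (w : R[i]) : complex.Im (k%:C * w) = k * complex.Im w.
Proof. by case: w => a b /=; rewrite mul0r addr0. Qed.

Lemma Re_sum (R : realType) n (F : 'I_n -> R[i]) :
  complex.Re (\sum_(k < n) F k) = \sum_(k < n) complex.Re (F k).
Proof. by apply: (big_morph (@complex.Re R)) => // -[a b] [c d]. Qed.

Lemma Im_sum (R : realType) n (F : 'I_n -> R[i]) :
  complex.Im (\sum_(k < n) F k) = \sum_(k < n) complex.Im (F k).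
Proof. by apply: (big_morph (@complex.Im R)) => // -[a b] [c d]. Qed.

Section Functionals.
Context {R : realType}.
Variables (z g : R).
Hypothesis z0 : 0 < z.
Implicit Types (f h : R -> R) (zeta : R[i]) (x : R) (n m k : nat).

Local Notation mu := (@lebesgue_measure R).

Definition limit_integral f : R := \int[mu]_x (expR (quartic z g x) * f x).

Lemma exp_bounded_expR_bound f : exp_bounded f ->
  exists C, forall x, `|f x| <= expR (C * (1 + `|x|)).
Proof.
move=> [_ [K [C Hf]]]; exists (`|K| + `|C|) => x.
apply: le_trans (Hf x) _; have x0 := normr_ge0 x.
have K0 := normr_ge0 K; have C0 := normr_ge0 C.
apply: (@le_trans _ _ (expR `|K| * expR (`|C| * `|x|))).
  apply: (@le_trans _ _ (`|K| * expR (C * `|x|))).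
    by rewrite ler_wpM2r ?expR_ge0// ler_norm.
  apply: ler_pM; rewrite ?expR_ge0//.
    by have := expR_ge1Dx `|K|; lra.
  by rewrite ler_expR ler_wpM2r// ler_norm.
by rewrite -expRD ler_expR; nra.
Qed.

Lemma limit_integrable f : exp_bounded f ->
  mu.-integrable setT (EFin \o (fun x => expR (quartic z g x) * f x)).
Proof.
by move=> mf; have [C HC] := exp_bounded_expR_bound mf;
  have [] := riemann_sum_dominated_cvg g z0 mf.1 HC.
Qed.

Lemma riemann_sum_cvg f : exp_bounded f ->
  riemann_sum z g f m @[m --> \oo] --> limit_integral f.
Proof.
by move=> mf; have [C HC] := exp_bounded_expR_bound mf;
  have [] := riemann_sum_dominated_cvg g z0 mf.1 HC.
Qed.

Lemma limit_integral_posfun : positive_functional limit_integral.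
Proof.
split.
- move=> f h mf mh; rewrite /limit_integral -RintegralD//; try exact: limit_integrable.
  by apply: eq_Rintegral => x _; rewrite mulrDr.
- move=> K f mf; rewrite /limit_integral -RintegralZl//; last exact: limit_integrable.
  by apply: eq_Rintegral => x _; rewrite mulrCA.
- move=> f h mf mh fh; rewrite /limit_integral.
  apply: le_trans (le_normr_Rintegral _ _) _ => //; first exact: limit_integrable.
  apply: le_Rintegral => //; last 2 first.
  + exact: limit_integrable.
  + by move=> x _; rewrite normrM gtr0_norm ?expR_gt0// ler_wpM2l ?expR_ge0.
  + have := integrable_norm (limit_integrable mf); apply: eq_integrable => //.
Qed.

Lemma central_ratio_ge0 m k : 0 <= central_ratio z g m k.
Proof. by rewrite /central_ratio divr_ge0// C_ge0. Qed.

Lemma riemann_sum_posfun m : positive_functional (fun f => riemann_sum z g f m).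
Proof.
split.
- move=> f h _ _; rewrite /riemann_sum -mulrDr -big_split /=; congr (_ * _).
  by apply: eq_bigr => k _; rewrite mulrDr.
- move=> K f _; rewrite /riemann_sum [RHS]mulrCA; congr (_ * _); rewrite mulr_sumr.
  by apply: eq_bigr => k _; rewrite mulrCA.
- move=> f h _ _ fh; rewrite /riemann_sum normrM ger0_norm ?invr_ge0 ?powR_ge0//.
  apply: ler_wpM2l; first by rewrite invr_ge0 powR_ge0.
  apply: le_trans (ler_norm_sum _ _ _) _; apply: ler_sum => k _.
  by rewrite normrM ger0_norm ?central_ratio_ge0// ler_wpM2l ?central_ratio_ge0.
Qed.

Lemma posfunZ (L : (R -> R) -> R) K : 0 <= K -> positive_functional L ->
  positive_functional (fun f => K * L f).
Proof.
move=> K0 [LD LZ Lle]; split.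
- by move=> f h mf mh; rewrite LD// mulrDr.
- by move=> c f mf; rewrite LZ// mulrCA.
- by move=> f h mf mh fh; rewrite normrM ger0_norm// ler_wpM2l// Lle.
Qed.

Lemma laplaceZ (L : (R -> R) -> R) K zeta :
  laplace (fun f => K * L f) zeta = K%:C * laplace L zeta.
Proof. by rewrite /laplace; simpc. Qed.

Lemma I_laplace zeta : I_ z g zeta = laplace limit_integral zeta.
Proof.
rewrite /I_ /laplace /Cintegral /limit_integral.
have E x : I_integrand z g zeta x = (expR (quartic z g x))%:C * cexp (zeta * x%:C).
  by rewrite /I_integrand cexpD cexp_real mulrC.
congr (_ +i* _); apply: eq_Rintegral => x _; rewrite E.
  exact: (Re_scale (expR (quartic z g x))).
exact: (Im_scale (expR (quartic z g x))).
Qed.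

Lemma I_integrable zeta : Cintegrable (I_integrand z g zeta).
Proof.
have E x : I_integrand z g zeta x = (expR (quartic z g x))%:C * cexp (zeta * x%:C).
  by rewrite /I_integrand cexpD cexp_real mulrC.
split.
  have := limit_integrable (exp_bounded_Re_cexp zeta); congr (integrable _ _ _).
  apply/funext => x; rewrite /comp E; congr EFin.
  by rewrite (Re_scale (expR (quartic z g x))).
have := limit_integrable (exp_bounded_Im_cexp zeta); congr (integrable _ _ _).
apply/funext => x; rewrite /comp E; congr EFin.
by rewrite (Im_scale (expR (quartic z g x))).
Qed.

(** The centring factor [w ^- kappa n] moves the exponent [k] of [w] to [k - m], which
is the site up to the scale [n34 n]. *)
Lemma Z_laplace m zeta : (0 < m)%N ->
  Z_ z g m.*2 (cexp (zeta / (n34 m.*2)%:C)) =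
  (C_ z g m.*2 m * n34 m.*2)%:C * laplace (fun f => riemann_sum z g f m) zeta.
Proof.
move=> m0; have n0 : (0 < m.*2)%N by rewrite double_gt0.
have n34p := n34_gt0 (R := R) n0.
have C0 : 0 < C_ z g m.*2 m by rewrite C_gt0// -addnn leq_addr.
have -> : laplace (fun f => riemann_sum z g f m) zeta =
  (n34 m.*2)^-1%:C * \sum_(k < m.*2.+1) (central_ratio z g m k)%:C * cexp (zeta * (site m k)%:C).
  rewrite /laplace /riemann_sum; apply/eqP; rewrite eq_complex; apply/andP; split; apply/eqP.
    rewrite (Re_scale (n34 m.*2)^-1) Re_sum; congr (_ * _).
    by apply: eq_bigr => k _; rewrite (Re_scale (central_ratio z g m k)).
  rewrite (Im_scale (n34 m.*2)^-1) Im_sum; congr (_ * _).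
  by apply: eq_bigr => k _; rewrite (Im_scale (central_ratio z g m k)).
rewrite /Z_ /P_ /kappa doubleK big_mkord.
rewrite mulrA -rmorphM mulfK ?gt_eqF// mulr_sumr mulr_sumr.
apply: eq_bigr => k _; rewrite mulrA -rmorphM /central_ratio [C_ z g m.*2 m * _]mulrC divfK ?gt_eqF//.
rewrite mulrCA; congr (_ * _).
set w := cexp _; have w0 : w ^+ m != 0 by rewrite expf_neq0// cexp_neq0.
apply: (mulfI w0); rewrite mulrA divff// mul1r /w !cexpX -cexpD; congr cexp.
rewrite /site rmorphM rmorphB /= fmorphV !rmorph_nat.
have N0 : (n34 m.*2)%:C != 0 :> R[i] by rewrite -normc_gt0 normc_real gtr0_norm.
by field.
Qed.

Lemma G_laplace m zeta : (0 < m)%N ->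
  G_ z g m.*2 zeta = laplace (fun f => riemann_sum z g f m) zeta.
Proof.
move=> m0; have n0 : (0 < m.*2)%N by rewrite double_gt0.
rewrite /G_ Z_laplace// /kappa doubleK mulrC mulKf//.
rewrite -normc_gt0 normc_real gtr0_norm ?mulr_gt0 ?n34_gt0//.
  by rewrite C_gt0// -addnn leq_addr.
by rewrite C_gt0// -addnn leq_addr.
Qed.

Lemma laplace_at0 (L : (R -> R) -> R) : positive_functional L ->
  laplace L 0 = (L (fun=> 1))%:C.
Proof.
move=> HL; rewrite /laplace -complexr0; congr (_ +i* _).
  by congr L; apply/funext => x; rewrite mul0r cexp0.
rewrite -[RHS](posfun0 HL); congr L; apply/funext => x.
by rewrite mul0r cexp0.
Qed.

Lemma limit_integral1_gt0 : 0 < limit_integral (fun=> 1).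
Proof.
pose d := expR (- (`|g| + B_ z / 12)).
have mI : measurable (`[0, 1]%classic : set R) by exact: measurable_itv.
have iI : mu.-integrable setT (EFin \o (fun x => d * \1_(`[0%R, 1%R]%classic : set R) x)).
  have := integrable_indic_itv (0 : R) 1 true false => /= h.
  by have := integrableZl measurableT d h; apply: eq_integrable.
have m1 := exp_bounded_cst (1 : R).
apply: (@lt_le_trans _ _ (\int[mu]_x (d * \1_(`[0%R, 1%R]%classic : set R) x))).
  rewrite RintegralZl//; last exact: (integrable_indic_itv (0 : R) 1 true false).
  rewrite mulr_gt0 ?expR_gt0// /Rintegral integral_indic//= setIT.
  by rewrite lebesgue_measure_itv /= lte_fin ltr01 -EFinB subr0 /= ltr01.
apply: le_Rintegral => //; first exact: limit_integrable.
move=> x _; rewrite indicE mulr1; have [xI|_] := boolP (x \in _); last first.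
  by rewrite mulr0 expR_ge0.
rewrite mulr1 ler_expR; move: xI; rewrite inE /= in_itv /= => /andP[x0 x1].
have B0 := B_gt0 z0.
have x2 : 0 <= x ^+ 2 <= 1 by rewrite sqr_ge0 exprn_ile1.
have x4 : 0 <= x ^+ 4 <= 1 by rewrite exprn_ge0// exprn_ile1.
have g0 := ler_norm (- g); rewrite normrN in g0.
have g00 := normr_ge0 g.
rewrite /quartic; move: x2 x4; move: (x ^+ 2) (x ^+ 4) => s t /andP[s0 s1] /andP[t0 t1].
have h1 : - `|g| <= g * s.
  rewrite lerNl -mulNr; apply: (@le_trans _ _ (`|g| * s)); first by rewrite ler_wpM2r.
  by rewrite ler_piMr.
have h2 : B_ z / 12 * t <= B_ z / 12 by rewrite ler_piMr// divr_ge0// ltW.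
lra.
Qed.

End Functionals.

(** * Convergence of the partition functions and of their zeros *)

#[global] Instance even_oo_filter : Filter even_oo.
Proof. exact: within_filter. Qed.

Section MainParts.
Context {R : realType}.
Variables (z g : R).
Hypothesis z0 : 0 < z.
Implicit Types (f h : R -> R) (zeta : R[i]) (x s t : R) (n m k : nat).

Local Notation mu := (@lebesgue_measure R).

Lemma even_oo_ge N : \forall n \near even_oo, (N <= n)%N.
Proof. by exists N => // n /= Nn _. Qed.

Lemma even_oo_half : \forall n \near even_oo, n./2.*2 = n.
Proof. by exists 0%N => // n _ /= /even_halfK. Qed.

Lemma even_oo_pos : \forall n \near even_oo, (0 < n./2)%N.
Proof. by exists 2%N => // n /= n2 _; rewrite half_gt0. Qed.

Lemma cvg_half : n./2 @[n --> even_oo] --> \oo.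
Proof.
move=> A [N _ HN]; exists N.*2 => // n /= Nn _; apply: HN => /=.
by rewrite -leq_double; have := odd_double_half n; lia.
Qed.

Lemma riemann_sum_cvg_even f : exp_bounded f ->
  riemann_sum z g f n./2 @[n --> even_oo] --> limit_integral z g f.
Proof.
move=> mf; apply: (@cvg_comp _ _ _ (fun n => n./2) (fun m => riemann_sum z g f m) _ _ _ cvg_half).
exact: riemann_sum_cvg.
Qed.

Lemma I_pseval : I_ z g = pseval (moment_coef (limit_integral z g)).
Proof.
apply/funext => zeta; rewrite (I_laplace _ _ zeta) pseval_moment//; exact: limit_integral_posfun.
Qed.

Lemma entire_coef_I : entire_coef (moment_coef (limit_integral z g)).
Proof. by apply: entire_coef_moment; exact: limit_integral_posfun. Qed.

Definition G_coef n := moment_coef (fun f => riemann_sum z g f n./2).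

Lemma entire_coef_G n : entire_coef (G_coef n).
Proof. by apply: entire_coef_moment; exact: riemann_sum_posfun. Qed.

Lemma G_pseval : \forall n \near even_oo, forall zeta,
  G_ z g n zeta = pseval (G_coef n) zeta.
Proof.
near=> n => zeta.
have n2 : n./2.*2 = n by near: n; exact: even_oo_half.
have m0 : (0 < n./2)%N by near: n; exact: even_oo_pos.
have <- : G_ z g n./2.*2 zeta = G_ z g n zeta by rewrite n2.
by rewrite (G_laplace g z0 zeta m0) -(pseval_moment (riemann_sum_posfun z g n./2)).
Unshelve. all: by end_near. Qed.

Lemma coef_cvg_G : coef_cvg G_coef even_oo (moment_coef (limit_integral z g)).
Proof.
apply: (coef_cvg_moment even_oo_filter (fun n => riemann_sum_posfun z g n./2) (limit_integral_posfun g z0)).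
by move=> f; exact: riemann_sum_cvg_even.
Qed.

Lemma I_entire : entire (I_ z g).
Proof. by move=> w; rewrite I_pseval; exact/derivable_pseval/entire_coef_I. Qed.

Lemma G_locally_uniform : locally_uniform_cvg (G_ z g) even_oo (I_ z g).
Proof.
apply: locally_uniform_discs => r e r0 e0; rewrite I_pseval.
have H := coef_cvg_uniform even_oo_filter entire_coef_G entire_coef_I coef_cvg_G r0 e0.
near=> n => v vr.
have -> : G_ z g n v = pseval (G_coef n) v by move: v vr => v _; move: v; near: n; exact: G_pseval.
by move: v vr; near: n.
Unshelve. all: by end_near. Qed.

Lemma I_0 : I_ z g 0 = (limit_integral z g (fun=> 1))%:C.
Proof. by rewrite (I_laplace _ _ 0) laplace_at0//; exact: limit_integral_posfun. Qed.

Lemma I0_neq0 : I_ z g 0 != 0.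
Proof. by rewrite I_0 -normc_gt0 normc_real gtr0_norm limit_integral1_gt0. Qed.

Let total := limit_integral z g (fun=> 1).
Let mass n := riemann_sum z g (fun=> 1) n./2.

Lemma mass_cvg : mass n @[n --> even_oo] --> total.
Proof. exact: riemann_sum_cvg_even (exp_bounded_cst 1). Qed.

(** The quotients are the Laplace transforms of normalized functionals. *)
Lemma ratio_locally_uniform :
  locally_uniform_cvg (fun n zeta => G_ z g n zeta / G_ z g n 0) even_oo
    (fun zeta => I_ z g zeta / I_ z g 0).
Proof.
have J10 : 0 < total := limit_integral1_gt0 g z0.
(* The absolute value makes the positivity of [L n] immediate. *)
pose L n f := `|(mass n)^-1| * riemann_sum z g f n./2.
pose L' f := total^-1 * limit_integral z g f.
have pL n : positive_functional (L n) by apply: posfunZ => //; exact: riemann_sum_posfun.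
have pL' : positive_functional L' by apply: posfunZ;
  [rewrite invr_ge0 ltW|exact: limit_integral_posfun].
have cL f : exp_bounded f -> L n f @[n --> even_oo] --> L' f.
  move=> mf; have -> : L' f = `|total^-1| * limit_integral z g f by rewrite gtr0_norm ?invr_gt0.
  apply: cvgM; last exact: riemann_sum_cvg_even.
  by apply: cvg_norm; apply: cvgV; [rewrite gt_eqF|exact: mass_cvg].
have cE := coef_cvg_moment even_oo_filter pL pL' cL.
apply: locally_uniform_discs => r e r0 e0.
have H := coef_cvg_uniform even_oo_filter (fun n => entire_coef_moment (pL n)) (entire_coef_moment pL') cE r0 e0.
near=> n.
have GE : forall zeta, G_ z g n zeta = pseval (G_coef n) zeta by near: n; exact: G_pseval.
have s10 : 0 < mass n by near: n; exact: cvgr_gt mass_cvg _ J10.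
move=> v vr.
have -> : G_ z g n v / G_ z g n 0 = pseval (moment_coef (L n)) v.
  rewrite !GE !pseval_moment//; try exact: riemann_sum_posfun.
  rewrite (laplace_at0 (riemann_sum_posfun z g n./2)) (laplaceZ (fun f => riemann_sum z g f n./2)).
  by rewrite -/(mass n) gtr0_norm ?invr_gt0// fmorphV mulrC.
have -> : I_ z g v / I_ z g 0 = pseval (moment_coef L') v.
  rewrite I_0 -/total (I_laplace _ _ v) pseval_moment// (laplaceZ (limit_integral z g)) fmorphV mulrC//.
by move: v vr; near: n.
Unshelve. all: by end_near. Qed.

Lemma S_eq_Z1 n : (S_ z g n)%:C = Z_ z g n 1.
Proof.
rewrite /Z_ /P_ /S_ expr1n invr1 mul1r rmorph_sum; apply: eq_bigr => k _.
by rewrite expr1n mulr1.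
Qed.

Lemma S_riemann_sum m : (0 < m)%N ->
  S_ z g m.*2 = C_ z g m.*2 m * n34 m.*2 * riemann_sum z g (fun=> 1) m.
Proof.
move=> m0; have n0 : (0 < m.*2)%N by rewrite double_gt0.
have n34p := n34_gt0 (R := R) n0.
have C0 : 0 < C_ z g m.*2 m by rewrite C_gt0// -addnn leq_addr.
rewrite /riemann_sum /S_ big_mkord mulrA mulfK ?gt_eqF// mulr_sumr.
by apply: eq_bigr => k _; rewrite mulr1 /central_ratio mulrC divfK ?gt_eqF.
Qed.

Lemma S_riemann_sum_even : \forall n \near even_oo,
  S_ z g n = C_ z g n (kappa n) * n34 n * mass n.
Proof.
near=> n.
have n2 : n./2.*2 = n by near: n; exact: even_oo_half.
have m0 : (0 < n./2)%N by near: n; exact: even_oo_pos.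
by have := S_riemann_sum m0; rewrite n2.
Unshelve. all: by end_near. Qed.

Lemma S_asymptotic : exists2 e : nat -> R, e n @[n --> even_oo] --> (0 : R) &
  \forall n \near even_oo,
    (S_ z g n)%:C =
      (C_ z g n (kappa n) * n34 n)%:C * I_ z g 0 * (1 + e n)%:C.
Proof.
have J10 : 0 < total := limit_integral1_gt0 g z0.
exists (fun n => mass n / total - 1).
  have h : mass n / total - 1 @[n --> even_oo] --> total / total - 1.
    by apply: cvgB; [apply: cvgM; [exact: mass_cvg|exact: cvg_cst]|exact: cvg_cst].
  by rewrite divff ?subrr ?gt_eqF// in h.
apply: filterS S_riemann_sum_even => n ->; rewrite I_0 -/total -!rmorphM; congr (_%:C).
by field; rewrite gt_eqF.
Qed.

(** [Z_ z g n] is a nonzero multiple of [G_ z g n], whose Taylor sequences converge. *)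
Lemma Z_zero_count (U : set (Cplx R)) : bounded_set U -> open U ->
  (forall w, boundary U w -> I_ z g w != 0) ->
  \forall n \near even_oo, exists N : nat,
    zero_count (fun zeta => Z_ z g n (cexp (zeta / (n34 n)%:C))) U N /\
    zero_count (I_ z g) U N.
Proof.
move=> Ub Uo Ubd; rewrite I_pseval; rewrite I_pseval in Ubd.
apply: (hurwitz_zero_count even_oo_filter even_oo_ge (v0 := 0) entire_coef_G entire_coef_I coef_cvg_G) => //.
  by rewrite -I_pseval I0_neq0.
near=> n; have n2 : n./2.*2 = n by near: n; exact: even_oo_half.
have m0 : (0 < n./2)%N by near: n; exact: even_oo_pos.
exists (C_ z g n./2.*2 n./2 * n34 n./2.*2)%:C.
  have n0 : (0 < n./2.*2)%N by rewrite double_gt0.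
  rewrite -normc_gt0 normc_real gtr0_norm ?mulr_gt0 ?n34_gt0//.
    by rewrite C_gt0// -addnn leq_addr.
  by rewrite C_gt0// -addnn leq_addr.
move=> v; have := Z_laplace g z0 v m0; rewrite n2 => ->.
by rewrite -(pseval_moment (riemann_sum_posfun z g n./2)).
Unshelve. all: by end_near. Qed.

End MainParts.

(** * Weak convergence of the measures *)

Section Density.
Context d (T : measurableType d) (R : realType).
Variables (mu nu : {measure set T -> \bar R}) (p : T -> R).
Hypothesis mp : measurable_fun [set: T] p.
Hypothesis p0 : forall x, 0 <= p x.
Hypothesis nuE : forall V, measurable V -> nu V = (\int[mu]_(x in V) (p x)%:E)%E.

Import HBNNSimple.

Let density_nnsfun (s : {nnsfun T >-> R}) :
  (\int[nu]_x (s x)%:E = \int[mu]_x (s x * p x)%:E)%E.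
Proof.
rewrite integralT_nnsfun sintegralE.
have ms y : measurable (s @^-1` [set y]) by exact: measurable_sfunP.
have E x : (s x * p x)%:E = (\sum_(y \in range s)
    (y * (\1_(s @^-1` [set y]) x * p x))%:E)%E.
  rewrite {1}fimfunE fsumEFin// (fsbig_finite _ _ (fimfunP s)) mulr_suml.
  rewrite [RHS](congr1 EFin (fsbig_finite _ _ (fimfunP s))); congr EFin.
  by apply: eq_bigr => y _; rewrite mulrA.
under [RHS]eq_integral do rewrite E.
have y0 y x : 0 <= y * (\1_(s @^-1` [set y]) x * p x).
  rewrite indicE; have [|_] := boolP (x \in _); last by rewrite mul0r mulr0.
  by rewrite inE /= => <-; rewrite mul1r mulr_ge0.
have mi y : measurable_fun [set: T] (fun x => (\1_(s @^-1` [set y]) x * p x)).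
  by apply: measurable_funM => //; exact: measurable_indic.
rewrite ge0_integral_fsum//; last 2 first.
- by move=> y; apply/measurable_EFinP; apply: measurable_funM.
- by move=> y x _; rewrite lee_fin.
apply: eq_fsbigr => y; rewrite inE => -[t _ yt].
have yge : 0 <= y by rewrite -yt.
under [RHS]eq_integral do rewrite EFinM.
rewrite ge0_integralZl//; last 2 first.
- exact/measurable_EFinP.
- by move=> x _; rewrite lee_fin mulr_ge0.
congr (_ * _)%E; rewrite nuE// integral_mkcond; apply: eq_integral => x _.
rewrite /patch indicE; case: ifPn => _; first by rewrite mul1r.
by rewrite mul0r.
Qed.

(** From simple functions by monotone convergence. *)
Lemma density_integral (h : T -> R) : measurable_fun [set: T] h ->
  (forall x, 0 <= h x) ->
  (\int[nu]_x (h x)%:E = \int[mu]_x (h x * p x)%:E)%E.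
Proof.
move=> mh h0; have mh' : measurable_fun [set: T] (EFin \o h) by exact/measurable_EFinP.
pose s := nnsfun_approx measurableT mh'.
have cs x : (s n x)%:E @[n --> \oo] --> (h x)%:E.
  by apply: cvg_nnsfun_approx => // y _ /=; rewrite lee_fin.
have -> : (\int[nu]_x (h x)%:E = limn (fun n => \int[nu]_x (s n x)%:E))%E.
  rewrite -monotone_convergence//=.
  - by apply: eq_integral => x _; apply/esym/cvg_lim.
  - by move=> n; apply/measurable_EFinP.
  - by move=> n x _; rewrite lee_fin.
  - by move=> x _ m n mn; rewrite lee_fin; exact/lefP/nd_nnsfun_approx.
have -> : (\int[mu]_x (h x * p x)%:E = limn (fun n => \int[mu]_x (s n x * p x)%:E))%E.
  rewrite -monotone_convergence//=.
  - apply: eq_integral => x _; apply/esym/cvg_lim => //.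
    under eq_fun do rewrite EFinM; rewrite EFinM; apply: cvgeZr => //; exact: cs.
  - by move=> n; apply/measurable_EFinP; apply: measurable_funM.
  - by move=> n x _; rewrite lee_fin mulr_ge0.
  - by move=> x _ m n mn; rewrite lee_fin ler_wpM2r//; exact/lefP/nd_nnsfun_approx.
by congr (limn _); apply/funext => n; exact: density_nnsfun.
Qed.

End Density.

(** A constant shift makes a bounded function nonnegative, and integrals of nonnegative
functions against densities or sums of point masses are unconditional. *)
Lemma prob_Rintegral_shift d (T : measurableType d) (R : realType)
    (nu : {measure set T -> \bar R}) (f : T -> R) (K : R) :
  nu setT = 1%E -> measurable_fun [set: T] f -> (forall x, `|f x| <= K) ->
  \int[nu]_x f x = \int[nu]_x (f x + K) - K.
Proof.
move=> nu1 mf fK.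
have icst (c : R) : nu.-integrable setT (EFin \o (fun=> c)).
  apply/integrableP; split; first exact: measurable_cst.
  under eq_integral do rewrite /=.
  by rewrite integral_cst//= nu1 mule1 ltry.
have if_ : nu.-integrable setT (EFin \o f).
  apply: (@le_integrable _ _ _ _ _ measurableT _ (EFin \o (fun=> K))) => //.
    exact/measurable_EFinP.
  by move=> x _ /=; rewrite lee_fin; apply: le_trans (fK x) (ler_norm _).
by rewrite RintegralD// Rintegral_cst// nu1 /= mulr1 addrK.
Qed.

Section Measures.
Context {R : realType}.
Variables (z g : R).
Hypothesis z0 : 0 < z.
Implicit Types (f h : R -> R) (zeta : R[i]) (x s t : R) (n m k : nat).

Local Notation mu := (@lebesgue_measure R).

Lemma nu_double_setT m : (0 < m)%N -> nu_ z g m.*2 setT = 1%E.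
Proof.
move=> m0; have n0 : (0 < m.*2)%N by rewrite double_gt0.
transitivity ((S_ z g m.*2)^-1%:E * \sum_(k < m.*2.+1) (C_ z g m.*2 k)%:E)%E.
  rewrite /nu_ {1}/mscale; congr (_ * _)%E; apply: eq_bigr => k _.
  by rewrite /= /mscale /= diracT mule1.
rewrite sumEFin -EFinM /S_ big_mkord mulVf// gt_eqF//.
rewrite (bigD1 ord0)//= ltr_pwDl//; first by rewrite C_gt0.
by apply: sumr_ge0 => k _; exact: C_ge0.
Qed.

Lemma nu_double_integral m h : (0 < m)%N ->
  measurable_fun [set: measurableTypeR R] h -> (forall x, 0 <= h x) ->
  (\int[nu_ z g m.*2]_x (h x)%:E)%E =
  ((S_ z g m.*2)^-1 * \sum_(k < m.*2.+1) C_ z g m.*2 k * h (site m k))%:E.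
Proof.
move=> m0 mh h0; have mh' : measurable_fun [set: measurableTypeR R] (EFin \o h).
  exact/measurable_EFinP.
rewrite /nu_ (ge0_integral_mscale _ measurableT)//=; last by move=> x _; rewrite lee_fin.
rewrite (ge0_integral_measure_sum _ measurableT)//=; last by move=> x _; rewrite lee_fin.
rewrite EFinM -sumEFin; congr (_ * _)%E; apply: eq_bigr => k _.
rewrite (ge0_integral_mscale _ measurableT)//=; last by move=> x _; rewrite lee_fin.
by rewrite integral_dirac// diracT mul1e -EFinM /kappa doubleK.
Qed.

Lemma nu_limit_integral h : measurable_fun [set: measurableTypeR R] h ->
  (forall x, 0 <= h x) ->
  (\int[nu_limit z g]_x (h x)%:E = \int[mu]_x (h x * nu_density z g x)%:E)%E.
Proof.
move=> mh h0; apply: (@density_integral _ (measurableTypeR R) R mu) => //.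
- exact: measurable_nu_density.
- by move=> x; exact: nu_density_ge0.
Qed.

Lemma nu_limit_Rintegral f : exp_bounded f -> (forall x, 0 <= f x) ->
  \int[nu_limit z g]_x f x = limit_integral z g f / limit_integral z g (fun=> 1).
Proof.
move=> mf f0; rewrite /Rintegral nu_limit_integral//; last first.
  exact: (continuous_measurable_fun mf.1).
rewrite -/(Rintegral mu setT (fun x => f x * nu_density z g x)).
have JE : complex.Re (I_ z g 0) = limit_integral z g (fun=> 1) by rewrite I_0.
rewrite -JE [RHS]mulrC /limit_integral -RintegralZl//; last exact: (limit_integrable g z0 mf).
by apply: eq_Rintegral => x _; rewrite /nu_density; ring.
Qed.

Lemma nu_limit_setT : nu_limit z g setT = 1%E.
Proof.
have J10 : 0 < limit_integral z g (fun=> 1) := limit_integral1_gt0 g z0.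
have m1 := exp_bounded_cst (1 : R).
rewrite /nu_limit.
have -> : (\int[mu]_x (nu_density z g x)%:E =
   \int[mu]_x ((limit_integral z g (fun=> 1))^-1%:E * (expR (quartic z g x) * 1)%:E))%E.
  by apply: eq_integral => x _; rewrite /nu_density I_0//= mulr1.
have i1 := limit_integrable g z0 m1.
rewrite integralZl//.
have -> : (\int[mu]_x (expR (quartic z g x) * 1)%:E = (limit_integral z g (fun=> 1))%:E)%E.
  by rewrite /limit_integral /Rintegral fineK//; exact: integrable_fin_num i1.
by rewrite -EFinM mulVf// gt_eqF.
Qed.

Lemma bounded_fun_exp_bounded f : continuous f -> bounded_fun f ->
  exp_bounded f /\ exists2 K : R, 0 <= K & forall x, `|f x| <= K.
Proof.
move=> fc [M [_ HM]].
have H x : `|f x| <= `|M| + 1 by apply: HM => //; rewrite ltr_pwDr// ler_norm.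
split; first by split => //; exists (`|M| + 1), 0 => x; rewrite mul0r expR0 mulr1.
by exists (`|M| + 1).
Qed.

Lemma weighted_mean m h : (0 < m)%N ->
  (S_ z g m.*2)^-1 * \sum_(k < m.*2.+1) C_ z g m.*2 k * h (site m k) =
  riemann_sum z g h m / riemann_sum z g (fun=> 1) m.
Proof.
move=> m0; have n0 : (0 < m.*2)%N by rewrite double_gt0.
have n34p := n34_gt0 (R := R) n0.
have C0 : 0 < C_ z g m.*2 m by rewrite C_gt0// -addnn leq_addr.
have -> : \sum_(k < m.*2.+1) C_ z g m.*2 k * h (site m k) =
    C_ z g m.*2 m * n34 m.*2 * riemann_sum z g h m.
  rewrite /riemann_sum mulrA mulfK ?gt_eqF// mulr_sumr; apply: eq_bigr => k _.
  by rewrite mulrA /central_ratio [C_ z g m.*2 m * _]mulrC divfK ?gt_eqF.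
rewrite S_riemann_sum// invfM mulrAC mulrA mulrAC mulVf ?mul1r; last by rewrite gt_eqF ?mulr_gt0.
by rewrite mulrC.
Qed.

(** A bounded continuous function is a test function, and its means are quotients of
convergent Riemann sums. *)
Lemma nu_weak_cvg : weak_cvg (nu_ z g) even_oo (nu_limit z g).
Proof.
move=> f fc fb; have [mf [K K0 fK]] := bounded_fun_exp_bounded fc fb.
have mfm : measurable_fun [set: measurableTypeR R] f by exact: continuous_measurable_fun.
have mfK : exp_bounded (fun x => f x + K) by exact: exp_boundedD (exp_bounded_cst K).
have fK0 x : 0 <= f x + K by rewrite -lerBlDr sub0r; have := fK x; rewrite ler_norml => /andP[].
have J10 : 0 < limit_integral z g (fun=> 1) := limit_integral1_gt0 g z0.
rewrite (prob_Rintegral_shift nu_limit_setT mfm fK) nu_limit_Rintegral//.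
have h : riemann_sum z g (fun x => f x + K) n./2 / riemann_sum z g (fun=> 1) n./2 - K @[n --> even_oo] -->
   limit_integral z g (fun x => f x + K) / limit_integral z g (fun=> 1) - K.
  apply: cvgB; last exact: cvg_cst.
  apply: cvgM; first exact: riemann_sum_cvg_even.
  apply: cvgV; first by rewrite gt_eqF.
  exact: riemann_sum_cvg_even (exp_bounded_cst 1).
apply: cvg_trans h; apply: near_eq_cvg; near=> n.
have n2 : n./2.*2 = n by near: n; exact: even_oo_half.
have m0 : (0 < n./2)%N by near: n; exact: even_oo_pos.
have := nu_double_setT m0; rewrite n2 => nu1.
rewrite (prob_Rintegral_shift nu1 mfm fK); congr (_ - _).
rewrite /Rintegral; have := nu_double_integral m0 (h := fun x => f x + K) _ fK0.
rewrite n2 => ->; last by apply: measurable_funD => //; exact: measurable_cst.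
have := weighted_mean (fun x => f x + K) m0; rewrite n2 /= => ->.
by [].
Unshelve. all: by end_near. Qed.

End Measures.

(** * Zeros on the imaginary axis *)

Section RealZeros.
Context {R : realType}.
Variables (z g : R).
Hypothesis z0 : 0 < z.
Implicit Types (f h : R -> R) (zeta : R[i]) (x s t : R) (n m k : nat).

Definition cosx s x : R := cos (x * s).

Lemma Re_cexp_i s : (fun x => complex.Re (cexp (('i%C * s%:C : R[i]) * x%:C))) = cosx s.
Proof.
apply/funext => x; rewrite Re_cexpx /=.
by rewrite !(mul0r, mulr0, mul1r, subr0, addr0, add0r, expR0, oppr0).
Qed.

Lemma Im_cexp_i s : (fun x => complex.Im (cexp (('i%C * s%:C : R[i]) * x%:C))) =
  (fun x => sin (x * s)).
Proof.
apply/funext => x; rewrite Im_cexpx /=.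
by rewrite !(mul0r, mulr0, mul1r, subr0, addr0, add0r, expR0, oppr0).
Qed.

Lemma exp_bounded_cosx s : exp_bounded (cosx s).
Proof. by rewrite -Re_cexp_i; exact: exp_bounded_Re_cexp. Qed.

(** The weights are symmetric about the centre, and the sine is odd. *)
Lemma riemann_sum_sin m s : (0 < m)%N -> riemann_sum z g (fun x => sin (x * s)) m = 0.
Proof.
move=> m0; have n0 : (0 < m.*2)%N by rewrite double_gt0.
rewrite /riemann_sum; set S := \sum_(k < _) _.
suff : S = - S by move=> h; rewrite (_ : S = 0) ?mulr0//; lra.
rewrite {1}/S (reindex_inj rev_ord_inj) /= -sumrN; apply: eq_bigr => k _.
have km : (k <= m.*2)%N by have := ltn_ord k.
rewrite subSS /central_ratio (C_sym g z0 n0 km) -mulrN; congr (_ * _).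
rewrite -sinN -mulNr; congr (sin (_ * _)).
have E : m.*2%:R = 2 * m%:R :> R by rewrite -muln2 natrM mulrC.
by rewrite /site natrB// E; ring.
Qed.

Lemma laplace_riemann_sum_i m s : (0 < m)%N ->
  laplace (fun f => riemann_sum z g f m) ('i%C * s%:C) = (riemann_sum z g (cosx s) m)%:C.
Proof. by move=> m0; rewrite /laplace Re_cexp_i Im_cexp_i riemann_sum_sin. Qed.

(** The imaginary part is a limit of Riemann sums that vanish. *)
Lemma I_imaginary_axis s : I_ z g ('i%C * s%:C) = (limit_integral z g (cosx s))%:C.
Proof.
rewrite (I_laplace _ _ ('i%C * s%:C)) /laplace Re_cexp_i Im_cexp_i; congr (_ +i* _).
have ms : exp_bounded (fun x => sin (x * s)) by rewrite -Im_cexp_i; exact: exp_bounded_Im_cexp.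
have h0 : riemann_sum z g (fun x => sin (x * s)) m @[m --> \oo] --> (0 : R).
  by apply: cvg_near_cst; exists 1%N => // m /= m0; exact: riemann_sum_sin.
by rewrite -(cvg_lim (@Rhausdorff R) (riemann_sum_cvg (g := g) z0 ms)) (cvg_lim (@Rhausdorff R) h0).
Qed.

(** [F s / (s - s0) = h s] is within half of [normc (h s0)] of the nonzero [h s0], so
its values at [s0 - t] and [s0 + t] have the same sign. *)
Lemma simple_zero_sign (f : Cplx R -> Cplx R) (F : R -> R) (s0 : R) :
  (forall s, f s%:C = (F s)%:C) -> zero_order f s0%:C 1 ->
  exists2 e0, 0 < e0 & forall t, 0 < t < e0 -> F (s0 - t) * F (s0 + t) < 0.
Proof.
move=> fF [h [hd h0 hE]].
have hc : {for (s0%:C : Cplx R), continuous h}.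
  apply: differentiable_continuous; apply/derivable1_diffP.
  exact: (nbhs_singleton hd).
pose G := normc (h s0%:C); have G0 : 0 < G by rewrite normc_gt0.
have hn : nbhs (s0%:C : Cplx R) (fun v => normc (h v - h s0%:C) < G / 2).
  apply: (hc [set y | normc (y - h s0%:C) < G / 2]); apply/nbhs_normcP.
  by exists (G / 2) => //; rewrite divr_gt0.
move/nbhs_normcP: hE => [e1 e10 He1]; move/nbhs_normcP: hn => [e2 e20 He2].
have e00 : 0 < Num.min e1 e2 by rewrite lt_min e10.
have He v : normc (v - s0%:C) < Num.min e1 e2 ->
    f v = (v - s0%:C) ^+ 1 * h v /\ normc (h v - h s0%:C) < G / 2.
  by rewrite lt_min => /andP[/He1 ? /He2].
set e0 := Num.min e1 e2 in e00 He.
exists e0 => // t /andP[t0 te].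
have key s : normc (s%:C - s0%:C : R[i]) < e0 -> s != s0 ->
    `|F s / (s - s0)| > G / 2 /\ h s%:C = (F s / (s - s0))%:C /\
    normc (h s%:C - h s0%:C) < G / 2.
  move=> hs ss; have [E1 E2] := He s%:C hs.
  have d0 : s - s0 != 0 by rewrite subr_eq0.
  have hsE : h s%:C = (F s / (s - s0))%:C.
    have dC : (s - s0)%:C != 0 :> R[i] by rewrite -normc_gt0 normc_real normr_gt0.
    have E3 : (s - s0)%:C * (F s / (s - s0))%:C = (F s)%:C :> R[i].
      by rewrite -(rmorphM (real_complex R)) mulrC divfK.
    by apply: (mulfI dC); rewrite E3 -fF E1 expr1 rmorphB.
  split; last by [].
  rewrite -normc_real -hsE; have := normcB (h s%:C) (h s%:C - h s0%:C).
  by rewrite opprB addrCA subrr addr0 -/G; move: E2; rewrite /=; lra.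
have [|| A1 [A2 A3]] := key (s0 + t).
- by rewrite -rmorphB /= normc_real addrAC subrr add0r gtr0_norm.
- by rewrite -subr_eq0 addrAC subrr add0r gt_eqF.
have [|| B1 [B2 B3]] := key (s0 - t).
- by rewrite -rmorphB /= normc_real addrAC subrr add0r normrN gtr0_norm.
- by rewrite -subr_eq0 addrAC subrr add0r oppr_eq0 gt_eqF.
have := normc_distD (h s0%:C) (h (s0 + t)%:C) (h (s0 - t)%:C).
rewrite (normc_distC (h s0%:C)) A2 B2 -rmorphB normc_real.
rewrite -A2 -B2; move: A1 B1 A3 B3; rewrite addrAC subrr add0r [s0 - t - s0]addrAC subrr add0r.
rewrite invrN mulrN.
set a := F (s0 + t) / t; set b := F (s0 - t) / t => A1 B1 A3 B3 h1.
have aE : F (s0 + t) = a * t by rewrite /a divfK ?gt_eqF.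
have bE : F (s0 - t) = b * t by rewrite /b divfK ?gt_eqF.
have ab : `|a + b| < G.
  move: h1; rewrite opprK => h1; apply: le_lt_trans h1 _; lra.
rewrite normrN in B1.
rewrite aE bE mulrACA pmulr_llt0 ?mulr_gt0//.
move: A1 B1 ab;  have [a0|a0] := lerP 0 a; have [b0|b0] := lerP 0 b.
- rewrite (ger0_norm a0) (ger0_norm b0) (ger0_norm (addr_ge0 a0 b0)) => *; lra.
- by move=> A1 _ _; rewrite nmulr_rlt0// lt_neqAle a0 andbT; apply/eqP => E; move: A1;
  rewrite -E normr0; lra.
- by move=> _ B1 _; rewrite nmulr_llt0// lt_neqAle b0 andbT; apply/eqP => E; move: B1;
  rewrite -E normr0; lra.
- have ab0 : a + b < 0 by lra.
  rewrite (ltr0_norm a0) (ltr0_norm b0) (ltr0_norm ab0) => *; lra.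
Qed.

Lemma riemann_sum_cos_continuous m : continuous (fun s => riemann_sum z g (cosx s) m).
Proof.
move=> s; rewrite /riemann_sum; apply: cvgM; first exact: cvg_cst.
elim: (m.*2.+1) => [|N IH].
  by under eq_fun do rewrite big_ord0; rewrite big_ord0; exact: cvg_cst.
under eq_fun do rewrite big_ord_recr /=; rewrite big_ord_recr /=.
apply: cvgD; first exact: IH.
apply: cvgM; first exact: cvg_cst.
apply: (@continuous_comp _ _ _ (fun s => site m N * s) cos); last exact: continuous_cos.
by apply: cvgM; [exact: cvg_cst|exact: cvg_id].
Qed.

Lemma P_zero_riemann_sum m s : (0 < m)%N ->
  P_ z g m.*2 (cexp ('i%C * (s / n34 m.*2)%:C)) = 0 <-> riemann_sum z g (cosx s) m = 0.
Proof.
move=> m0; have n0 : (0 < m.*2)%N by rewrite double_gt0.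
have n34p := n34_gt0 (R := R) n0.
have C0 : 0 < C_ z g m.*2 m by rewrite C_gt0// -addnn leq_addr.
have := Z_laplace g z0 ('i%C * s%:C) m0; rewrite laplace_riemann_sum_i//.
have -> : 'i%C * s%:C / (n34 m.*2)%:C = 'i%C * (s / n34 m.*2)%:C :> R[i].
  by rewrite rmorphM fmorphV mulrA.
rewrite /Z_ -rmorphM; set w := cexp _ => E.
have w0 : w ^- kappa m.*2 != 0 by rewrite invr_neq0// expf_neq0// cexp_neq0.
have K0 : C_ z g m.*2 m * n34 m.*2 != 0 by rewrite gt_eqF// mulr_gt0.
split=> [P0|r0].
  move: E; rewrite P0 mulr0 => /esym/(congr1 (@complex.Re R)) /= /eqP.
  by rewrite mulf_eq0 (negbTE K0) => /eqP.
by move: E; rewrite r0 mulr0 => /eqP; rewrite mulf_eq0 (negbTE w0) => /eqP.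
Qed.

(** At [s0 - t] and [s0 + t] the limit has opposite signs, so eventually the
approximation does too, and it vanishes in between. Here [t] is arbitrarily small. *)
Lemma real_zeros s0 :
  zero_order (fun s : Cplx R => I_ z g ('i%C * s)) (s0%:C) 1 ->
  exists2 s_ : nat -> R, s_ n @[n --> even_oo] --> s0 &
    \forall n \near even_oo,
      P_ z g n (cexp ('i%C * (s_ n / n34 n)%:C)) = 0 /\
      P_ z g n (cexp (- ('i%C * (s_ n / n34 n)%:C))) = 0.
Proof.
move=> hz; have [e0 e00 He0] := simple_zero_sign (fun s => I_imaginary_axis s) hz.
have zn e : 0 < e -> \forall n \near even_oo,
    exists2 s, riemann_sum z g (cosx s) n./2 = 0 & `|s - s0| < e.
  move=> e_gt0; pose t := Num.min e e0 / 2.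
  have t0 : 0 < Num.min e e0 by rewrite lt_min e_gt0.
  have [te te0] : Num.min e e0 <= e /\ Num.min e e0 <= e0.
    by rewrite !ge_min !lexx orbT.
  (* [t < e0] gives the sign change, [t < e] the distance. *)
  have sgn : limit_integral z g (cosx (s0 - t)) * limit_integral z g (cosx (s0 + t)) < 0.
    by apply: He0; rewrite /t; lra.
  have cv := cvgM (riemann_sum_cvg_even z0 (exp_bounded_cosx (s0 - t))) (riemann_sum_cvg_even z0 (exp_bounded_cosx (s0 + t))).
  have H : \forall n \near even_oo,
      riemann_sum z g (cosx (s0 - t)) n./2 * riemann_sum z g (cosx (s0 + t)) n./2 < 0.
    exact: cvgr_lt _ (cv _ g g) _ sgn.
  apply: filterS H => n hn.
  have ab : s0 - t <= s0 + t by rewrite /t; lra.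
  have [||c cI c0] := @IVT R (fun s => riemann_sum z g (cosx s) n./2) (s0 - t) (s0 + t) 0 ab.
  - exact/continuous_subspaceT/riemann_sum_cos_continuous.
  - rewrite ge_min le_max; apply/andP; split; apply/orP.
      case: (lerP (riemann_sum z g (cosx (s0 - t)) n./2) 0) => h1; first by left.
      by right; move: hn; rewrite pmulr_rlt0// => /ltW.
    case: (lerP 0 (riemann_sum z g (cosx (s0 - t)) n./2)) => h1; first by left.
    by right; move: hn; rewrite nmulr_rlt0// => /ltW.
  exists c => //; move: cI; rewrite in_itv /= => /andP[c1 c2].
  apply: (@le_lt_trans _ _ t); last by rewrite /t; lra.
  by rewrite ler_norml; apply/andP; split; lra.
have [s_ cs hs] := near_choice s0 even_oo_filter even_oo_ge
  (fun s => normr_ge0 (s - s0)) zn.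
exists s_.
  apply/cvgrPdist_lt => e e_gt0; move/cvgrPdist_lt/(_ _ e_gt0) : cs.
  by apply: filterS => n; rewrite sub0r normrN normr_id distrC.
near=> n.
have n2 : n./2.*2 = n by near: n; exact: even_oo_half.
have m0 : (0 < n./2)%N by near: n; exact: even_oo_pos.
have r0 : riemann_sum z g (cosx (s_ n)) n./2 = 0 by near: n.
have r0' : riemann_sum z g (cosx (- s_ n)) n./2 = 0.
  by rewrite -[RHS]r0; congr riemann_sum; apply/funext => x; rewrite /cosx mulrN cosN.
have := (P_zero_riemann_sum (s_ n) m0).2 r0; have := (P_zero_riemann_sum (- s_ n) m0).2 r0'.
by rewrite n2 mulNr rmorphN mulrN.
Unshelve. all: by end_near. Qed.

End RealZeros.

Theorem theoremA (R : realType) (z g : R) (z_gt0 : 0 < z) :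
  [/\ [/\ forall zeta : Cplx R, Cintegrable (I_integrand z g zeta),
          entire (I_ z g)
        & locally_uniform_cvg (G_ z g) even_oo (I_ z g)],
      [/\ forall n : nat, (0 < n)%N -> ~~ odd n -> (S_ z g n)%:C = Z_ z g n 1,
          exists2 e : nat -> R, e n @[n --> even_oo] --> (0 : R) &
            \forall n \near even_oo,
              (S_ z g n)%:C =
                (C_ z g n (kappa n) * n34 n)%:C * I_ z g 0 * (1 + e n)%:C
        & locally_uniform_cvg (fun n zeta => G_ z g n zeta / G_ z g n 0) even_oo
            (fun zeta => I_ z g zeta / I_ z g 0)],
      [/\ forall n : nat, (0 < n)%N -> ~~ odd n -> nu_ z g n setT = 1%E,
          nu_limit z g setT = 1%E
        & weak_cvg (nu_ z g) even_oo (nu_limit z g)],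
      forall U : set (Cplx R), bounded_set U -> open U ->
        (forall w, boundary U w -> I_ z g w != 0) ->
        \forall n \near even_oo, exists N : nat,
          zero_count (fun zeta => Z_ z g n (cexp (zeta / (n34 n)%:C))) U N /\
          zero_count (I_ z g) U N
    & forall s0 : R,
        zero_order (fun s : Cplx R => I_ z g ('i%C * s)) (s0%:C) 1 ->
        exists2 s_ : nat -> R, s_ n @[n --> even_oo] --> s0 &
          \forall n \near even_oo,
            P_ z g n (cexp ('i%C * (s_ n / n34 n)%:C)) = 0 /\
            P_ z g n (cexp (- ('i%C * (s_ n / n34 n)%:C))) = 0].
Proof.
split; [split|split|split| |].
- exact: I_integrable.
- exact: I_entire.
- exact: G_locally_uniform.
- by move=> n _ _; exact: S_eq_Z1.
- exact: S_asymptotic.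
- exact: ratio_locally_uniform.
- move=> n n0 neven; have n2 := even_halfK neven.
  by rewrite -n2; apply: nu_double_setT => //; rewrite half_gt0; case: n n0 neven {n2} => [|[]].
- exact: nu_limit_setT.
- exact: nu_weak_cvg.
- exact: Z_zero_count.
- exact: real_zeros.
Qed.
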